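(* Let $r$ be a positive integer and let $(G,v)$ be a based graph such that $G$ is simple. Then there is a group isomorphism $$\pi_1^r(G,v)\;\cong\;\pi_1(X_r(G),v),$$ where $\pi_1^r(G,v)$ is the $r$-fundamental group of $(G,v)$ and $X_r(G)$ is the 2-dimensional cell complex obtained from $|G|$ by attaching 2-cells along all $(2s)$-cycles of $G$ with $2\le s\le r$.
   Context: A graph is a pair $G=(V(G),E(G))$ with $V(G)$ a set (possibly infinite) and $E(G)\subset V(G)\times V(G)$ a symmetric subset (loops allowed, no multiple edges); it is simple if it has no loops. A graph homomorphism $f:G\to H$ is a map $V(G)\to V(H)$ sending edges to edges. A based graph $(G,v)$ is a graph with a chosen vertex $v$. $r$-fundamental group. $L_n$ ($n\ge 0$) is the graph with $V(L_n)=\{0,1,\dots,n\}$ and $E(L_n)=\{(x,y): |x-y|=1\}$. A path of length $n$ in $G$ is a graph homomorphism $\varphi:L_n\to G$; write $l(\varphi)=n$; it joins $\varphi(0)$ to $\varphi(n)$. On the set of paths joining $v$ to $w$, let $\simeq_r$ be the equivalence relation generated by the following two conditions on a pair $\varphi,\psi$: (A) $l(\psi)=l(\varphi)+2$ and there is $x\in\{0,\dots,l(\varphi)\}$ with $\psi(i)=\varphi(i)$ for $i\le x$ and $\psi(i+2)=\varphi(i)$ for $i\ge x$; (B)$_r$ $l(\varphi)=l(\psi)$ and $\#\{i: 0\le i\le l(\varphi),\ \varphi(i)\ne\psi(i)\}<r$. $\pi_1^r(G,v)$ is the set of $\simeq_r$-classes of paths from $v$ to $v$, with group operation induced by concatenation,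 $[\psi]_r\cdot[\varphi]_r=[\psi\cdot\varphi]_r$ ($\varphi$ followed by $\psi$). The complex $X_r(G)$. For a simple graph $G$, $|G|$ is the geometric realization of $G$ regarded as a 1-dimensional simplicial complex (vertices $V(G)$, 1-simplices $\{x,y\}$ for $(x,y)\in E(G)$). $C_n$ is the graph with $V(C_n)=\mathbb{Z}/n$, $E(C_n)=\{(x,x\pm1): x\in\mathbb{Z}/n\}$. An $n$-cycle of $G$ is a graph homomorphism $C_n\to G$ (not required to be injective); it induces a continuous map $S^1=|C_n|\to|G|$. $X_r(G)$ is obtained from $|G|$ by attaching one 2-cell along the map $|C_{2s}|\to|G|$ for each $(2s)$-cycle of $G$ and each $s$ with $2\le s\le r$. *)

(* Defs.v *)
From HB Require Import structures.
From mathcomp Require Import all_boot all_order all_algebra.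
From mathcomp Require Import all_classical all_reals all_analysis.
From mathcomp Require Import homotopy.
From mathcomp Require Import zify ring lra.
From Stdlib Require Import Relation_Operators.

Set Implicit Arguments.
Unset Strict Implicit.
Unset Printing Implicit Defensive.

Import Order.TTheory GRing.Theory Num.Theory.
Import numFieldNormedType.Exports.

Local Open Scope classical_set_scope.
Local Open Scope ring_scope.
Local Open Scope quotient_scope.

Section generated_equivalence.
Context {T : Type} (S : T -> T -> Prop).

Let gen (x y : T) : bool := `[< clos_refl_sym_trans T S x y >].

Let gen_refl : reflexive gen.
Proof. by move=> x; apply/asboolP; exact: rst_refl. Qed.

Let gen_sym : symmetric gen.
Proof. by move=> x y; apply/asboolP/asboolP; exact: rst_sym. Qed.

Let gen_trans : transitive gen.
Proof.
by move=> y x z /asboolP xy /asboolP yz; apply/asboolP; exact: rst_trans yz.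
Qed.

Definition generated_equiv : equiv_rel T := EquivRel gen gen_refl gen_sym gen_trans.

Lemma generated_equivP x y :
  reflect (clos_refl_sym_trans T S x y) (generated_equiv x y).
Proof. exact: asboolP. Qed.

End generated_equivalence.

Lemma clos_rst_map (T U : Type) (S : T -> T -> Prop) (S' : U -> U -> Prop)
    (f : T -> U) :
  (forall x y, S x y -> clos_refl_sym_trans U S' (f x) (f y)) ->
  forall x y, clos_refl_sym_trans T S x y -> clos_refl_sym_trans U S' (f x) (f y).
Proof.
move=> fS x y; elim=> [? ?|?|? ? _|? b ? _ + _]; first exact: fS.
- exact: rst_refl.
- exact: rst_sym.
- exact: rst_trans.
Qed.

Record graph := Graph {
  vertices :> Type;
  edge : vertices -> vertices -> Prop;
  edge_sym : forall x y, edge x y -> edge y x }.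

Definition simple_graph (G : graph) : Prop := forall x : G, ~ edge x x.

Record graph_hom (G H : graph) := GraphHom {
  hom_map :> G -> H;
  hom_edge : forall x y, edge x y -> edge (hom_map x) (hom_map y) }.

Definition line_edge (n : nat) (x y : 'I_n.+1) : Prop :=
  x.+1 = y :> nat \/ y.+1 = x :> nat.

Lemma line_edge_sym n (x y : 'I_n.+1) : line_edge x y -> line_edge y x.
Proof. by case; [right|left]. Qed.

Definition line_graph (n : nat) : graph := Graph (@line_edge_sym n).

Section gpath.
Context {G : graph}.

Record gpath (v w : G) := GPath {
  glen : nat;
  gmap : graph_hom (line_graph glen) G;
  gmap_start : gmap ord0 = v;
  gmap_end : gmap ord_max = w }.

(* Only meaningful for [i <= glen p]. *)
Definition gat (v w : G) (p : gpath v w) (i : nat) : G := gmap p (inord i).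

Implicit Types u v w : G.

Lemma gat0 v w (p : gpath v w) : gat p 0 = v.
Proof.
rewrite /gat -[RHS](gmap_start p); congr (gmap p _).
by apply/val_inj; rewrite /= inordK.
Qed.

Lemma gat_len v w (p : gpath v w) : gat p (glen p) = w.
Proof.
rewrite /gat -[RHS](gmap_end p); congr (gmap p _).
by apply/val_inj; rewrite /= inordK.
Qed.

Lemma gat_edge v w (p : gpath v w) i : (i < glen p)%N ->
  edge (gat p i) (gat p i.+1).
Proof.
by move=> ip; apply: hom_edge; left; rewrite !inordK //; lia.
Qed.

Section mkgpath.
Context (n : nat) (f : nat -> G) (v w : G).
Context (fE : forall i, (i < n)%N -> edge (f i) (f i.+1)).
Context (f0 : f 0%N = v) (fn : f n = w).

Lemma mkgpath_subproof (x y : line_graph n) : edge x y -> edge (f x) (f y).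
Proof.
case=> /= xy; [rewrite -xy; apply: fE|rewrite -xy; apply/edge_sym/fE].
  by rewrite xy -ltnS.
by rewrite xy -ltnS.
Qed.

Definition mkgpath : gpath v w :=
  @GPath v w n (@GraphHom (line_graph n) G (fun x => f x) mkgpath_subproof) f0 fn.

Lemma gat_mkgpath i : (i <= n)%N -> gat mkgpath i = f i.
Proof. by move=> ni; rewrite /gat /= inordK. Qed.

End mkgpath.

Lemma eq_gpath v w (p q : gpath v w) : glen p = glen q ->
  (forall i, (i <= glen p)%N -> gat p i = gat q i) -> p = q.
Proof.
case: p q => [n [f fE] f0 fn] [m [g gE] g0 gm] /= nm; subst m => fg.
have E : f = g.
  apply/funext => i; have := fg i; rewrite /gat /= inord_val; apply.
  by rewrite -ltnS.
clear fg; subst g; rewrite (Prop_irrelevance gE fE) in g0 gm *.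
by rewrite (Prop_irrelevance g0 f0) (Prop_irrelevance gm fn).
Qed.

Definition gpath_insert v w (p q : gpath v w) : Prop :=
  glen q = (glen p).+2 /\
  exists2 x, (x <= glen p)%N &
    (forall i, (i <= x)%N -> gat q i = gat p i) /\
    (forall i, (x <= i <= glen p)%N -> gat q i.+2 = gat p i).

Definition gpath_subst (r : nat) v w (p q : gpath v w) : Prop :=
  glen p = glen q /\
  (#|[set i : 'I_(glen p).+1 | `[< gat p i <> gat q i >] ]%SET| < r)%N.

Definition gpath_step (r : nat) v w (p q : gpath v w) : Prop :=
  gpath_insert p q \/ gpath_subst r p q.

Definition gpath_equiv (r : nat) v w : equiv_rel (gpath v w) :=
  generated_equiv (@gpath_step r v w).

Definition gpath_id v : gpath v v :=
  @mkgpath 0 (fun=> v) v v (fun i (ltn0 : (i < 0)%N) => False_ind _ (notF ltn0))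
    erefl erefl.

Section gpath_rev.
Context v w (p : gpath v w).
Let f i := gat p (glen p - i).

Let fE i : (i < glen p)%N -> edge (f i) (f i.+1).
Proof.
move=> ip; apply: edge_sym; rewrite /f subnS.
rewrite -{2}(@prednK (glen p - i)) ?subn_gt0 //.
by apply: gat_edge; lia.
Qed.

Let f0 : f 0 = w. Proof. by rewrite /f subn0 gat_len. Qed.
Let fn : f (glen p) = v. Proof. by rewrite /f subnn gat0. Qed.

Definition gpath_rev : gpath w v := mkgpath fE f0 fn.

Lemma gat_rev i : (i <= glen p)%N -> gat gpath_rev i = gat p (glen p - i).
Proof. by move=> ip; rewrite gat_mkgpath. Qed.

End gpath_rev.

Section gpath_cat.
Context u v w (p : gpath u v) (q : gpath v w).
Let f i := if (i <= glen p)%N then gat p i else gat q (i - glen p).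

Let f_right i : (glen p <= i)%N -> f i = gat q (i - glen p).
Proof.
move=> pi; rewrite /f; case: ifPn => // ip.
have -> : i = glen p by lia.
by rewrite subnn gat_len gat0.
Qed.

Let fE i : (i < glen p + glen q)%N -> edge (f i) (f i.+1).
Proof.
move=> ipq; case: (ltnP i (glen p)) => ip.
  by rewrite /f (ltnW ip) ip; exact: gat_edge.
rewrite !f_right ?subSn //; last exact: leqW.
by apply: gat_edge; lia.
Qed.

Let f0 : f 0 = u. Proof. by rewrite /f /= gat0. Qed.
Let fn : f (glen p + glen q) = w.
Proof. by rewrite f_right ?leq_addr // addKn gat_len. Qed.

(* [p] followed by [q] *)
Definition gpath_cat : gpath u w := mkgpath fE f0 fn.

Lemma gat_catl i : (i <= glen p)%N -> gat gpath_cat i = gat p i.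
Proof.
move=> ip; rewrite gat_mkgpath ?/f ?ip //; exact: leq_trans (leq_addr _ _).
Qed.

Lemma gat_catr i : (glen p <= i <= glen p + glen q)%N ->
  gat gpath_cat i = gat q (i - glen p).
Proof. by case/andP => pi ipq; rewrite gat_mkgpath // f_right. Qed.

End gpath_cat.

Lemma gpath_catA t u v w (p : gpath t u) (q : gpath u v) (s : gpath v w) :
  gpath_cat p (gpath_cat q s) = gpath_cat (gpath_cat p q) s.
Proof.
apply: eq_gpath => [|i] /=; first by rewrite addnA.
move=> ile; have [ip|pi] := leqP i (glen p).
  by rewrite !gat_catl //=; lia.
rewrite gat_catr /=; last by lia.
have [ipq|pqi] := leqP i (glen p + glen q).
  rewrite [LHS]gat_catl; last by lia.
  rewrite [RHS]gat_catl //=; rewrite [RHS]gat_catr //; lia.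
rewrite [LHS]gat_catr; last by lia.
rewrite [RHS]gat_catr /=; last by lia.
by rewrite subnDA.
Qed.

Lemma gpath_idcat v w (p : gpath v w) : gpath_cat (gpath_id v) p = p.
Proof.
by apply: eq_gpath => //= i ip; rewrite gat_catr /= ?subn0 // add0n.
Qed.

Lemma gpath_catid v w (p : gpath v w) : gpath_cat p (gpath_id w) = p.
Proof.
apply: eq_gpath => /= [|i]; rewrite addn0 // => ip; exact: gat_catl.
Qed.

Lemma gpath_revK v w (p : gpath v w) : gpath_rev (gpath_rev p) = p.
Proof.
apply: eq_gpath => //= i ip.
by rewrite !gat_rev //= ?leq_subr // subKn.
Qed.

Section gpath_equiv_theory.
Context (r : nat).

Let card_count (n : nat) (P : nat -> Prop) :
  #|[set i : 'I_n.+1 | `[< P i >] ]%SET| = count (fun i => `[< P i >]) (iota 0 n.+1).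
Proof.
rewrite cardE {1}/enum_mem -enumT size_filter -val_enum_ord count_map.
by apply: eq_count => i; exact: (etrans (finset.in_set _ _)).
Qed.

Let gpath_substE v w (p q : gpath v w) : gpath_subst r p q <->
  glen p = glen q /\
  (count (fun i => `[< gat p i <> gat q i >]) (iota 0 (glen p).+1) < r)%N.
Proof. by rewrite /gpath_subst (card_count _ (fun i => gat p i <> gat q i)). Qed.

Let step_catl u v w (p p' : gpath u v) (q : gpath v w) :
  gpath_step r p p' -> gpath_step r (gpath_cat p q) (gpath_cat p' q).
Proof.
case=> [[E [x xp [lex gex]]]|/gpath_substE[E pp']]; [left|right].
  split; first by rewrite /= E !addSn.
  exists x; first by rewrite /=; lia.
  split=> i ix; first by rewrite !gat_catl ?lex //; lia.
  move: ix => /= ix; have [ip|pi] := leqP i (glen p).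
    by rewrite !gat_catl ?gex //; lia.
  by rewrite !gat_catr ?E /= ?subSS //; lia.
apply/gpath_substE; split; first by rewrite /= E.
rewrite (_ : (glen _).+1 = (glen p).+1 + glen q)%N // iotaD count_cat.
rewrite [X in (_ + X)%N](_ : _ = 0%N).
  rewrite addn0; apply: leq_ltn_trans pp'; rewrite leq_eqVlt; apply/orP.
  left; apply/eqP/eq_in_count => i; rewrite mem_iota => /andP[_ ip].
  by rewrite !gat_catl //; lia.
apply/eqP; rewrite -leqn0 leqNgt -has_count; apply/hasPn => i.
rewrite mem_iota => ip; apply/asboolPn; apply; rewrite !gat_catr ?E //; lia.
Qed.

Let step_catr u v w (p : gpath u v) (q q' : gpath v w) :
  gpath_step r q q' -> gpath_step r (gpath_cat p q) (gpath_cat p q').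
Proof.
case=> [[E [x xq [lex gex]]]|/gpath_substE[E qq']]; [left|right].
  split; first by rewrite /= E !addnS.
  exists (glen p + x)%N; first by rewrite /= leq_add2l.
  split=> i ix; have [ip|pi] := leqP i (glen p).
  - by rewrite !gat_catl.
  - by rewrite !gat_catr ?lex //; lia.
  - have {}ip : i = glen p by lia.
    move: ix => /= ix; rewrite ip !gat_catr /=; [|lia..].
    by rewrite subnn -(gex 0%N); [congr (gat _ _)|]; lia.
  - move: ix => /= ix; rewrite !gat_catr /=; [|lia..].
    by rewrite -gex; [congr (gat _ _)|]; lia.
apply/gpath_substE; split; first by rewrite /= E.
rewrite (_ : (glen _).+1 = glen p + (glen q).+1)%N; last by rewrite addnS.
rewrite iotaD count_cat add0n.
rewrite [X in (X + _)%N](_ : _ = 0%N).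
  rewrite add0n -[X in iota X]addn0 iotaDl count_map; apply: leq_ltn_trans qq'.
  rewrite leq_eqVlt; apply/orP; left; apply/eqP/eq_in_count => i.
  rewrite mem_iota => /andP[_ ip] /=.
  by rewrite !gat_catr -?E ?addKn //; lia.
apply/eqP; rewrite -leqn0 leqNgt -has_count; apply/hasPn => i.
rewrite mem_iota => ip; apply/asboolPn; apply; rewrite !gat_catl //; lia.
Qed.

Lemma gpath_equiv_cat u v w (p p' : gpath u v) (q q' : gpath v w) :
  gpath_equiv r _ _ p p' -> gpath_equiv r _ _ q q' ->
  gpath_equiv r _ _ (gpath_cat p q) (gpath_cat p' q').
Proof.
move=> /generated_equivP pp' /generated_equivP qq'; apply/generated_equivP.
apply: (@rst_trans _ _ _ (gpath_cat p' q)).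
  move: pp'; apply: (clos_rst_map (f := fun s => gpath_cat s q)) => a b ab.
  exact/rst_step/step_catl.
move: qq'; apply: (clos_rst_map (f := gpath_cat p')) => a b ab.
exact/rst_step/step_catr.
Qed.

Let insert_rev v w (p q : gpath v w) :
  gpath_insert p q -> gpath_insert (gpath_rev p) (gpath_rev q).
Proof.
move=> [E [x xp [lex gex]]]; split; first by rewrite /= E.
exists (glen p - x)%N; first exact: leq_subr.
split=> i /= ix.
  rewrite !gat_rev ?E /=; [|lia..].
  by rewrite -gex; [congr (gat _ _)|]; lia.
rewrite !gat_rev ?E /=; [|lia..].
by rewrite -lex; [congr (gat _ _)|]; lia.
Qed.

Let subst_rev v w (p q : gpath v w) :
  gpath_subst r p q -> gpath_subst r (gpath_rev p) (gpath_rev q).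
Proof.
move=> [E pq]; split=> //=; apply: leq_ltn_trans pq.
rewrite -[leqRHS](card_imset _ (@rev_ord_inj _)).
apply/subset_leq_card/fintype.subsetP => i; rewrite finset.in_set => iP.
rewrite -(rev_ordK i); apply: imset_f; rewrite finset.in_set /=.
have ip : (i <= glen p)%N by rewrite -ltnS.
by move: iP; rewrite !gat_rev -?E // subSS.
Qed.

Lemma gpath_equiv_rev v w (p p' : gpath v w) :
  gpath_equiv r _ _ p p' -> gpath_equiv r _ _ (gpath_rev p) (gpath_rev p').
Proof.
move=> /generated_equivP pp'; apply/generated_equivP; move: pp'.
apply: (clos_rst_map (f := @gpath_rev v w)) => a b [ab|ab]; apply: rst_step.
- by left; exact: insert_rev.
- by right; exact: subst_rev.
Qed.

Lemma gpath_equiv_catrev v w (p : gpath v w) :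
  gpath_equiv r _ _ (gpath_cat p (gpath_rev p)) (gpath_id v).
Proof.
pose f k i := if (i <= k)%N then gat p i else gat p (k.*2 - i).
have main k : (k <= glen p)%N -> forall q : gpath v v, glen q = k.*2 ->
    (forall i, (i <= k.*2)%N -> gat q i = f k i) -> gpath_equiv r _ _ q (gpath_id v).
  elim: k => [_|k IH kp] q lq qE.
    suff -> : q = gpath_id v by apply/generated_equivP; exact: rst_refl.
    by apply: eq_gpath; rewrite lq // => -[] // _; rewrite !gat0.
  have fE i : (i < k.*2)%N -> edge (f k i) (f k i.+1).
    move=> ik; rewrite /f; case: (ltngtP i k) => ik'.
    - by apply: gat_edge; lia.
    - apply: edge_sym; rewrite subnS -{2}(@prednK (k.*2 - i)); last by lia.
      by apply: gat_edge; lia.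
    - subst i; apply: edge_sym; rewrite (_ : k.*2 - k.+1 = k.-1)%N; last by lia.
      by rewrite -{2}(@prednK k); [apply: gat_edge|]; lia.
  have f0 : f k 0%N = v by rewrite /f /= gat0.
  have fk : f k k.*2 = v.
    rewrite /f; case: ifPn => kk; last by rewrite subnn gat0.
    by rewrite (_ : k.*2 = 0%N) ?gat0 //; lia.
  pose q' : gpath v v := mkgpath fE f0 fk.
  apply/generated_equivP/(@rst_trans _ _ _ q'); last first.
    by apply/generated_equivP/IH => //; [exact: ltnW|move=> i ik; rewrite gat_mkgpath].
  apply/rst_sym/rst_step; left; split.
    by rewrite lq /= doubleS.
  exists k; first by rewrite /=; lia.
  split=> i ik; rewrite qE; [|lia| |move: ik => /=; lia].
    by rewrite gat_mkgpath ?/f ?ik ?(leqW ik) //; lia.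
  move: ik => /= ik; rewrite gat_mkgpath; last by lia.
  rewrite /f ifF; last by lia.
  by case: ifPn => ki; congr (gat _ _); lia.
apply: (main (glen p)) => //= [|i]; first by rewrite addnn.
rewrite -addnn => ip; rewrite /f; case: ifPn => pi; first by rewrite gat_catl.
rewrite gat_catr /=; last by lia.
by rewrite gat_rev; [congr (gat _ _)|]; lia.
Qed.

Lemma gpath_equiv_revcat v w (p : gpath v w) :
  gpath_equiv r _ _ (gpath_cat (gpath_rev p) p) (gpath_id w).
Proof. by rewrite -{2}(gpath_revK p); exact: gpath_equiv_catrev. Qed.

End gpath_equiv_theory.
End gpath.

HB.instance Definition _ (G : graph) (v w : G) := gen_eqMixin (gpath v w).
HB.instance Definition _ (G : graph) (v w : G) := gen_choiceMixin (gpath v w).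

Definition rpi1 (r : nat) (G : graph) (v : G) : Type :=
  {eq_quot (gpath_equiv r v v)}.

Section rpi1_group.
Context (r : nat) (G : graph) (v : G).
Local Notation pi1r := (rpi1 r v).

HB.instance Definition _ := Choice.on pi1r.
HB.instance Definition _ := EqQuotient.on pi1r.

Definition rpi1_class (p : gpath v v) : pi1r := \pi_pi1r p.

Lemma rpi1_classP p q : gpath_equiv r v v p q <-> rpi1_class p = rpi1_class q.
Proof. by split=> [pq|/eqmodP//]; exact/eqmodP. Qed.

(* In a product, the right-hand factor is travelled first. *)
Let mul (a b : pi1r) : pi1r := rpi1_class (gpath_cat (repr b) (repr a)).
Let one : pi1r := rpi1_class (gpath_id v).
Let inv (a : pi1r) : pi1r := rpi1_class (gpath_rev (repr a)).

Let repr_class p : gpath_equiv r v v (repr (rpi1_class p)) p.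
Proof. by apply/rpi1_classP; rewrite /rpi1_class reprK. Qed.

Let classK a : rpi1_class (repr a) = a.
Proof. exact: reprK. Qed.

Let mulE p q : mul (rpi1_class q) (rpi1_class p) = rpi1_class (gpath_cat p q).
Proof. by apply/rpi1_classP/gpath_equiv_cat. Qed.

Let mulA : associative mul.
Proof.
move=> a b c; rewrite -(classK a) -(classK b) -(classK c) !mulE.
by rewrite gpath_catA.
Qed.

Let mul1 : left_id one mul.
Proof. by move=> a; rewrite -(classK a) mulE gpath_catid. Qed.

Let mulr1 : right_id one mul.
Proof. by move=> a; rewrite -(classK a) mulE gpath_idcat. Qed.

Let mulV : left_inverse one inv mul.
Proof.
move=> a; rewrite -[X in mul _ X](classK a) mulE.
exact/rpi1_classP/gpath_equiv_catrev.
Qed.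

Let mulrV : right_inverse one inv mul.
Proof.
move=> a; rewrite -[X in mul X _](classK a) mulE.
exact/rpi1_classP/gpath_equiv_revcat.
Qed.

HB.instance Definition _ := isGroup.Build pi1r mulA mul1 mulr1 mulV mulrV.

Lemma rpi1_mulE p q :
  (rpi1_class q * rpi1_class p)%g = rpi1_class (gpath_cat p q).
Proof. exact: mulE. Qed.

End rpi1_group.

Section continuity.
Context {T U V : topologicalType} {R : realType}.

Lemma id_cont : continuous (fun t : T => t).
Proof. by move=> t; exact: cvg_id. Qed.

Lemma cst_cont (y : U) : continuous (fun _ : T => y).
Proof. by move=> t; exact: cvg_cst. Qed.

Lemma comp_cont (g : U -> V) (f : T -> U) :
  continuous g -> continuous f -> continuous (fun t => g (f t)).
Proof. by move=> cg cf t; apply: continuous_comp; [exact: cf|exact: cg]. Qed.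

Lemma pair_cont (f : T -> U) (g : T -> V) :
  continuous f -> continuous g -> continuous (fun t => (f t, g t)).
Proof. by move=> cf cg t; exact: (cvg_pair (cf t) (cg t)). Qed.

Lemma fst_cont : continuous (fun t : T * U => t.1).
Proof. by move=> t; exact: cvg_fst. Qed.

Lemma snd_cont : continuous (fun t : T * U => t.2).
Proof. by move=> t; exact: cvg_snd. Qed.

Lemma add_cont (f g : T -> R) :
  continuous f -> continuous g -> continuous (fun t => f t + g t).
Proof. by move=> cf cg t; apply: cvgD; [exact: cf|exact: cg]. Qed.

Lemma opp_cont (f : T -> R) : continuous f -> continuous (fun t => - f t).
Proof. by move=> cf t; apply: cvgN; exact: cf. Qed.

Lemma mul_cont (f g : T -> R) :
  continuous f -> continuous g -> continuous (fun t => f t * g t).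
Proof. by move=> cf cg t; apply: cvgM; [exact: cf|exact: cg]. Qed.

Lemma min_cont (f g : T -> R) :
  continuous f -> continuous g -> continuous (fun t => Num.min (f t) (g t)).
Proof.
by move=> cf cg t; apply: (@continuous_min R T f g); [exact: cf|exact: cg].
Qed.

Lemma max_cont (f g : T -> R) :
  continuous f -> continuous g -> continuous (fun t => Num.max (f t) (g t)).
Proof.
by move=> cf cg t; apply: (@continuous_max R T f g); [exact: cf|exact: cg].
Qed.

Lemma glue_cont (h : T -> R) (f g : T -> U) :
  continuous h -> continuous f -> continuous g ->
  (forall t, h t = 0 -> f t = g t) ->
  continuous (fun t => if h t <= 0 then f t else g t).
Proof.
move=> ch cf cg fg t; have [ht|ht|ht] := ltgtP (h t) 0.
- have N : \forall u \near t, f u = (if h u <= 0 then f u else g u).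
    have : \forall u \near t, h u < 0 by exact: cvgr_lt (ch t) _ ht.
    by apply: filterS => u /ltW ->.
  rewrite /continuous_at (ltW ht).
  exact: (cvg_trans (near_eq_cvg N) (cf t)).
- have N : \forall u \near t, g u = (if h u <= 0 then f u else g u).
    have : \forall u \near t, 0 < h u by exact: cvgr_gt (ch t) _ ht.
    by apply: filterS => u; rewrite ltNge => /negbTE ->.
  rewrite /continuous_at leNgt ht /=.
  exact: (cvg_trans (near_eq_cvg N) (cg t)).
- rewrite /continuous_at ht lexx => A fA.
  have gA : nbhs (g t) A by rewrite -fg.
  have nf : nbhs t (f @^-1` A) by exact: cf.
  have ng : nbhs t (g @^-1` A) by exact: cg.
  by apply: filterS2 nf ng => u fAu gAu /=; case: ifP.
Qed.

End continuity.

Section unit_interval.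
Context (R : realType).

Definition unit_interval : Type := set_type [set t : R | 0 <= t <= 1].

HB.instance Definition _ := Topological.on unit_interval.

Definition ui_val (t : unit_interval) : R := \val t.

Lemma ui_valP t : 0 <= ui_val t <= 1.
Proof. exact: (set_mem (valP t)). Qed.

Lemma ui_val_inj : injective ui_val.
Proof. exact: val_inj. Qed.

Lemma ui_val_continuous : continuous ui_val.
Proof.
exact: (@initial_continuous (set_type [set t : R | 0 <= t <= 1]) R set_val).
Qed.

Let clampP (t : R) : Num.max 0 (Num.min 1 t) \in [set t : R | 0 <= t <= 1].
Proof. by rewrite inE /= le_max lexx /= ge_max ler01 ge_min lexx. Qed.

Definition clamp (t : R) : unit_interval := 
  exist (fun s => s \in [set t : R | 0 <= t <= 1]) _ (clampP t).

Lemma clampE t : 0 <= t <= 1 -> ui_val (clamp t) = t.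
Proof. by case/andP => t0 t1; rewrite /ui_val /= min_r // max_r. Qed.

Lemma clampK t : clamp (ui_val t) = t.
Proof. exact/ui_val_inj/clampE/ui_valP. Qed.

Lemma clamp_continuous : continuous clamp.
Proof.
apply: (@continuous_comp_initial _ _ _ set_val).
change (continuous (fun t : R => Num.max 0 (Num.min 1 t))).
by apply: max_cont; [exact: cst_cont|apply: min_cont; [exact: cst_cont|exact: id_cont]].
Qed.

Let ui_zero_one : clamp 0 != clamp 1.
Proof.
apply/eqP => /(congr1 ui_val); rewrite !clampE ?lexx ?ler01 // => /esym/eqP.
by rewrite oner_eq0.
Qed.

HB.instance Definition _ := isBiPointed.Build unit_interval ui_zero_one.

Lemma ui_val0 : ui_val zero = 0. Proof. by rewrite clampE // lexx ler01. Qed.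
Lemma ui_val1 : ui_val one = 1. Proof. by rewrite clampE // lexx ler01. Qed.
Lemma clamp0 : clamp 0 = zero. Proof. by []. Qed.
Lemma clamp1 : clamp 1 = one. Proof. by []. Qed.

End unit_interval.

Ltac cont := repeat first
  [ assumption | exact: id_cont | exact: cst_cont | exact: fst_cont
  | exact: snd_cont | apply: pair_cont | apply: add_cont | apply: opp_cont
  | apply: mul_cont | apply: min_cont | apply: max_cont
  | apply: (comp_cont (@ui_val_continuous _))
  | apply: (comp_cont (@clamp_continuous _))
  | apply: (comp_cont (@cts_fun _ _ _)) ].

Notation upath R x y := {path (unit_interval R) from x to y}.

Section path_homotopy.
Context {R : realType} {X : topologicalType}.
Local Notation I := (unit_interval R).
Implicit Types x y z : X.

(* The first coordinate of [H] is the parameter of the paths, the second one is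
   the time of the deformation. *)
Definition path_homotopic x y (f g : upath R x y) : Prop :=
  exists H : I * I -> X,
    [/\ continuous H,
        forall t, H (t, zero) = f t,
        forall t, H (t, one) = g t &
        forall s, H (zero, s) = x /\ H (one, s) = y].

Lemma path_homotopic_refl x y (f : upath R x y) : path_homotopic f f.
Proof.
exists (fun ts => f ts.1); split => // [|s].
- by cont.
- by rewrite path_zero path_one.
Qed.

Lemma path_homotopic_sym x y (f g : upath R x y) :
  path_homotopic f g -> path_homotopic g f.
Proof.
move=> [H [cH H0 H1 He]].
exists (fun ts => H (ts.1, clamp (1 - ui_val ts.2))); split => //=.
- by apply: (comp_cont cH); cont.
- by move=> t; rewrite ui_val0 subr0.
- by move=> t; rewrite ui_val1 subrr.
Qed.

Lemma path_homotopic_trans x y (f g h : upath R x y) :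
  path_homotopic f g -> path_homotopic g h -> path_homotopic f h.
Proof.
move=> [H [cH H0 H1 He]] [K [cK K0 K1 Ke]].
pose c a b (ts : I * I) : I * I := (ts.1, clamp (a * ui_val ts.2 + b)).
have cc a b : continuous (c a b).
  by rewrite /c; cont.
exists (fun ts => if 2 * ui_val ts.2 - 1 <= 0 then H (c 2 0 ts) else K (c 2 (-1) ts)).
split.
- apply: glue_cont => [|||[t s] /= E].
  + by cont.
  + by apply: (comp_cont cH).
  + by apply: (comp_cont cK).
  + have -> : c 2 0 (t, s) = (t, one).
      by rewrite /c /= (_ : _ + 0 = 1) ?clamp1; last by lra.
    have -> : c 2 (-1) (t, s) = (t, zero) by rewrite /c /= E.
    by rewrite H1 K0.
- by move=> t; rewrite /c /= ui_val0 mulr0 sub0r lerN10 addr0.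
- move=> t; rewrite /c /= ui_val1 mulr1 ifF; last by lra.
  by rewrite (_ : 2 - 1 = 1) ?clamp1; last by lra.
- move=> s; case: ifP => _; rewrite /c /=; [exact: He|exact: Ke].
Qed.

Definition path_equiv_rel x y (f g : upath R x y) : bool :=
  `[< path_homotopic f g >].

Let path_equiv_refl x y : reflexive (@path_equiv_rel x y).
Proof. by move=> f; apply/asboolP; exact: path_homotopic_refl. Qed.

Let path_equiv_sym x y : symmetric (@path_equiv_rel x y).
Proof. by move=> f g; apply/asboolP/asboolP; exact: path_homotopic_sym. Qed.

Let path_equiv_trans x y : transitive (@path_equiv_rel x y).
Proof.
move=> g f h /asboolP fg /asboolP gh; apply/asboolP.
exact: path_homotopic_trans gh.
Qed.

Definition path_equiv x y : equiv_rel (upath R x y) :=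
  EquivRel (@path_equiv_rel x y) (@path_equiv_refl x y) (@path_equiv_sym x y)
    (@path_equiv_trans x y).

Lemma path_equivP x y (f g : upath R x y) :
  reflect (path_homotopic f g) (path_equiv x y f g).
Proof. exact: asboolP. Qed.

Section path_rev.
Context (x y : X) (f : upath R x y).
Let rev (t : I) : X := f (clamp (1 - ui_val t)).

Let rev_cts : continuous rev.
Proof.
by rewrite /rev; cont.
Qed.

Let rev0 : rev zero = y.
Proof. by rewrite /rev ui_val0 subr0 clamp1 path_one. Qed.

Let rev1 : rev one = x.
Proof. by rewrite /rev ui_val1 subrr clamp0 path_zero. Qed.

Definition path_rev : upath R y x := mk_path rev_cts rev0 rev1.

Lemma path_revE t : path_rev t = f (clamp (1 - ui_val t)).
Proof. by []. Qed.

End path_rev.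

Section path_cat.
Context (x y z : X) (f : upath R x y) (g : upath R y z).
Let cat (t : I) : X :=
  if 2 * ui_val t - 1 <= 0 then f (clamp (2 * ui_val t))
  else g (clamp (2 * ui_val t - 1)).

Let cat_cts : continuous cat.
Proof.
apply: glue_cont => [|||t E].
- by cont.
- by cont.
- by cont.
- rewrite E (_ : 2 * _ = 1); last by lra.
  by rewrite clamp0 clamp1 path_zero path_one.
Qed.

Let cat0 : cat zero = x.
Proof. by rewrite /cat ui_val0 mulr0 sub0r lerN10 clamp0 path_zero. Qed.

Let cat1 : cat one = z.
Proof.
rewrite /cat ui_val1 mulr1 ifF; last by lra.
by rewrite (_ : 2 - 1 = 1) ?clamp1 ?path_one; last by lra.
Qed.

(* [f] followed by [g] *)
Definition path_cat : upath R x z := mk_path cat_cts cat0 cat1.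

Lemma path_catE t : path_cat t =
  if 2 * ui_val t - 1 <= 0 then f (clamp (2 * ui_val t))
  else g (clamp (2 * ui_val t - 1)).
Proof. by []. Qed.

End path_cat.

Lemma path_homotopic_cat x y z (f f' : upath R x y) (g g' : upath R y z) :
  path_homotopic f f' -> path_homotopic g g' ->
  path_homotopic (path_cat f g) (path_cat f' g').
Proof.
move=> [H [cH H0 H1 He]] [K [cK K0 K1 Ke]].
pose c b (ts : I * I) : I * I := (clamp (2 * ui_val ts.1 + b), ts.2).
have cc b : continuous (c b) by rewrite /c; cont.
exists (fun ts => if 2 * ui_val ts.1 - 1 <= 0 then H (c 0 ts) else K (c (-1) ts)).
split.
- apply: glue_cont => [|||[t s] /= E].
  + by cont.
  + by apply: (comp_cont cH).
  + by apply: (comp_cont cK).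
  + have -> : c 0 (t, s) = (one, s).
      by rewrite /c /= (_ : _ + 0 = 1) ?clamp1; last by lra.
    have -> : c (-1) (t, s) = (zero, s) by rewrite /c /= E.
    by rewrite (He s).2 (Ke s).1.
- by move=> t; rewrite path_catE /c /= addr0 H0 K0.
- by move=> t; rewrite path_catE /c /= addr0 H1 K1.
- move=> s; rewrite /c /= ui_val0 ui_val1 mulr0 mulr1 sub0r lerN10 addr0.
  split; first exact: (He s).1.
  rewrite ifF; last by lra.
  by rewrite (_ : 2 - 1 = 1) ?clamp1 ?(Ke s).2; last by lra.
Qed.

Lemma path_homotopic_rev x y (f g : upath R x y) :
  path_homotopic f g -> path_homotopic (path_rev f) (path_rev g).
Proof.
move=> [H [cH H0 H1 He]].
exists (fun ts => H (clamp (1 - ui_val ts.1), ts.2)); split => //=.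
- by apply: (comp_cont cH); cont.
- by move=> t; rewrite H0.
- by move=> t; rewrite H1.
- by move=> s; rewrite ui_val0 ui_val1 subr0 subrr clamp0 clamp1; have [] := He s.
Qed.

Lemma path_homotopic_reparam x y u v (k : upath R u v) (f g : upath R x y)
    (phi psi : R -> R) :
  continuous phi -> continuous psi -> phi 0 = psi 0 -> phi 1 = psi 1 ->
  (forall t, f t = k (clamp (phi (ui_val t)))) ->
  (forall t, g t = k (clamp (psi (ui_val t)))) ->
  path_homotopic f g.
Proof.
move=> cphi cpsi E0 E1 fE gE.
exists (fun ts => k (clamp ((1 - ui_val ts.2) * phi (ui_val ts.1)
                            + ui_val ts.2 * psi (ui_val ts.1)))).
split.
- apply: (comp_cont (@cts_fun _ _ k)); apply: (comp_cont (@clamp_continuous _)).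
  apply: add_cont; apply: mul_cont; cont.
    by apply: (comp_cont cphi); cont.
  by apply: (comp_cont cpsi); cont.
- by move=> t /=; rewrite ui_val0 subr0 mul1r mul0r addr0 fE.
- by move=> t /=; rewrite ui_val1 subrr mul1r mul0r add0r gE.
- move=> s /=; rewrite ui_val0 ui_val1 -E0 -E1 -!mulrDl subrK !mul1r.
  by rewrite -{1}ui_val0 -ui_val1 -!fE path_zero path_one.
Qed.

Lemma path_catA x y z w (f : upath R x y) (g : upath R y z) (h : upath R z w) :
  path_homotopic (path_cat (path_cat f g) h) (path_cat f (path_cat g h)).
Proof.
pose phi (t : R) := Num.min (2 * t) (Num.min (t + 4^-1) ((t + 1) / 2)).
apply: (@path_homotopic_reparam _ _ _ _ (path_cat f (path_cat g h)) _ _ phi id).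
- by rewrite /phi; cont.
- by cont.
- by rewrite /phi mulr0 min_l // le_min; lra.
- by rewrite /phi min_r ?min_r ?ge_min; lra.
- move=> t; have /andP[t0 t1] := ui_valP t.
  have phiE : [\/ 4 * ui_val t <= 1 /\ phi (ui_val t) = 2 * ui_val t,
      [/\ 1 <= 4 * ui_val t, 2 * ui_val t <= 1 & phi (ui_val t) = ui_val t + 4^-1] |
      1 <= 2 * ui_val t /\ phi (ui_val t) = (ui_val t + 1) / 2].
    rewrite /phi; have [?|?] := leP (4 * ui_val t) 1.
      by constructor 1; split=> //; rewrite min_l // le_min; lra.
    have [?|?] := leP (2 * ui_val t) 1.
      constructor 2; split; [lra|lra|].
      by rewrite (@min_l _ _ (_ + 4^-1)) ?min_r //; lra.
    constructor 3; split; first by lra.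
    by rewrite (@min_r _ _ (_ + 4^-1)) ?min_r //; lra.
  rewrite !path_catE; case: phiE => [[tq E]|[tq th E]|[th E]].
  + rewrite E ifT; last by lra.
    rewrite (@clampE _ (2 * _)); last by lra.
    by rewrite ifT ?ifT //; lra.
  + rewrite E ifT; last by lra.
    rewrite (@clampE _ (2 * _)); last by lra.
    rewrite (@clampE _ (_ + _)); last by lra.
    have [tq'|tq'] := leP (4 * ui_val t) 1.
      have {tq'}tq : ui_val t = 4^-1 by lra.
      rewrite tq !ifT; [|lra..].
      by congr (f (clamp _)); lra.
    rewrite ifF; last by lra.
    rewrite ifF; last by lra.
    rewrite clampE; last by lra.
    rewrite ifT; last by lra.
    by congr (g (clamp _)); lra.
  + rewrite E (@clampE _ (_ / 2)); last by lra.
    have [th'|th'] := leP (2 * ui_val t) 1.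
      have {th'}th : ui_val t = 2^-1 by lra.
      rewrite th ifT; last by lra.
      rewrite (@clampE _ (2 * _)); last by lra.
      rewrite ifF; last by lra.
      rewrite ifF; last by lra.
      rewrite (@clampE _ (2 * _ - 1)); last by lra.
      rewrite ifT; last by lra.
      by congr (g (clamp _)); lra.
    rewrite ifF; last by lra.
    rewrite ifF; last by lra.
    rewrite (@clampE _ (2 * _ - 1)); last by lra.
    rewrite ifF; last by lra.
    by congr (h (clamp _)); lra.
- by move=> t; rewrite clampK.
Qed.

Definition path_id x : upath R x x := cst x.

Lemma path_idcat x y (f : upath R x y) : path_homotopic (path_cat (path_id x) f) f.
Proof.
apply: (@path_homotopic_reparam _ _ _ _ f _ _ (fun t => Num.max 0 (2 * t - 1)) id).
- by cont.
- by cont.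
- by rewrite mulr0 max_l //; lra.
- by rewrite max_r; lra.
- move=> t; rewrite path_catE; case: ifPn => [t0|]; first by rewrite max_l // clamp0 path_zero.
  by rewrite -ltNge => /ltW t0; rewrite max_r.
- by move=> t; rewrite clampK.
Qed.

Lemma path_catid x y (f : upath R x y) : path_homotopic (path_cat f (path_id y)) f.
Proof.
apply: (@path_homotopic_reparam _ _ _ _ f _ _ (fun t => Num.min 1 (2 * t)) id).
- by cont.
- by cont.
- by rewrite mulr0 min_r //; lra.
- by rewrite min_l; lra.
- move=> t; rewrite path_catE; case: ifPn => [t0|]; first by rewrite min_r //; lra.
  by rewrite -ltNge => t0; rewrite min_l ?clamp1 ?path_one //; lra.
- by move=> t; rewrite clampK.
Qed.

Lemma path_catrev x y (f : upath R x y) :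
  path_homotopic (path_cat f (path_rev f)) (path_id x).
Proof.
apply: (@path_homotopic_reparam _ _ _ _ f _ _
  (fun t => Num.min (2 * t) (2 - 2 * t)) (fun=> 0)).
- by cont.
- by cont.
- by rewrite mulr0 min_l //; lra.
- by rewrite min_r; lra.
- move=> t; have /andP[t0 t1] := ui_valP t.
  rewrite path_catE; case: ifPn => [th|]; first by rewrite min_l //; lra.
  rewrite -ltNge => th; rewrite path_revE clampE; last by lra.
  by rewrite min_r; [congr (f (clamp _))|]; lra.
- by move=> t; rewrite clamp0 path_zero.
Qed.

Lemma path_revK x y (f : upath R x y) : path_rev (path_rev f) = f.
Proof.
apply/path_eqP => t; have /andP[t0 t1] := ui_valP t.
rewrite !path_revE clampE; last by lra.
by rewrite subKr clampK.
Qed.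

Lemma path_revcat x y (f : upath R x y) :
  path_homotopic (path_cat (path_rev f) f) (path_id y).
Proof. by rewrite -{2}(path_revK f); exact: path_catrev. Qed.

End path_homotopy.

Definition pi1 (R : realType) (X : topologicalType) (x : X) : Type :=
  {eq_quot (@path_equiv R X x x)}.

Section pi1_group.
Context (R : realType) (X : topologicalType) (x : X).
Local Notation pi1X := (pi1 R x).

HB.instance Definition _ := Choice.on pi1X.
HB.instance Definition _ := EqQuotient.on pi1X.

Definition pi1_class (f : upath R x x) : pi1X := \pi_pi1X f.

Lemma pi1_classP f g : path_homotopic f g <-> pi1_class f = pi1_class g.
Proof. by split=> [fg|/eqmodP/path_equivP//]; exact/eqmodP/path_equivP. Qed.

(* Same convention as for [rpi1]: the right-hand factor is travelled first. *)
Let mul (a b : pi1X) : pi1X := pi1_class (path_cat (repr b) (repr a)).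
Let one : pi1X := pi1_class (path_id x).
Let inv (a : pi1X) : pi1X := pi1_class (path_rev (repr a)).

Let classK a : pi1_class (repr a) = a.
Proof. exact: reprK. Qed.

Let mulE f g : mul (pi1_class g) (pi1_class f) = pi1_class (path_cat f g).
Proof. by apply/pi1_classP/path_homotopic_cat; apply/pi1_classP/classK. Qed.

Let mulA : associative mul.
Proof.
move=> a b c; rewrite -(classK a) -(classK b) -(classK c) !mulE.
exact/pi1_classP/path_catA.
Qed.

Let mul1 : left_id one mul.
Proof. by move=> a; rewrite -(classK a) mulE; exact/pi1_classP/path_catid. Qed.

Let mulr1 : right_id one mul.
Proof. by move=> a; rewrite -(classK a) mulE; exact/pi1_classP/path_idcat. Qed.

Let mulV : left_inverse one inv mul.
Proof.
move=> a; rewrite -[X in mul _ X](classK a) mulE.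
exact/pi1_classP/path_catrev.
Qed.

Let mulrV : right_inverse one inv mul.
Proof.
move=> a; rewrite -[X in mul X _](classK a) mulE.
exact/pi1_classP/path_revcat.
Qed.

HB.instance Definition _ := isGroup.Build pi1X mulA mul1 mulr1 mulV mulrV.

Lemma pi1_mulE f g : (pi1_class g * pi1_class f)%g = pi1_class (path_cat f g).
Proof. exact: mulE. Qed.

End pi1_group.

(* The 1-dimensional simplicial complex associated with a graph has the simplices
   [{x}] and [{x, y}] for [edge x y]. *)
Definition spans_simplex (G : graph) (x y : G) : Prop := x = y \/ edge x y.

Section realization.
Context (R : realType) (G : graph).

(* Barycentric coordinates of the point [(1 - t) x + t y]. *)
Definition bary (x y : G) (t : R) (z : G) : R :=
  (1 - t) * \1_[set x] z + t * \1_[set y] z.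

Definition realization : Type :=
  {p : G -> R | exists x y t,
    [/\ spans_simplex x y, 0 <= t <= 1 & p = bary x y t]}.

HB.instance Definition _ := gen_eqMixin realization.
HB.instance Definition _ := gen_choiceMixin realization.

Definition simplex_point (x y : G) (xy : spans_simplex x y)
    (t : unit_interval R) : realization :=
  exist _ (bary x y (ui_val t))
    (ex_intro _ x (ex_intro _ y (ex_intro _ (ui_val t)
      (And3 xy (ui_valP t) erefl)))).

Definition realization_vertex (x : G) : realization :=
  simplex_point (or_introl erefl : spans_simplex x x) zero.

(* Coherent (weak) topology: a set is open when its trace on every closed simplex
   is. *)
Definition realization_open (U : set realization) : Prop :=
  forall (x y : G) (xy : spans_simplex x y), open (simplex_point xy @^-1` U).

Let realization_openT : realization_open setT.
Proof. by move=> x y xy; rewrite preimage_setT; exact: openT. Qed.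

Let realization_openI : setI_closed realization_open.
Proof. by move=> U V oU oV x y xy; rewrite preimage_setI; exact: openI. Qed.

Let realization_open_bigcup (J : Type) (U : J -> set realization) :
  (forall j, realization_open (U j)) -> realization_open (\bigcup_j U j).
Proof.
by move=> oU x y xy; rewrite preimage_bigcup; apply: bigcup_open => j _; exact: oU.
Qed.

HB.instance Definition _ := isOpenTopological.Build realization
  realization_openT realization_openI realization_open_bigcup.

End realization.

Definition cycle_edge (n : nat) (x y : 'I_n) : Prop := y = ordS x \/ y = ord_pred x.

Lemma cycle_edge_sym n (x y : 'I_n) : cycle_edge x y -> cycle_edge y x.
Proof. by case=> ->; [right|left]; rewrite ?ordSK ?ord_predK. Qed.

(* ['I_n] stands for Z/n; [ordS] and [ord_pred] are the successor and the
   predecessor modulo [n]. *)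
Definition cycle_graph (n : nat) : graph := Graph (@cycle_edge_sym n).

Record short_even_cycle (r : nat) (G : graph) := ShortEvenCycle {
  half_length : nat;
  half_length_bounds : (2 <= half_length <= r)%N;
  cycle_map : graph_hom (cycle_graph (2 * half_length)) G }.

HB.instance Definition _ (r : nat) (G : graph) :=
  gen_eqMixin (short_even_cycle r G).
HB.instance Definition _ (r : nat) (G : graph) :=
  gen_choiceMixin (short_even_cycle r G).

Lemma cycle_spans (n : nat) (G : graph) (c : graph_hom (cycle_graph n) G)
  (k : 'I_n) : spans_simplex (c k) (c (ordS k)).
Proof. by right; apply: hom_edge; left. Qed.

Section cells.
Context (R : realType).

Definition disk : Type := set_type [set z : R * R | z.1 ^+ 2 + z.2 ^+ 2 <= 1].

HB.instance Definition _ := Topological.on disk.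

Let circle_pointP (a : R) :
  (cos a, sin a) \in [set z : R * R | z.1 ^+ 2 + z.2 ^+ 2 <= 1].
Proof. by rewrite inE /= cos2Dsin2. Qed.

Definition circle_point (a : R) : disk :=
  exist (fun z => z \in [set z : R * R | z.1 ^+ 2 + z.2 ^+ 2 <= 1]) _
    (circle_pointP a).

Context (r : nat) (G : graph).

(* The realization ([None]) and one disk for each cycle ([Some c]). *)
Definition piece (i : option (short_even_cycle r G)) : topologicalType :=
  if i is Some _ then disk else realization R G.

Definition pieces : Type := {i : option (short_even_cycle r G) & piece i}.

HB.instance Definition _ := Topological.on pieces.

Definition in_realization (p : realization R G) : pieces := existT piece None p.
Definition in_disk (c : short_even_cycle r G) (z : disk) : pieces :=
  existT piece (Some c) z.

(* For a cycle [c] of length n, the circle is identified with the realization of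
   the cycle graph by sending exp (2 i pi (k + t) / n) to (1 - t) k + t (k + 1), which
   the map induced by [c] sends to (1 - t) c(k) + t c(k + 1). *)
Inductive attach : pieces -> pieces -> Prop :=
| Attach (c : short_even_cycle r G) (k : 'I_(2 * half_length c))
    (t : unit_interval R) :
    attach
      (in_disk c
        (circle_point (2 * pi * (k%:R + ui_val t) / (2 * half_length c)%:R)))
      (in_realization (simplex_point (cycle_spans (cycle_map c) k) t)).

Definition Xr : Type := {eq_quot (generated_equiv attach)}.

HB.instance Definition _ := Topological.copy Xr (quotient_topology Xr).
HB.instance Definition _ := EqQuotient.on Xr.

Definition Xr_vertex (x : G) : Xr :=
  \pi_Xr (in_realization (realization_vertex R x)).

End cells.

Definition group_isomorphic (A B : groupType) : Prop :=
  exists f : {multiplicative A -> B}, bijective f.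

(* Main.v *)
Require Import Defs.
From HB Require Import structures.
From mathcomp Require Import all_boot all_order all_algebra.
From mathcomp Require Import all_classical all_reals all_analysis.
From mathcomp Require Import homotopy.
From mathcomp Require Import zify ring lra.
From Stdlib Require Import Relation_Operators.

Set Implicit Arguments.
Unset Strict Implicit.
Unset Printing Implicit Defensive.

Import Order.TTheory GRing.Theory Num.Theory.
Import numFieldNormedType.Exports.

Local Open Scope classical_set_scope.
Local Open Scope ring_scope.
Local Open Scope quotient_scope.

(**
Sending a path of the graph to the concatenation of its edges in the complex
[Xr] turns the combinatorial classes into homotopy classes, and this map is the
isomorphism.

It is well defined ([gwalk_equiv]).  Inserting a backtrack inserts an arc
followed by its inverse.  If two paths of the same length and with the same
ends differ at fewer than [r] places, cut them at the first common vertex after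
the start, at distance [m] say; then [m <= r], and if [m >= 2] the two initial
pieces bound a cycle of length [2 * m], whose disk is convex
([homotopic_few_differences]).

It is surjective ([homotopic_gwalk]).  The complex is covered by the open stars
of the vertices and the open disks.  Each of these sets contracts to a point
inside itself ([vertex_contraction], [cell_contraction]), so that a point [x] of
such a set is joined to a vertex by a canonical path, its spoke.  The spokes of
[x] in two sets of the cover differ by a path of the graph ([spoke_link]),
because everything happens in one edge or in one closed disk; and inside one set
the spoke of the end of a path is the spoke of its origin followed by the path
([spoke_move]).  Hence the property that the part of [f] before time [t] is
homotopic to a path of the graph followed by a spoke is locally constant in [t];
it holds at time 0, so it holds at time 1.

It is injective ([homotopic_lift_end]).  The classes of paths issued from the
base vertex are the vertices of a covering of the graph.  Edges lift uniquely
to it, and cycles of length [2 * s] with [s <= r] lift to closed cycles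
([cycle_lift_closed]): the two halves of the cycle differ at fewer than [r]
places.  So the covering extends over the disks; its sheets over the sets of the
cover form a local system on [Xr].  A homotopy pulls this local system back to a
square, where it has sections with any given value at a corner
([rect_extends]).  Comparing such a section along the four sides with the
lifts of the two given paths shows that these lifts have the same end, which
says that the paths are equivalent.

The topology of [Xr] is always used through charts: it is the final topology for
the edges [I -> Xr] and for the sectors [I * I -> Xr] of the disks in polar
coordinates ([chart_final]), and functions on [Xr] are defined by their
expressions in the charts ([Xr_rec]).
*)

(** * Paths and homotopies *)

Section interval_lines.
Context {R : realType}.
Local Notation I := (unit_interval R).

Definition lin (a b s : I) : I :=
  clamp ((1 - ui_val s) * ui_val a + ui_val s * ui_val b).

Lemma ui_val_lin a b s : ui_val (lin a b s) = (1 - ui_val s) * ui_val a + ui_val s * ui_val b.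
Proof.
have /andP[a0 a1] := ui_valP a; have /andP[b0 b1] := ui_valP b; have /andP[s0 s1] := ui_valP s.
rewrite clampE //; apply/andP; split.
  by rewrite addr_ge0 // mulr_ge0 // subr_ge0.
have : (1 - ui_val s) * ui_val a <= 1 - ui_val s by rewrite ler_piMr // subr_ge0.
have : ui_val s * ui_val b <= ui_val s by rewrite ler_piMr.
lra.
Qed.

Lemma lin0 a b : lin a b zero = a.
Proof. by rewrite /lin ui_val0 subr0 mul1r mul0r addr0 clampK. Qed.

Lemma lin1 a b : lin a b one = b.
Proof. by rewrite /lin ui_val1 subrr mul1r mul0r add0r clampK. Qed.

Lemma linxx a s : lin a a s = a.
Proof. by rewrite /lin -mulrDl subrK mul1r clampK. Qed.

Lemma lin_continuous (T : topologicalType) (f g h : T -> I) :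
  continuous f -> continuous g -> continuous h ->
  continuous (fun x => lin (f x) (g x) (h x)).
Proof.
move=> cf cg ch; apply: (comp_cont (@clamp_continuous _)).
have cu := comp_cont (@ui_val_continuous R).
apply: add_cont; apply: mul_cont; try exact: cu.
by apply: add_cont; [exact: cst_cont|apply: opp_cont; exact: cu].
Qed.

End interval_lines.

(** One structural step towards the continuity of a function given by a formula;
 the eta-reduced heads come from applications of [comp_cont]. *)
Ltac continuity_step h := match h with
  | @fst _ _ => exact: fst_cont
  | @snd _ _ => exact: snd_cont
  | @ui_val _ => exact: ui_val_continuous
  | @clamp _ => exact: clamp_continuous
  | @Algebra.add _ ?a => exact: (add_cont (@cst_cont _ _ a) (@id_cont _))
  | @GRing.mul _ ?a => exact: (mul_cont (@cst_cont _ _ a) (@id_cont _))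
  | @pair _ _ ?a => exact: (pair_cont (@cst_cont _ _ a) (@id_cont _))
  | @Algebra.opp _ => exact: (opp_cont (@id_cont _))
  | fun t => t => exact: id_cont
  | fun t => (_, _) => apply: pair_cont
  | fun t => @Algebra.add _ _ _ => apply: add_cont
  | fun t => @GRing.mul _ _ _ => apply: mul_cont
  | fun t => @Algebra.opp _ _ => apply: opp_cont
  | fun t => ui_val (@?f t) => apply: (comp_cont (@ui_val_continuous _) (f := f))
  | fun t => clamp (@?f t) => apply: (comp_cont (@clamp_continuous _) (f := f))
  | fun t => fst (@?f t) => apply: (comp_cont (@fst_cont _ _) (f := f))
  | fun t => snd (@?f t) => apply: (comp_cont (@snd_cont _ _) (f := f))
  | fun t => lin (@?a t) (@?b t) (@?c t) => apply: (lin_continuous (f := a) (g := b) (h := c))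
  | lin ?a ?b => apply: (lin_continuous (f := fun=> a) (g := fun=> b) (h := id))
  | fun t => ?g (@?f t) =>
      match goal with
      | cg : forall x, @continuous_at _ _ x g |- _ => apply: (comp_cont cg (f := f))
      end
  | _ => first [assumption | exact: cst_cont]
  end.

Ltac continuity := repeat (cbv beta;
  lazymatch goal with |- forall x, @continuous_at _ _ x ?h => continuity_step h end).

(** Homotopy is restated for plain functions on the interval: equalities between
 end points then stay propositional, and paths can be concatenated without
 transporting them along such equalities. *)
Section raw_paths.
Context {R : realType} {X : topologicalType}.
Local Notation I := (unit_interval R).
Implicit Types f g h : I -> X.

Definition pcat f g : I -> X := fun t =>
  if 2 * ui_val t - 1 <= 0 then f (clamp (2 * ui_val t))
  else g (clamp (2 * ui_val t - 1)).

Definition homotopic f g : Prop := exists H : I * I -> X,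
  [/\ continuous H, forall t, H (t, zero) = f t, forall t, H (t, one) = g t &
      forall s, H (zero, s) = f zero /\ H (one, s) = f one].

Lemma homotopicE x y (f g : upath R x y) : homotopic f g <-> path_homotopic f g.
Proof.
by split=> -[H [cH H0 H1 He]]; exists H; split=> // s; have := He s;
  rewrite !path_zero !path_one.
Qed.

Lemma pcat0 f g : pcat f g zero = f zero.
Proof. by rewrite /pcat ui_val0 mulr0 sub0r lerN10 clamp0. Qed.

Lemma pcat1 f g : pcat f g one = g one.
Proof.
rewrite /pcat ui_val1 mulr1 ifF; last by lra.
by rewrite (_ : 2 - 1 = 1) ?clamp1 //; lra.
Qed.

Lemma pcat_cont f g : continuous f -> continuous g -> f one = g zero ->
  continuous (pcat f g).
Proof.
move=> cf cg fg.
pose f' := mk_path cf erefl fg; pose g' := mk_path cg (erefl (g zero)) erefl.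
exact: (@cts_fun _ _ (path_cat f' g')).
Qed.

Lemma homotopic_refl f : continuous f -> homotopic f f.
Proof.
move=> cf; pose f' := mk_path cf erefl erefl.
exact/(homotopicE f' f')/path_homotopic_refl.
Qed.

Lemma homotopicP f g : homotopic f g ->
  [/\ continuous f, continuous g, f zero = g zero & f one = g one].
Proof.
move=> [H [cH H0 H1 He]]; split.
- rewrite (_ : f = fun t => H (t, zero)); last by apply/funext.
  by continuity.
- rewrite (_ : g = fun t => H (t, one)); last by apply/funext.
  by continuity.
- by rewrite -H1 (He _).1.
- by rewrite -H1 (He _).2.
Qed.

Lemma homotopic_sym f g : homotopic f g -> homotopic g f.
Proof.
move=> fg; have [cf cg e0 e1] := homotopicP fg.
pose f' := mk_path cf e0 e1; pose g' := mk_path cg (erefl (g zero)) (erefl (g one)).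
by apply/(homotopicE g' f')/path_homotopic_sym/(homotopicE f' g').
Qed.

Lemma homotopic_trans f g h : homotopic f g -> homotopic g h -> homotopic f h.
Proof.
move=> fg gh; have [cf cg e0 e1] := homotopicP fg; have [_ ch e0' e1'] := homotopicP gh.
pose f' := mk_path cf e0 e1; pose g' := mk_path cg (erefl (g zero)) (erefl (g one)).
pose h' := mk_path ch (esym e0') (esym e1').
apply/(homotopicE f' h')/(@path_homotopic_trans _ _ _ _ _ g').
  exact/(homotopicE f' g').
exact/(homotopicE g' h').
Qed.

Lemma homotopic_pcat f f' g g' : f one = g zero ->
  homotopic f f' -> homotopic g g' -> homotopic (pcat f g) (pcat f' g').
Proof.
move=> fg ff' gg'; have [cf cf' e0 e1] := homotopicP ff'.
have [cg cg' e0' e1'] := homotopicP gg'.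
pose pf := mk_path cf (erefl (f zero)) fg.
pose pf' := mk_path cf' (esym e0) (etrans (esym e1) fg).
pose pg := mk_path cg (erefl (g zero)) erefl.
pose pg' := mk_path cg' (esym e0') (esym e1').
apply/(homotopicE (path_cat pf pg) (path_cat pf' pg'))/path_homotopic_cat.
  exact/(homotopicE pf pf').
exact/(homotopicE pg pg').
Qed.

Lemma pcatA f g h : continuous f -> continuous g -> continuous h ->
  f one = g zero -> g one = h zero ->
  homotopic (pcat (pcat f g) h) (pcat f (pcat g h)).
Proof.
move=> cf cg ch fg gh.
pose f' := mk_path cf (erefl (f zero)) fg.
pose g' := mk_path cg (erefl (g zero)) gh.
pose h' := mk_path ch (erefl (h zero)) (erefl (h one)).
apply/(homotopicE (path_cat (path_cat f' g') h') (path_cat f' (path_cat g' h'))).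
exact: path_catA.
Qed.

Lemma pcat_cst f : continuous f -> homotopic (pcat f (cst (f one))) f.
Proof.
move=> cf; pose f' := mk_path cf (erefl (f zero)) (erefl (f one)).
by apply/(homotopicE (path_cat f' (path_id _)) f')/path_catid.
Qed.

Lemma cst_pcat f : continuous f -> homotopic (pcat (cst (f zero)) f) f.
Proof.
move=> cf; pose f' := mk_path cf (erefl (f zero)) (erefl (f one)).
by apply/(homotopicE (path_cat (path_id _) f') f')/path_idcat.
Qed.

End raw_paths.

Lemma pcat_comp (R : realType) (C X : topologicalType) (q : C -> X)
  (f g : unit_interval R -> C) :
  pcat (fun t => q (f t)) (fun t => q (g t)) = fun t => q (pcat f g t).
Proof. by apply/funext => t; rewrite /pcat; case: ifP. Qed.

Section convex.
Context {R : realType}.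
Local Notation I := (unit_interval R).

Lemma disk_val_continuous : continuous (fun z : disk R => \val z : R * R).
Proof. exact: (@initial_continuous (disk R) (R * R)%type set_val). Qed.

Definition convex_space (C : topologicalType) : Prop :=
  exists mix : (C * C) * I -> C,
    [/\ continuous mix, forall a b, mix (a, b, zero) = a,
        forall a b, mix (a, b, one) = b & forall a s, mix (a, a, s) = a].

(** The only source of homotopies below: two paths with the same ends in a convex
 space are joined by a straight homotopy. *)
Lemma homotopic_through (C X : topologicalType) (q : C -> X) (f g : I -> C) :
  convex_space C -> continuous q -> continuous f -> continuous g ->
  f zero = g zero -> f one = g one ->
  homotopic (fun t => q (f t)) (fun t => q (g t)).
Proof.
move=> [mix [cm m0 m1 me]] cq cf cg e0 e1.
exists (fun ts => q (mix (f ts.1, g ts.1, ts.2))); split=> /=.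
- by continuity.
- by move=> t; rewrite m0.
- by move=> t; rewrite m1.
- by move=> s; rewrite -e0 -e1 !me.
Qed.

Lemma convex_interval : convex_space I.
Proof.
exists (fun abs => clamp ((1 - ui_val abs.2) * ui_val abs.1.1
                          + ui_val abs.2 * ui_val abs.1.2)).
split=> /=.
- by continuity.
- by move=> a b; rewrite ui_val0 subr0 mul1r mul0r addr0 clampK.
- by move=> a b; rewrite ui_val1 subrr mul1r mul0r add0r clampK.
- by move=> a s; rewrite -mulrDl subrK mul1r clampK.
Qed.

Lemma convex_prod (C D : topologicalType) :
  convex_space C -> convex_space D -> convex_space (C * D)%type.
Proof.
move=> [m [cm m0 m1 me]] [n [cn n0 n1 ne]].
exists (fun abs => (m (abs.1.1.1, abs.1.2.1, abs.2), n (abs.1.1.2, abs.1.2.2, abs.2))).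
split=> /=.
- by continuity.
- by move=> [a a'] [b b'] /=; rewrite m0 n0.
- by move=> [a a'] [b b'] /=; rewrite m1 n1.
- by move=> [a a'] s /=; rewrite me ne.
Qed.

(** [1 - |(1 - s) a + s b|^2] is a convex combination of [1 - |a|^2] and
 [1 - |b|^2] plus [s (1 - s) |a - b|^2]. *)
Lemma convex_disk : convex_space (disk R).
Proof.
pose m (x : disk R * disk R * I) : R * R :=
  ((1 - ui_val x.2) * (\val x.1.1).1 + ui_val x.2 * (\val x.1.2).1,
   (1 - ui_val x.2) * (\val x.1.1).2 + ui_val x.2 * (\val x.1.2).2).
have mP x : m x \in [set z : R * R | z.1 ^+ 2 + z.2 ^+ 2 <= 1].
  rewrite inE /m /=; have /andP[] := ui_valP x.2.
  have /set_mem /= := valP x.1.1; have /set_mem /= := valP x.1.2.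
  move: (ui_val x.2) (\val x.1.1).1 (\val x.1.1).2 (\val x.1.2).1 (\val x.1.2).2.
  move=> s a b c d cd ab s0 s1.
  have : 0 <= s * (1 - s) * ((a - c) ^+ 2 + (b - d) ^+ 2).
    by apply: mulr_ge0; [apply: mulr_ge0; rewrite ?subr_ge0|apply: addr_ge0; exact: sqr_ge0].

  have : (1 - s) * (a ^+ 2 + b ^+ 2) <= 1 - s by rewrite ler_piMr //; lra.
  have : s * (c ^+ 2 + d ^+ 2) <= s by rewrite ler_piMr.
  move=> h1 h2 h3.
  rewrite (_ : ((1 - s) * a + s * c) ^+ 2 + _ = (1 - s) * (a ^+ 2 + b ^+ 2) + s * (c ^+ 2 + d ^+ 2)
     - s * (1 - s) * ((a - c) ^+ 2 + (b - d) ^+ 2)); last by ring.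
  lra.
exists (fun x => exist _ (m x) (mP x)); split.
- apply: (@continuous_comp_initial _ _ _ set_val).
  change (continuous m).
  by rewrite /m; continuity; apply: (comp_cont disk_val_continuous); continuity.
- move=> a b; apply/val_inj => /=; rewrite /m /= ui_val0 subr0 !mul1r !mul0r !addr0.
  by rewrite -surjective_pairing.
- move=> a b; apply/val_inj => /=; rewrite /m /= ui_val1 subrr !mul1r !mul0r !add0r.
  by rewrite -surjective_pairing.
- move=> a s; apply/val_inj => /=; rewrite /m /= -!mulrDl subrK !mul1r.
  by rewrite -surjective_pairing.
Qed.

End convex.

(** The sets where [P] and where its negation hold are both relatively open. *)
Lemma connected_locally_constant (Y : topologicalType) (B : set Y) (P : Y -> Prop) :
  connected B -> (forall y, B y -> \forall y' \near y, B y' -> (P y' <-> P y)) ->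
  forall y0, B y0 -> P y0 -> forall y, B y -> P y.
Proof.
move=> cB nP y0 By0 Py0 y By.
have key : B `&` P = B.
  apply: cB; first by exists y0.
  - exists [set z | B z -> P z]°; first exact: open_interior.
    apply/seteqP; split=> z [Bz zP]; split=> //.
      by apply: filterS (nP z Bz) => z' H Bz'; apply/(H Bz').
    exact: (nbhs_singleton zP).
  - exists (~` [set z | B z -> ~ P z]°); first exact/open_closedC/open_interior.
    apply/seteqP; split=> z [Bz zP]; split=> //.
      by move=> /nbhs_singleton /(_ Bz); exact.
    apply: contrapT => nPz; apply: zP.
    by apply: filterS (nP z Bz) => z' H Bz' Pz'; apply: nPz; apply/(H Bz').
by have [] : (B `&` P) y by rewrite key.
Qed.

Section compact_interval.
Context {R : realType}.
Local Notation I := (unit_interval R).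

Lemma clamp_image : [set: I] = (@clamp R) @` `[0, 1].
Proof.
apply/seteqP; split=> // t _; exists (ui_val t); last exact: clampK.
by rewrite /= in_itv /=; exact: ui_valP.
Qed.

Lemma interval_compact : compact [set: I].
Proof.
rewrite clamp_image; apply: continuous_compact; last exact: segment_compact.
exact/continuous_subspaceT/clamp_continuous.
Qed.

Lemma interval_connected : connected [set: I].
Proof.
rewrite clamp_image; apply: connected_continuous_connected; first exact: segment_connected.
exact/continuous_subspaceT/clamp_continuous.
Qed.

Lemma square_compact : compact [set: I * I].
Proof. by rewrite -setXTT; apply: compact_setX; exact: interval_compact. Qed.

Lemma disk_hausdorff : hausdorff_space (disk R).
Proof.
have hR : hausdorff_space R by exact: Rhausdorff.
move=> z w zw; apply/val_inj.
have sep (h : R * R -> R) : continuous h -> h (\val z) = h (\val w).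
  move=> ch; apply: hR => A B zA wB.
  have cv : continuous (fun z : disk R => h (\val z)) by exact: (comp_cont ch disk_val_continuous).
  have [u [Au Bu]] := zw _ _ (cv z _ zA) (cv w _ wB).
  by exists (h (\val u)).
rewrite [LHS]surjective_pairing [RHS]surjective_pairing; congr pair; apply: sep.
  exact: fst_cont.
exact: snd_cont.
Qed.

End compact_interval.

(** * Polar coordinates in the disk *)
Section polar.
Context {R : realType}.
Local Notation I := (unit_interval R).

Let polarP (rho : I) (a : R) : (ui_val rho * cos a, ui_val rho * sin a) \in
  [set z : R * R | z.1 ^+ 2 + z.2 ^+ 2 <= 1].
Proof.
rewrite inE /= !exprMn -mulrDr cos2Dsin2 mulr1.
by have /andP[? ?] := ui_valP rho; rewrite expr_le1.
Qed.

Definition polar (rho : I) (a : R) : disk R :=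
  exist (fun z => z \in [set z : R * R | z.1 ^+ 2 + z.2 ^+ 2 <= 1]) _ (polarP rho a).

Lemma polar_continuous : continuous (fun ra : I * R => polar ra.1 ra.2).
Proof.
apply: (@continuous_comp_initial _ _ _ set_val).
change (continuous (fun ra : I * R => (ui_val ra.1 * cos ra.2, ui_val ra.1 * sin ra.2))).
have ccos := @continuous_cos R; have csin := @continuous_sin R.
by continuity.
Qed.

(** [cos x = 1 - 2 sin^2 (x / 2)], and [sin] is positive inside [0, pi]. *)
Lemma cos_eq1 (x : R) : 0 <= x <= 2 * pi -> cos x = 1 -> x = 0 \/ x = 2 * pi.
Proof.
move=> /andP[x0 x1] cx.
have [x0'|x0'] := eqVneq x 0; first by left.
have [x1'|x1'] := eqVneq x (2 * pi); first by right.
have s0 : 0 < sin (x / 2).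
  by apply: sin_gt0_pi; apply/andP; split; lra.
have : cos (x / 2 + x / 2) = 1 by rewrite -splitr.
rewrite cosD -!expr2 cos2sin2 => E.
have : sin (x / 2) ^+ 2 = 0 by lra.
by move/eqP; rewrite expf_eq0 /= => /eqP; lra.
Qed.

Lemma cos_sin_inj (a b : R) : 0 <= a <= 2 * pi -> 0 <= b <= 2 * pi ->
  cos a = cos b -> sin a = sin b -> [\/ a = b, a = 0 /\ b = 2 * pi | a = 2 * pi /\ b = 0].
Proof.
wlog ab : a b / b <= a.
  move=> W ha hb ca sa; have [ba|/ltW ab] := leP b a; first exact: W.
  by have [->|[-> ->]|[-> ->]] := W b a ab hb ha (esym ca) (esym sa);
    [constructor 1|constructor 3|constructor 2].
move=> ha hb ca sa.
have : cos (a - b) = 1 by rewrite cosB ca sa -!expr2 cos2Dsin2.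
move/cos_eq1; case; first by apply/andP; split; lra.
  by move=> ?; constructor 1; lra.
by move=> ?; constructor 3; lra.
Qed.

(** The angle is the arc cosine of the abscissa in the upper half plane, and is
 obtained by reflection in the lower one. *)
Lemma polar_surj (z : disk R) : exists rho a, 0 <= a < 2 * pi /\ z = polar rho a.
Proof.
case: z => -[x y] zP; have /set_mem /= xy := zP.
have pi0 := pi_gt0 R.
set n := x ^+ 2 + y ^+ 2 in xy.
have n0 : 0 <= n by rewrite addr_ge0 ?sqr_ge0.
pose rho := Num.sqrt n.
have rho0 : 0 <= rho by exact: sqrtr_ge0.
have rho2 : rho ^+ 2 = n by exact: sqr_sqrtr.
have rho1 : rho <= 1 by rewrite -(@expr_le1 _ 2) // rho2.
have [E|rho_neq0] := eqVneq rho 0.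
  exists (clamp rho), 0; split; first by lra.
  apply/val_inj => /=; rewrite clampE ?rho0 // E !mul0r.
  move: rho2; rewrite E expr0n /= /n => /esym/eqP.
  by rewrite paddr_eq0 ?sqr_ge0 // !expf_eq0 /= => /andP[/eqP-> /eqP->].
have rho_gt0 : 0 < rho by rewrite lt_neqAle eq_sym rho_neq0.
have x2 : x ^+ 2 <= rho ^+ 2 by rewrite rho2 /n lerDl sqr_ge0.
have xr : -1 <= x / rho <= 1.
  rewrite -ler_norml normrM normfV (gtr0_norm rho_gt0) ler_pdivrMr // mul1r.
  by rewrite -(@ler_pXn2r _ 2) ?nnegrE // real_normK // num_real.
pose b := acos (x / rho).
have cb : cos b = x / rho by apply: acosK; rewrite in_itv.
have b0 : 0 <= b by exact: acos_ge0.
have bpi : b <= pi by exact: acos_lepi.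
have sb : sin b = `|y| / rho.
  rewrite sin_acos // -(@ger0_norm _ (`|y| / rho)); last by rewrite divr_ge0.
  rewrite -sqrtr_sqr; congr Num.sqrt.
  rewrite !exprMn !exprVn real_normK ?num_real // rho2 /n.
  by field; rewrite -/n -rho2 sqrf_eq0.
have [y0|y0] := leP 0 y.
  exists (clamp rho), b; split; first by lra.
  apply/val_inj => /=; rewrite clampE ?rho0 // cb sb ger0_norm //.
  by congr pair; field.
exists (clamp rho), (- b + pi *+ 2); split.
  rewrite mulr2n; apply/andP; split; first by lra.
  have [E|?] := eqVneq b 0; last by lra.
  move: sb; rewrite E sin0 => /esym/eqP.
  by rewrite mulf_eq0 invr_eq0 (negbTE rho_neq0) orbF normr_eq0 lt_eqF.
apply/val_inj => /=; rewrite clampE ?rho0 // cosD2pi sinD2pi cosN sinN cb sb ltr0_norm //.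
by congr pair; field.
Qed.

Lemma polar_inj rho rho' (a a' : R) : polar rho a = polar rho' a' ->
  rho = rho' /\ (rho = zero \/ cos a = cos a' /\ sin a = sin a').
Proof.
move=> /(congr1 \val) /= [E1 E2].
have sqE (x : R) b : (x * cos b) ^+ 2 + (x * sin b) ^+ 2 = x ^+ 2.
  by rewrite !exprMn -mulrDr cos2Dsin2 mulr1.
have E : rho = rho'.
  apply: ui_val_inj; have /andP[? _] := ui_valP rho; have /andP[? _] := ui_valP rho'.
  by apply: (@pexpIrn _ 2) => //; rewrite -(sqE _ a) E1 E2 sqE.
split=> //; subst rho'.
have [e|e] := eqVneq (ui_val rho) 0; [left|right].
  by apply: ui_val_inj; rewrite ui_val0.
by split; apply: (mulfI e).
Qed.

End polar.

(** * Charts of the complex *)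
Section cells.
Context {r : nat} {G : graph}.
Implicit Types c : short_even_cycle r G.

Definition clen c : nat := (2 * half_length c)%N.

Lemma clen_gt3 c : (3 < clen c)%N.
Proof. by rewrite /clen; have := half_length_bounds c; lia. Qed.

Lemma clen_gt0 c : (0 < clen c)%N.
Proof. by have := clen_gt3 c; lia. Qed.

Definition cidx c (i : nat) : 'I_(clen c) := Ordinal (ltn_pmod i (clen_gt0 c)).

(** Indices are natural numbers read modulo the length of the cycle, so that the
 successor of an index needs no case analysis. *)
Definition cyc c (i : nat) : G := Defs.cycle_map c (cidx c i).

Lemma ordS_cidx c i : ordS (cidx c i) = cidx c i.+1.
Proof. by apply/val_inj; rewrite /= -addn1 modnDml addn1. Qed.

Lemma cyc_edge c i : edge (cyc c i) (cyc c i.+1).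
Proof. by apply: hom_edge; left; rewrite ordS_cidx. Qed.

Lemma cyc_mod c i : cyc c (i %% clen c) = cyc c i.
Proof. by congr (Defs.cycle_map c _); apply/val_inj; rewrite /= modn_mod. Qed.

Lemma cyc_period c i : cyc c (i + clen c) = cyc c i.
Proof. by rewrite -cyc_mod modnDr cyc_mod. Qed.

End cells.

Section charts.
Context {R : realType} {r : nat} {G : graph}.
Local Notation I := (unit_interval R).
Local Notation X := (Xr R r G).
Implicit Types c : short_even_cycle r G.

Definition angle c (k : nat) (t : R) : R := 2 * pi * (k%:R + t) / (clen c)%:R.

Definition rchart (p : realization R G) : X := \pi_X (@in_realization R r G p).
Definition dchart c (z : disk R) : X := \pi_X (in_disk c z).

(** Total in [x] and [y]; the value is meaningful only when [x] and [y] span a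
 simplex. *)
Definition echart (x y : G) (t : I) : X :=
  if pselect (spans_simplex x y) is left xy then rchart (simplex_point xy t)
  else Xr_vertex R r x.

Lemma echartE x y (xy : spans_simplex x y) t :
  echart x y t = rchart (simplex_point xy t).
Proof.
rewrite /echart; case: pselect => // xy'.
by rewrite (Prop_irrelevance xy' xy).
Qed.

(** The [k]-th sector of the disk of [c], in polar coordinates: [y.1] is the radius
 and [y.2] the position on the [k]-th edge. *)
Definition schart c (k : nat) (y : I * I) : X :=
  dchart c (polar y.1 (angle c k (ui_val y.2))).

Lemma rchart_continuous : continuous rchart.
Proof.
move=> p; apply: continuous_comp; first exact: existT_continuous.
exact: pi_continuous.
Qed.

Lemma dchart_continuous c : continuous (dchart c).
Proof.
move=> p; apply: continuous_comp; last exact: pi_continuous.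
exact: (@existT_continuous _ (@piece R r G) (Some c)).
Qed.

Lemma simplex_point_continuous x y (xy : spans_simplex x y) :
  continuous (@simplex_point R G x y xy).
Proof. by apply/continuousP => U oU; exact: oU. Qed.

Lemma echart_continuous x y : continuous (echart x y).
Proof.
rewrite /echart; case: pselect => [xy|_]; last exact: cst_cont.
exact: (comp_cont rchart_continuous (@simplex_point_continuous _ _ _)).
Qed.

Lemma angle_continuous c k : continuous (angle c k).
Proof. by rewrite /angle; continuity. Qed.

Lemma polar_sector_continuous c k :
  continuous (fun y : I * I => polar y.1 (angle c k (ui_val y.2))).
Proof.
apply: (comp_cont (g := fun ra : I * R => polar ra.1 ra.2)
  (f := fun y : I * I => (y.1, angle c k (ui_val y.2)))).
  exact: polar_continuous.
have ca := @angle_continuous c k.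
by continuity.
Qed.

Lemma schart_continuous c k : continuous (schart c k).
Proof. exact: (comp_cont (@dchart_continuous c) (@polar_sector_continuous c k)). Qed.

Lemma clenR_gt0 c : 0 < (clen c)%:R :> R.
Proof. by rewrite ltr0n clen_gt0. Qed.

Lemma polar_period c (rho : I) k t :
  polar rho (angle c (k + clen c) t) = polar rho (angle c k t).
Proof.
apply/val_inj => /=.
have -> : angle c (k + clen c) t = angle c k t + pi *+ 2.
  rewrite /angle natrD mulr2n; field.
  by rewrite gt_eqF // clenR_gt0.
by rewrite cosD2pi sinD2pi.
Qed.

Lemma polar_mod c (rho : I) k t :
  polar rho (angle c (k %% clen c) t) = polar rho (angle c k t).
Proof.
rewrite {2}(divn_eq k (clen c)); elim: (k %/ clen c)%N => [|m IH].
  by rewrite mul0n add0n.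
by rewrite mulSn -addnA [(clen c + _)%N]addnC polar_period.
Qed.

Lemma schart_mod c k y : schart c (k %% clen c) y = schart c k y.
Proof. by rewrite /schart polar_mod. Qed.

Lemma schart_center c k k' t t' : schart c k (zero, t) = schart c k' (zero, t').
Proof. by congr dchart; apply/val_inj; rewrite /= ui_val0 !mul0r. Qed.

Lemma schart_next c k rho : schart c k (rho, one) = schart c k.+1 (rho, zero).
Proof.
congr (dchart _ (polar _ _)) => /=; rewrite /angle ui_val0 ui_val1.
by rewrite addr0 natr1.
Qed.

Lemma attach_eq (a b : pieces R r G) : attach a b -> \pi_X a = \pi_X b.
Proof. by move=> ab; apply/eqmodP/generated_equivP/rst_step. Qed.

Lemma schart_boundary c k t : schart c k (one, t) = echart (cyc c k) (cyc c k.+1) t.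
Proof.
rewrite -schart_mod /schart.
have e := cycle_spans (Defs.cycle_map c) (cidx c k).
rewrite [cyc c k.+1]/cyc -ordS_cidx (echartE e).
rewrite (Prop_irrelevance e (cycle_spans (Defs.cycle_map c) (cidx c k))).
rewrite /rchart -(attach_eq (Attach _ _)) /dchart /=.
congr (\pi_X (in_disk c _)); apply/val_inj => /=.
by rewrite ui_val1 !mul1r.
Qed.

(** With angle [2 pi u / n], the sector is the integral part of [u]. *)
Lemma disk_sector c (z : disk R) : exists2 k, (k < clen c)%N &
  exists y : I * I, z = polar y.1 (angle c k (ui_val y.2)).
Proof.
have [rho [a [/andP[a0 a1] ->]]] := polar_surj z.
have pi0 := pi_gt0 R; have n0 := clenR_gt0 c.
pose u := a * (clen c)%:R / (2 * pi).
have u0 : 0 <= u by rewrite /u !mulr_ge0 ?invr_ge0 ?(ltW n0) //; lra.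
have un : u < (clen c)%:R.
  rewrite /u ltr_pdivrMr; last by lra.
  by rewrite mulrC ltr_pM2l.
pose k := Num.truncn u.
have /andP[ku uk] : k%:R <= u < k.+1%:R by exact: truncn_itv.
exists k.
  by rewrite -(ltr_nat R) (le_lt_trans ku).
exists (rho, clamp (u - k%:R)) => /=.
rewrite clampE; last by rewrite -natr1 in uk; lra.
congr polar; rewrite /angle /u.
move: pi0 n0; move: (pi : R) (clen c)%:R => p n p0 n0.
by field; rewrite !gt_eqF.
Qed.

(** Two sectors meet only at the center and, if they are consecutive, along a
 radius. *)
Lemma polar_sector_inj c k k' (y y' : I * I) : (k < clen c)%N -> (k' < clen c)%N ->
  polar y.1 (angle c k (ui_val y.2)) = polar y'.1 (angle c k' (ui_val y'.2)) ->
  y.1 = y'.1 /\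
  [\/ y.1 = zero, k = k' /\ y.2 = y'.2,
      [/\ (k.+1 = k' %[mod clen c])%N, y.2 = one & y'.2 = zero] |
      [/\ (k'.+1 = k %[mod clen c])%N, y'.2 = one & y.2 = zero]].
Proof.
case: y y' => [rho t] [rho' t'] /= kn kn' /polar_inj[-> E]; split=> //.
case: E => [->|[E1 E2]]; first by constructor 1.
have pi0 := pi_gt0 R; have n0 := clenR_gt0 c.
have /andP[t0 t1] := ui_valP t; have /andP[t0' t1'] := ui_valP t'.
have angP j s : (j < clen c)%N -> 0 <= s <= 1 -> 0 <= angle c j s <= 2 * pi.
  move=> jn /andP[s0 s1]; rewrite /angle; apply/andP; split.
    apply: divr_ge0; last exact: ltW.
    apply: mulr_ge0; [by rewrite mulr_ge0 // ltW|exact: addr_ge0].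
  rewrite ler_pdivrMr // ler_pM2l; last by lra.
  apply: (@le_trans _ _ j.+1%:R); last by rewrite ler_nat.
  by rewrite -natr1 lerD2l.
have angK j s : angle c j s * (clen c)%:R / (2 * pi) = j%:R + s.
  rewrite /angle; move: pi0 n0; move: (pi : R) (clen c)%:R => p n p0 n0.
  by field; rewrite !gt_eqF.
have natE j s j' s' : 0 <= s <= 1 -> 0 <= s' <= 1 -> j%:R + s = j'%:R + s' :> R ->
   [\/ j = j' /\ s = s', [/\ j.+1 = j', s = 1 & s' = 0] | [/\ j'.+1 = j, s' = 1 & s = 0]].
  move=> /andP[s0 s1] /andP[s0' s1'] e; case: (ltngtP j j') => jj.
  - have h : j.+1%:R <= j'%:R :> R by rewrite ler_nat.
    rewrite -natr1 in h; constructor 2; split; [|lra|lra].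
    apply/eqP; rewrite eqn_leq jj -(ler_nat R) -natr1; lra.
  - have h : j'.+1%:R <= j%:R :> R by rewrite ler_nat.
    rewrite -natr1 in h; constructor 3; split; [|lra|lra].
    apply/eqP; rewrite eqn_leq jj -(ler_nat R) -natr1; lra.
  - by constructor 1; split=> //; subst j'; lra.
have angE j s j' s' : angle c j s = angle c j' s' -> j%:R + s = j'%:R + s'.
  by move=> e; rewrite -angK e angK.
have zE : angle c 0 0 = 0 by rewrite /angle addr0 mulr0 mul0r.
have nE : angle c (clen c) 0 = 2 * pi by rewrite /angle addr0 mulfK // gt_eqF.
have I0 : 0 <= (0 : R) <= 1 by rewrite lexx ler01.
have toI (s : I) (x : I) : ui_val s = ui_val x -> s = x by exact: ui_val_inj.
case: (cos_sin_inj (angP _ _ kn (ui_valP t)) (angP _ _ kn' (ui_valP t')) E1 E2).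
- move=> /angE/natE; case=> [||[-> e]|[e e1 e0]|[e e1 e0]]; [exact: ui_valP..| | |].
  + by constructor 2; split=> //; exact: toI.
  + by constructor 3; rewrite e; split=> //; apply: toI; rewrite ?ui_val0 ?ui_val1.
  + by constructor 4; rewrite e; split=> //; apply: toI; rewrite ?ui_val0 ?ui_val1.
- rewrite -{1}zE -nE => -[/angE/natE A /angE/natE B].
  case: A => [||[k0 s0]|[]|[? ?]]; [exact: ui_valP|exact: I0| |by []|by lra].
  case: B => [||[]|[kk s1 _]|[]]; [exact: ui_valP|exact: I0|by lia| |by lia].
  constructor 4; rewrite kk k0 mod0n modnn; split=> //; apply: toI.
    by rewrite ui_val1.
  by rewrite ui_val0.
- rewrite -zE -{1}nE => -[/angE/natE B /angE/natE A].
  case: A => [||[k0 s0]|[]|[? ?]]; [exact: ui_valP|exact: I0| |by []|by lra].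
  case: B => [||[]|[kk s1 _]|[]]; [exact: ui_valP|exact: I0|by lia| |by lia].
  constructor 3; rewrite kk k0 mod0n modnn; split=> //; apply: toI.
    by rewrite ui_val1.
  by rewrite ui_val0.
Qed.

End charts.

(** * The topology of the complex *)
Section final_topology.
Context {R : realType}.
Local Notation I := (unit_interval R).

Lemma interval_hausdorff : hausdorff_space I.
Proof.
move=> s t st; apply: ui_val_inj; apply: Rhausdorff => A B sA tB.
have [u [Au Bu]] := st _ _ (@ui_val_continuous R s _ sA) (@ui_val_continuous R t _ tB).
by exists (ui_val u).
Qed.

Definition final_family (J : Type) (Y : J -> topologicalType) (X : topologicalType)
    (chart : forall j, Y j -> X) : Prop :=
  (forall x, exists j y, x = chart j y) /\
  (forall U : set X, (forall j, open (@chart j @^-1` U)) -> open U).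

Lemma final_family_continuous (J : Type) (Y : J -> topologicalType)
    (X Z : topologicalType) (chart : forall j, Y j -> X) (f : X -> Z) :
  final_family chart -> (forall j, continuous (fun y => f (@chart j y))) ->
  continuous f.
Proof.
move=> [_ fin] cf; apply/continuousP => A oA; apply: fin => j.
by move/continuousP: (cf j); apply.
Qed.

(** The product of a quotient map with the interval is again a quotient map, in a
 version relative to an open set [U].  Around [(x, s)], take a compact
 neighbourhood [K] of [s] such that [f] maps [x * K] to the given open set [B];
 by compactness of [K], the points [x'] of [U] such that [f] maps [x' * K] to [B]
 form an open set, because this can be checked in the charts. *)
Lemma final_family_prod_continuous (J : Type) (Y : J -> topologicalType)
    (X Z : topologicalType) (chart : forall j, Y j -> X) (f : X * I -> Z) (U : set X) :
  final_family chart -> open U ->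
  (forall j, continuous (@chart j)) ->
  (forall j y s, U (chart j y) ->
     {for (y, s), continuous (fun ys => f (chart j ys.1, ys.2))}) ->
  forall x s, U x -> {for (x, s), continuous f}.
Proof.
move=> [surj fin] oU cc cf x s Ux B /=.
rewrite nbhsE => -[B' [oB' B'x] B'B].
have [j [y xE]] := surj x; subst x.
have {B'x} : nbhs (y, s) [set ys | B' (f (chart j ys.1, ys.2))].
  by apply: (cf _ _ _ Ux); exact: open_nbhs_nbhs.
case=> -[N1 N2] /= [N1y N2s] N12.
have cT : compact [set: I] by exact: interval_compact.
have [K [Ks cK] KN2] : exists2 K : set I, nbhs s K /\ compact K & K `<=` N2.
  have [K Ks KN] := @compact_regular I s setT interval_hausdorff cT filterT N2 N2s.
  exists (closure K) => //; split; first by apply: filterS Ks; exact: subset_closure.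
  by apply: (subclosed_compact _ cT) => //; exact: closed_closure.
pose A := [set x | U x /\ forall s', K s' -> B' (f (x, s'))].
have oA : open A.
  apply: fin => i; rewrite openE => z [Uz Kz]; rewrite /interior.
  have nU : \forall z' \near z, U (chart i z').
    by apply: (cc i z); exact: open_nbhs_nbhs.
  have : \forall z' \near z, K `<=` (fun s' => B' (f (chart i z', s'))).
    move/compact_near_coveringP: cK; apply => s' Ks'.
    have : nbhs (z, s') [set ys | B' (f (chart i ys.1, ys.2))].
      by apply: (cf _ _ _ Uz); apply: open_nbhs_nbhs; split=> //; exact: Kz.
    by case=> -[M1 M2] /= [? ?] M12; exists (M2, M1) => // -[? ?] [? ?]; exact: (M12 (_, _)).
  by move=> nK; apply: filterS2 nU nK => z' ? KB; split.
exists (A, K) => /=.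
  split=> //; apply: open_nbhs_nbhs; split=> //; split=> // s' Ks'.
  exact: (N12 (y, s') (conj (nbhs_singleton N1y) (KN2 _ Ks'))).
by move=> [x' s'] /= [[_ KB] Ks']; apply: B'B; exact: KB.
Qed.

End final_topology.

Section charts_final.
Context {R : realType} {r : nat} {G : graph}.
Local Notation I := (unit_interval R).
Local Notation X := (Xr R r G).
Implicit Types c : short_even_cycle r G.

(** Only pairs spanning a simplex are kept: on the other ones [echart] is a
 constant. *)
Definition chart_index : Type :=
  ({ab : G * G | spans_simplex ab.1 ab.2} + short_even_cycle r G * nat)%type.

Definition chart_dom (j : chart_index) : topologicalType :=
  if j is inl _ then I else (I * I)%type.

Definition chart (j : chart_index) : chart_dom j -> X :=
  match j with
  | inl ab => @echart R r G (sval ab).1 (sval ab).2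
  | inr ck => @schart R r G ck.1 ck.2
  end.

Lemma chart_continuous j : continuous (@chart j).
Proof. by case: j => ?; [exact: echart_continuous|exact: schart_continuous]. Qed.

Lemma Xr_cover (x : X) :
  (exists a b t, spans_simplex a b /\ x = echart a b t) \/
  (exists c k y, x = schart c k y).
Proof.
rewrite -[x]reprK; case: (repr x) => -[c|] z.
  by right; have [k _ [y ->]] := disk_sector c z; exists c, k, y.
left; case: z => p [a [b [t [ab /= t01 pE]]]].
exists a, b, (clamp t); split=> //; rewrite (echartE ab).
congr (\pi_X (existT _ _ _)).
subst p; rewrite /simplex_point; move: (ex_intro _ _ _) (ex_intro _ _ _).
by rewrite clampE // => E E'; rewrite (Prop_irrelevance E E').
Qed.

(** The sectors of a disk are finitely many compact sets covering it, so a set whose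
 traces on the sectors are closed is a finite union of compact sets. *)
Lemma chart_final : final_family chart.
Proof.
split=> [x|U oU].
  case: (Xr_cover x) => [[a [b [t [ab ->]]]]|[c [k [y ->]]]].
    by exists (inl (exist (fun ab => spans_simplex ab.1 ab.2) (a, b) ab)), t.
  by exists (inr (c, k)), y.
change (open (\pi_X @^-1` U)).
apply/sigT_openP => -[c|].
  set A := _ @^-1` _; rewrite -[A]setCK; apply: closed_openC.
  pose f k (y : I * I) : disk R := polar y.1 (angle c k (ui_val y.2)).
  have -> : ~` A = \bigcup_(k in [set k | (k < clen c)%N]) (f k @` (f k @^-1` ~` A)).
    apply/seteqP; split=> [z Az|z [k _ [y Ay <-]]] //.
    by have [k kn [y yE]] := disk_sector c z; exists k => //; exists y; rewrite /preimage /= /f -yE.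
  apply: closed_bigcup => [|k _]; first exact: finite_II.
  apply: (compact_closed disk_hausdorff).
  apply: continuous_compact; first exact/continuous_subspaceT/polar_sector_continuous.
  apply: (subclosed_compact _ square_compact) => //.
  rewrite preimage_setC; apply: open_closedC.
  exact: (oU (inr (c, k))).
move=> a b ab.
rewrite (_ : _ @^-1` _ = echart a b @^-1` U).
  exact: (oU (inl (exist (fun ab => spans_simplex ab.1 ab.2) (a, b) ab))).
by apply/funext => t; rewrite /preimage /= (echartE ab).
Qed.

(** A function on the complex is given by its values [fE] on the graph and [fD] on
 the sectors, provided that they agree along common radii, at the centers and on
 the boundary. *)
Section recursion.
Context (T : Type) (fE : realization R G -> T)
  (fD : short_even_cycle r G -> nat -> I * I -> T).
Hypothesis fD_mod : forall c k y, fD c (k %% clen c) y = fD c k y.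
Hypothesis fD_next : forall c k rho, fD c k (rho, one) = fD c k.+1 (rho, zero).
Hypothesis fD_center : forall c k k' t t', fD c k (zero, t) = fD c k' (zero, t').
Hypothesis fD_boundary : forall c k t (e : spans_simplex (cyc c k) (cyc c k.+1)),
  fD c k (one, t) = fE (simplex_point e t).

Let gD c (z : disk R) : T :=
  let P := disk_sector c z in
  let: k := sval (cid2 P) in let: y := sval (cid (s2valP' (cid2 P))) in fD c k y.

Let gDE c k y : gD c (polar y.1 (angle c k (ui_val y.2))) = fD c k y.
Proof.
rewrite /gD; case: cid2 => k' kn' E /=; case: cid => y' /= {E}.
rewrite -(polar_mod c) -(fD_mod c k).
have : (k %% clen c < clen c)%N by rewrite ltn_mod clen_gt0.
move: (k %% clen c)%N => {}k kn.
case: y y' => [rho t] [rho' t'] /(polar_sector_inj kn kn')[/= <-].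
case=> [->|[-> ->]|[E -> ->]|[E -> ->]] //.
- by rewrite (fD_next c k) -(fD_mod c k.+1) E fD_mod.
- by rewrite (fD_next c k') -(fD_mod c k'.+1) E fD_mod.
Qed.

Let g (a : pieces R r G) : T :=
  match a with existT i z =>
    (match i return piece R i -> T with None => fE | Some c => gD c end) z
  end.

Let g_attach a b : attach a b -> g a = g b.
Proof.
case=> c k t /=.
have -> : circle_point (2 * pi * (k%:R + ui_val t) / (2 * half_length c)%:R) =
          polar (one : I, t).1 (angle c k (ui_val (one : I, t).2)).
  by apply/val_inj; rewrite /= ui_val1 !mul1r.
rewrite gDE.
have kE : cidx c k = k by apply/val_inj; rewrite /= modn_small.
have e : spans_simplex (cyc c k) (cyc c k.+1) by right; exact: cyc_edge.
rewrite (fD_boundary _ e); congr fE.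
move: e; rewrite /cyc -ordS_cidx kE => e.
by rewrite (Prop_irrelevance e (cycle_spans (Defs.cycle_map c) k)).
Qed.

Let g_rst a b : clos_refl_sym_trans _ (@attach R r G) a b -> g a = g b.
Proof. by elim=> [|//|? ? _ ->//|? ? ? _ -> _ ->//]; exact: g_attach. Qed.

Lemma Xr_rec : exists F : X -> T, (forall p, F (rchart p) = fE p) /\
  (forall c k y, F (schart c k y) = fD c k y).
Proof.
have gK a : g (repr (\pi_X a)) = g a.
  have /eqmodP/generated_equivP : \pi_X (repr (\pi_X a)) = \pi_X a by rewrite reprK.
  exact: g_rst.
exists (fun x => g (repr x)); split=> [p|c k y].
  by rewrite /rchart gK.
by rewrite /schart /dchart gK; exact: gDE.
Qed.

End recursion.
End charts_final.

(** * The cover by vertex stars and open disks *)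
Section bary.
Context {R : realType} {G : graph}.
Local Notation I := (unit_interval R).
Implicit Types (a b v : G) (t : R).

Lemma baryE a b t v : bary a b t v = (1 - t) * `[< v = a >]%:R + t * `[< v = b >]%:R.
Proof.
by rewrite /bary !indicE; congr (_ * _%:R + _ * _%:R); apply/idP/idP;
  rewrite inE /= => /asboolP.
Qed.

Lemma bary_ge0 a b (t : I) v : 0 <= bary a b (ui_val t) v.
Proof.
have /andP[t0 t1] := ui_valP t.
by rewrite baryE addr_ge0 // mulr_ge0 // subr_ge0.
Qed.

(** Positivity of the piecewise linear functions on an edge with values 0 or 1 at
 the ends. *)
Lemma hat_gt0 (t : I) (p q : bool) :
  0 < (1 - ui_val t) * p%:R + ui_val t * q%:R <->
  p /\ ui_val t < 1 \/ q /\ 0 < ui_val t.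
Proof.
have /andP[t0 t1] := ui_valP t.
case: p; case: q; rewrite /= ?mulr1 ?mulr0 ?addr0 ?add0r; split=> //.
- by move=> _; have [?|?] := ltP (ui_val t) 1; [left|right; split=> //; lra].
- by rewrite subrK.
- by rewrite subr_gt0; left.
- by case=> -[//]; rewrite subr_gt0.
- by right.
- by case=> -[].
- by rewrite ltxx.
- by case=> -[].
Qed.

Lemma bary_gt0 a b (t : I) v : 0 < bary a b (ui_val t) v <->
  v = a /\ ui_val t < 1 \/ v = b /\ 0 < ui_val t.
Proof.
by rewrite baryE; split=> [/hat_gt0[] []/asboolP|[] [/asboolP ? ?]];
  [left|right|apply/hat_gt0; left|apply/hat_gt0; right].
Qed.

Lemma bary_continuous a b v : continuous (fun t : I => bary a b (ui_val t) v).
Proof. by rewrite /bary; continuity. Qed.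

End bary.

Section cover.
Context {R : realType} {r : nat} {G : graph}.
Context (simpleG : simple_graph G).
Local Notation I := (unit_interval R).
Local Notation X := (Xr R r G).
Implicit Types (c : short_even_cycle r G) (v w : G) (x : X).

Lemma cyc_mod_eq c j k : (j = k %[mod clen c])%N -> cyc c j = cyc c k.
Proof. by move=> jk; rewrite -cyc_mod jk cyc_mod. Qed.

Lemma succ_modn n k : ((k %% n).+1 = k.+1 %[mod n])%N.
Proof. by rewrite -addn1 modnDml addn1. Qed.

Lemma cyc_neq c k : cyc c k <> cyc c k.+1.
Proof. by move=> E; apply: (simpleG (x := cyc c k)); rewrite {2}E; exact: cyc_edge. Qed.

Lemma cell_function (T : topologicalType) (fE : realization R G -> T)
    (fD : short_even_cycle r G -> nat -> I * I -> T) :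
  (forall c k y, fD c (k %% clen c)%N y = fD c k y) ->
  (forall c k rho, fD c k (rho, one) = fD c k.+1 (rho, zero)) ->
  (forall c k k' t t', fD c k (zero, t) = fD c k' (zero, t')) ->
  (forall c k t (e : spans_simplex (cyc c k) (cyc c k.+1)),
     fD c k (one, t) = fE (simplex_point e t)) ->
  (forall a b (ab : spans_simplex a b), continuous (fun t : I => fE (simplex_point ab t))) ->
  (forall c k, continuous (fD c k)) ->
  exists F : X -> T, [/\ forall p, F (rchart p) = fE p,
    forall c k y, F (schart c k y) = fD c k y & continuous F].
Proof.
move=> fm fn f0 f1 cE cD; have [F [FE FD]] := Xr_rec fm fn f0 f1.
exists F; split=> //; apply: (final_family_continuous (@chart_final R r G)).
case=> [[[a b] /= ab]|[c k]] /=.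
  by under eq_fun do rewrite (echartE ab) FE; exact: cE.
by under eq_fun do rewrite FD; exact: cD.
Qed.

(** The barycentric coordinate of [v], extended to the disks by homogeneity in the
 radius.  The open star of [v] is the set where it is positive. *)
Lemma weight_exists v : exists W : X -> R,
  [/\ forall p, W (rchart p) = sval p v,
      forall c k y, W (schart c k y) =
        ui_val y.1 * bary (cyc c k) (cyc c k.+1) (ui_val y.2) v & continuous W].
Proof.
apply: cell_function => /=.
- by move=> c k y; rewrite cyc_mod (cyc_mod_eq (succ_modn _ _)).
- move=> c k rho; rewrite !baryE ui_val0 ui_val1; congr (_ * _).
  by rewrite subrr mul0r add0r mul1r subr0 mul1r mul0r addr0.
- by move=> c k k' t t'; rewrite ui_val0 !mul0r.
- by move=> c k t e; rewrite ui_val1 mul1r.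
- by move=> a b ab; exact: bary_continuous.
- move=> c k; apply: mul_cont; first by continuity.
  exact: (comp_cont (@bary_continuous R G (cyc c k) (cyc c k.+1) v) (@snd_cont _ _)).
Qed.

Definition weight v : X -> R := sval (cid (weight_exists v)).

Lemma weight_rchart v p : weight v (rchart p) = sval p v.
Proof. by rewrite /weight; case: cid => W /= []. Qed.

Lemma weight_schart v c k y : weight v (schart c k y) =
  ui_val y.1 * bary (cyc c k) (cyc c k.+1) (ui_val y.2) v.
Proof. by rewrite /weight; case: cid => W /= []. Qed.

Lemma weight_continuous v : continuous (weight v).
Proof. by rewrite /weight; case: cid => W /= []. Qed.

(** The distance to the boundary in the disk of [c], extended by zero: it is
 positive exactly in the open disk. *)
Lemma depth_exists c : exists d : X -> R,
  [/\ forall p, d (rchart p) = 0,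
      forall c' k y, d (schart c' k y) = (c' == c)%:R * (1 - ui_val y.1) & continuous d].
Proof.
apply: cell_function => //=.
- by move=> c' k t e; rewrite ui_val1 subrr mulr0.
- by move=> a b ab; exact: cst_cont.
- by move=> c' k; continuity.
Qed.

Definition depth c : X -> R := sval (cid (depth_exists c)).

Lemma depth_rchart c p : depth c (rchart p) = 0.
Proof. by rewrite /depth; case: cid => W /= []. Qed.

Lemma depth_schart c c' k y : depth c (schart c' k y) = (c' == c)%:R * (1 - ui_val y.1).
Proof. by rewrite /depth; case: cid => W /= []. Qed.

Lemma depth_continuous c : continuous (depth c).
Proof. by rewrite /depth; case: cid => W /= []. Qed.

(** A function that is positive, in the punctured open disk of [c], exactly on the
 union of the two sectors adjacent to the [j]-th radius.  As [c] may pass several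
 times through the same vertex [v], these sets are the components of the
 intersection of the disk with the star of [v]. *)
Lemma sector_exists c j : exists h : X -> R,
  [/\ forall p, h (rchart p) = 0,
      forall c' k y, h (schart c' k y) = (c' == c)%:R * (ui_val y.1 * (1 - ui_val y.1) *
        ((1 - ui_val y.2) * (k == j %[mod clen c])%N%:R
         + ui_val y.2 * (k.+1 == j %[mod clen c])%N%:R)) & continuous h].
Proof.
apply: cell_function => //=.
- move=> c' k y; have [->|] := eqVneq c' c; last by rewrite !mul0r.
  by rewrite modn_mod succ_modn.
- move=> c' k rho; rewrite ui_val0 ui_val1 subrr subr0 !mul0r add0r addr0 !mul1r.
  by [].
- by move=> c' k k' t t'; rewrite ui_val0 !mul0r !mulr0.
- by move=> c' k t e; rewrite ui_val1 subrr mulr0 mul0r mulr0.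
- by move=> a b ab; exact: cst_cont.
- by move=> c' k; continuity.
Qed.

Definition sector c j : X -> R := sval (cid (sector_exists c j)).

Lemma sector_rchart c j p : sector c j (rchart p) = 0.
Proof. by rewrite /sector; case: cid => W /= []. Qed.

Lemma sector_schart c j c' k y : sector c j (schart c' k y) =
  (c' == c)%:R * (ui_val y.1 * (1 - ui_val y.1) *
        ((1 - ui_val y.2) * (k == j %[mod clen c])%N%:R
         + ui_val y.2 * (k.+1 == j %[mod clen c])%N%:R)).
Proof. by rewrite /sector; case: cid => W /= []. Qed.

Lemma sector_continuous c j : continuous (sector c j).
Proof. by rewrite /sector; case: cid => W /= []. Qed.

Lemma weight_echart v a b (ab : spans_simplex a b) t :
  weight v (echart a b t) = bary a b (ui_val t) v.
Proof. by rewrite (echartE ab) weight_rchart. Qed.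

(** A point lies in the stars of the two ends of one edge at most. *)
Lemma weight_carrier x : exists a b, spans_simplex a b /\
  forall v, 0 < weight v x -> v = a \/ v = b.
Proof.
case: (Xr_cover x) => [[a [b [t [ab ->]]]]|[c [k [y ->]]]].
  exists a, b; split=> // v; rewrite (weight_echart _ ab) => /bary_gt0.
  by case=> -[]; [left|right].
exists (cyc c k), (cyc c k.+1); split=> [|v]; first by right; exact: cyc_edge.
rewrite weight_schart; have /andP[y0 _] := ui_valP y.1; move=> yb.
have /bary_gt0 : 0 < bary (cyc c k) (cyc c k.+1) (ui_val y.2) v.
  by move: (yb); rewrite pmulr_rgt0 // lt_neqAle y0 andbT eq_sym;
    apply: contraTneq yb => ->; rewrite mul0r ltxx.
by case=> -[]; [left|right].
Qed.

Lemma weight_edge v w x : 0 < weight v x -> 0 < weight w x -> v <> w -> edge v w.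
Proof.
have [a [b [ab H]]] := weight_carrier x => /H va /H wb vw.
have {}ab : v = a /\ w = b \/ v = b /\ w = a -> edge v w.
  case: ab => [ab|ab] [[]|[]] va' wb'; subst => //; exact: edge_sym.
by apply: ab; case: va wb vw => -> [] -> //; [left|right].
Qed.

Lemma weight_three u v w x : 0 < weight u x -> 0 < weight v x -> 0 < weight w x ->
  v <> w -> u = v \/ u = w.
Proof.
have [a [b [ab H]]] := weight_carrier x => /H ua /H va /H wa vw.
by case: ua va wa vw => -> [] -> [] -> //; [left|right|right|left].
Qed.

Lemma prod3_gt0 (p q s : R) : 0 <= p -> 0 <= q -> 0 <= s ->
  0 < p * q * s <-> [/\ 0 < p, 0 < q & 0 < s].
Proof.
move=> p0 q0 s0; split=> [h|[? ? ?]]; last by rewrite !mulr_gt0.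
have ne (y : R) : 0 <= y -> y != 0 -> 0 < y by rewrite lt_neqAle eq_sym => -> ->.
by split; apply: ne => //; apply: contraTneq h => ->; rewrite ?mul0r ?mulr0 ?mul0r ltxx.
Qed.

Definition sector_cond c j k (y : I * I) : Prop :=
  0 < ui_val y.1 < 1 /\
  ((k = j %[mod clen c])%N /\ ui_val y.2 < 1 \/ (k.+1 = j %[mod clen c])%N /\ 0 < ui_val y.2).

Lemma sector_schart_gt0 c j k y : 0 < sector c j (schart c k y) <-> sector_cond c j k y.
Proof.
have /andP[r0 r1] := ui_valP y.1; have /andP[t0 t1] := ui_valP y.2.
rewrite sector_schart eqxx mul1r prod3_gt0 ?subr_ge0 //; last first.
  by rewrite addr_ge0 // mulr_ge0 // subr_ge0.
rewrite subr_gt0 /sector_cond; split.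
  case=> y0 y1 /hat_gt0 H; rewrite y0 y1; split=> //.
  by case: H => -[/eqP ? ?]; [left|right].
case=> /andP[-> ->] H; split=> //; apply/hat_gt0.
by case: H => -[/eqP ? ?]; [left|right].
Qed.

Lemma sectorP c j x : 0 < sector c j x ->
  exists k y, x = schart c k y /\ sector_cond c j k y.
Proof.
case: (Xr_cover x) => [[a [b [t [ab ->]]]]|[c' [k [y ->]]]].
  by rewrite (echartE ab) sector_rchart ltxx.
have [cc|cc] := eqVneq c' c; last by rewrite sector_schart (negbTE cc) mul0r ltxx.
by subst c' => /sector_schart_gt0 h; exists k, y.
Qed.

Lemma depthP c x : 0 < depth c x -> exists k y, x = schart c k y /\ ui_val y.1 < 1.
Proof.
case: (Xr_cover x) => [[a [b [t [ab ->]]]]|[c' [k [y ->]]]].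
  by rewrite (echartE ab) depth_rchart ltxx.
rewrite depth_schart; have [->|cc] := eqVneq c' c; last by rewrite mul0r ltxx.
by rewrite mul1r subr_gt0; exists k, y.
Qed.

Lemma depth_unique c c' x : 0 < depth c x -> 0 < depth c' x -> c = c'.
Proof.
move=> /depthP[k [y [-> _]]]; rewrite depth_schart.
by have [//|_] := eqVneq c c'; rewrite mul0r ltxx.
Qed.

Lemma sector_depth c j x : 0 < sector c j x -> 0 < depth c x.
Proof.
move=> /sectorP[k [y [-> [/andP[_ y1] _]]]].
by rewrite depth_schart eqxx mul1r subr_gt0.
Qed.

Lemma weight_schart_gt0 v c k y : 0 < weight v (schart c k y) <->
  0 < ui_val y.1 /\ (v = cyc c k /\ ui_val y.2 < 1 \/ v = cyc c k.+1 /\ 0 < ui_val y.2).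
Proof.
have /andP[y0 _] := ui_valP y.1.
rewrite weight_schart -bary_gt0; split=> [h|[? ?]]; last exact: mulr_gt0.
have b0 := bary_ge0 (cyc c k) (cyc c k.+1) y.2 v.
by have := h; rewrite -{1}[ui_val y.1]mulr1 => /(prod3_gt0 y0 ler01 b0)[].
Qed.

Lemma sector_weight c j x : 0 < sector c j x -> 0 < weight (cyc c j) x.
Proof.
move=> /sectorP[k [y [-> [/andP[y0 _] H]]]]; apply/weight_schart_gt0; split=> //.
by case: H => -[/cyc_mod_eq -> ?]; [left|right].
Qed.

Lemma weight_depth v c x : 0 < weight v x -> 0 < depth c x ->
  exists2 j, v = cyc c j & 0 < sector c j x.
Proof.
move=> + /depthP[k [y [xE y1]]]; rewrite xE => /weight_schart_gt0[y0 [] [-> h]].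
  by exists k => //; apply/sector_schart_gt0; split; [rewrite y0|left].
by exists k.+1 => //; apply/sector_schart_gt0; split; [rewrite y0|right].
Qed.

Lemma sector_adjacent c j j' x : 0 < sector c j x -> 0 < sector c j' x ->
  [\/ (j = j' %[mod clen c])%N, (j.+1 = j' %[mod clen c])%N |
      (j'.+1 = j %[mod clen c])%N].
Proof.
move=> /sectorP[k [y [-> [_ H]]]] /sector_schart_gt0[_ H'].
case: H H' => -[e _] [] [e' _].
- by constructor 1; rewrite -e e'.
- by constructor 2; rewrite -e' -succ_modn -e succ_modn.
- by constructor 3; rewrite -succ_modn -e' succ_modn e.
- by constructor 1; rewrite -e e'.
Qed.

Lemma weight_or_depth x : (exists v, 0 < weight v x) \/ (exists c, 0 < depth c x).
Proof.
have side (t : I) : ui_val t < 1 \/ 0 < ui_val t.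
  by have [?|?] := ltP (ui_val t) 1; [left|right; lra].
case: (Xr_cover x) => [[a [b [t [ab ->]]]]|[c [k [y ->]]]].
  left; case: (side t) => h; [exists a|exists b]; rewrite weight_echart //;
    apply/bary_gt0; first [by left|by right].
have [y1|y1] := ltP (ui_val y.1) 1.
  by right; exists c; rewrite depth_schart eqxx mul1r subr_gt0.
have y0 : 0 < ui_val y.1 by lra.
left; case: (side y.2) => h; [exists (cyc c k)|exists (cyc c k.+1)];
  apply/weight_schart_gt0; split=> //; first [by left|by right].
Qed.

End cover.

(** * Contractions of the sets of the cover *)
Section contractions.
Context {R : realType} {r : nat} {G : graph}.
Context (simpleG : simple_graph G).
Local Notation I := (unit_interval R).
Local Notation X := (Xr R r G).
Implicit Types (c : short_even_cycle r G) (a b v w : G) (x : X).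

Lemma realization_inj (p q : realization R G) : sval p = sval q -> p = q.
Proof.
by case: p q => [p pP] [q qP] /= pq; subst q; rewrite (Prop_irrelevance pP qP).
Qed.

Lemma echart_rev a b (t : I) : edge a b \/ a = b ->
  echart a b t = echart b a (clamp (1 - ui_val t)) :> X.
Proof.
move=> ab.
have e1 : spans_simplex a b by case: ab; [right|left].
have e2 : spans_simplex b a by case: ab => [/edge_sym|]; [right|left].
rewrite (echartE e1) (echartE e2); congr rchart; apply: realization_inj.
have /andP[t0 t1] := ui_valP t.
apply/funext => z /=; rewrite !baryE clampE; last by lra.
by ring.
Qed.

Lemma echart_cst a (t : I) : echart a a t = Xr_vertex R r a.
Proof.
rewrite (echartE (or_introl erefl)); congr rchart; apply: realization_inj.
by apply/funext => z /=; rewrite !baryE; ring.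
Qed.

Lemma echart_zero a b : echart a b zero = Xr_vertex R r a.
Proof.
rewrite /echart; case: pselect => // ab; congr rchart; apply: realization_inj.
by apply/funext => z /=; rewrite !baryE ui_val0; ring.
Qed.

Lemma echart_one a b : spans_simplex a b -> echart a b one = Xr_vertex R r b.
Proof.
move=> ab; rewrite (echartE ab); congr rchart; apply: realization_inj.
by apply/funext => z /=; rewrite !baryE ui_val0 ui_val1; ring.
Qed.

(** In each chart a point of the star of [v] moves straight to [v]: along its edge,
 or inside its sector towards the corner [(1, 0)] or [(1, 1)] that is mapped to
 [v].  Points outside the star do not move. *)
Section vertex_contraction.
Context (v : G).

Let moved (p : realization R G) (s : I) (q : realization R G) : Prop :=
  0 < sval p v /\
  sval q = fun z => (1 - ui_val s) * sval p z + ui_val s * `[< z = v >]%:R.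

Let fE p (s : I) : X :=
  if pselect (exists q, moved p s q) is left e then rchart (sval (cid e)) else rchart p.

Let fD c k (y : I * I) (s : I) : X :=
  if `[< [/\ v = cyc c k, 0 < ui_val y.1 & ui_val y.2 < 1] >]
  then schart c k (lin y.1 one s, lin y.2 zero s)
  else if `[< [/\ v = cyc c k.+1, 0 < ui_val y.1 & 0 < ui_val y.2] >]
  then schart c k (lin y.1 one s, lin y.2 one s) else schart c k y.

Let fE_moved p s q : moved p s q -> fE p s = rchart q.
Proof.
move=> pq; rewrite /fE; case: pselect => [e|]; last by case; exists q.
case: cid => q' /= [_ q'E]; congr rchart; apply: realization_inj.
by rewrite q'E pq.2.
Qed.

Let fE_start a b (ab : spans_simplex a b) (t s : I) :
  0 < bary a b (ui_val t) v -> v = a -> fE (simplex_point ab t) s = echart a b (lin t zero s).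
Proof.
move=> vt va; rewrite (echartE ab); apply: fE_moved; split=> //.
apply/funext => z /=; rewrite !baryE ui_val_lin ui_val0 va; ring.
Qed.

Let fE_end a b (ab : spans_simplex a b) (t s : I) :
  0 < bary a b (ui_val t) v -> v = b -> fE (simplex_point ab t) s = echart a b (lin t one s).
Proof.
move=> vt va; rewrite (echartE ab); apply: fE_moved; split=> //.
apply/funext => z /=; rewrite !baryE ui_val_lin ui_val1 va; ring.
Qed.

Let fE_out a b (ab : spans_simplex a b) (t s : I) :
  ~ 0 < bary a b (ui_val t) v -> fE (simplex_point ab t) s = echart a b t.
Proof.
by move=> vt; rewrite (echartE ab) /fE; case: pselect => // e; exfalso; case: e => q [/vt].
Qed.

Lemma vertex_contraction_exists : exists K : X * I -> X,
  [/\ forall a b t s, spans_simplex a b -> 0 < weight v (echart a b t : X) -> v = a ->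
        K (echart a b t, s) = echart a b (lin t zero s),
      forall a b t s, spans_simplex a b -> 0 < weight v (echart a b t : X) -> v = b ->
        K (echart a b t, s) = echart a b (lin t one s),
      forall c k y s, 0 < weight v (schart c k y) -> v = cyc c k ->
        K (schart c k y, s) = schart c k (lin y.1 one s, lin y.2 zero s) &
      forall c k y s, 0 < weight v (schart c k y) -> v = cyc c k.+1 ->
        K (schart c k y, s) = schart c k (lin y.1 one s, lin y.2 one s)].
Proof.
have [|||c k t e|F [FE FD]] := @Xr_rec R r G (I -> X) fE fD.
- move=> c k y; rewrite /fD; apply/funext => s.
  by rewrite !schart_mod cyc_mod (cyc_mod_eq (succ_modn _ _)).
- move=> c k rho; apply/funext => s; rewrite /fD /= ui_val0 ui_val1 !ltr01 !ltxx !linxx.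
  rewrite asboolF; last by move=> [].
  have -> w : `[< [/\ v = w, 0 < ui_val rho & false] >] = false by apply: asboolF => -[].
  by case: ifP => _; rewrite schart_next.
- move=> c k k' t t'; apply/funext => s; rewrite /fD /= ui_val0 !ltxx.
  have E w (b : bool) : `[< [/\ v = w, false & b] >] = false by apply: asboolF => -[].
  by rewrite !E; exact: schart_center.
- apply/funext => s; rewrite /fD /= ui_val1 linxx !schart_boundary.
  case: asboolP => [[va _ t1]|h].
    by rewrite fE_start //; apply/bary_gt0; left.
  case: asboolP => [[vb _ t0]|h'].
    by rewrite fE_end //; apply/bary_gt0; right.
  rewrite fE_out // => /bary_gt0[] [? ?]; [apply: h|apply: h']; split=> //; exact: ltr01.
exists (fun xs => F xs.1 xs.2); split=> /=.
- move=> a b t s ab; rewrite weight_echart // (echartE ab) FE => vt va.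
  exact: fE_start.
- move=> a b t s ab; rewrite weight_echart // (echartE ab) FE => vt va.
  exact: fE_end.
- move=> c k y s /weight_schart_gt0[y0 yv] va; rewrite FD /fD asboolT //; split=> //.
  by case: yv => -[] // vb; case: (cyc_neq simpleG (c := c) (k := k)); rewrite -va.
- move=> c k y s /weight_schart_gt0[y0 yv] va; rewrite FD /fD asboolF; last first.
    by move=> [vb _ _]; case: (cyc_neq simpleG (c := c) (k := k)); rewrite -va.
  rewrite asboolT //; split=> //.
  by case: yv => -[] // vb; case: (cyc_neq simpleG (c := c) (k := k)); rewrite -va.
Qed.

End vertex_contraction.
End contractions.

Section stars.
Context {R : realType} {r : nat} {G : graph}.
Context (simpleG : simple_graph G).
Local Notation I := (unit_interval R).
Local Notation X := (Xr R r G).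
Implicit Types (c : short_even_cycle r G) (a b v w : G) (x : X).

Lemma open_gt0 (f : X -> R) : continuous f -> open [set x | 0 < f x].
Proof. by move=> /continuousP /(_ [set z | 0 < z]); apply; exact: open_gt. Qed.

Lemma continuous_at_near (S T : topologicalType) (f g : S -> T) (x : S) :
  (\forall y \near x, f y = g y) -> {for x, continuous f} -> {for x, continuous g}.
Proof.
move=> fg cf; rewrite /prop_for /continuous_at -(nbhs_singleton fg).
exact: (cvg_trans (near_eq_cvg fg) cf).
Qed.

(** Continuity holds because near each point of the star a single one of the chart
 formulas applies; the trace of a contraction in a chart is recorded since the
 spokes have to be compared inside one chart. *)
Lemma vertex_contraction v : exists K : X * I -> X,
  [/\ forall x s, 0 < weight v x -> {for (x, s), continuous K},
      forall a b (t : I), spans_simplex a b -> 0 < weight v (echart a b t : X) ->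
        exists g : I -> I, [/\ continuous g, g zero = t,
          v = a /\ g one = zero \/ v = b /\ g one = one &
          forall s, K (echart a b t, s) = echart a b (g s)] &
      forall c k y, 0 < weight v (schart c k y) ->
        exists g : I -> I * I, [/\ continuous g, g zero = y,
          v = cyc c k /\ g one = (one, zero) \/ v = cyc c k.+1 /\ g one = (one, one) &
          forall s, K (schart c k y, s) = schart c k (g s)]].
Proof.
have [K [Ka Kb Kc Kd]] := @vertex_contraction_exists R r G simpleG v.
have oU := open_gt0 (@weight_continuous R r G v).
exists K; split.
- move=> x s; refine (@final_family_prod_continuous R _ _ X X _ K _
    (@chart_final R r G) oU (@chart_continuous R r G) _ x s); move=> {x s}.
  have nearU (J : topologicalType) (f : J -> X) (y : J) (s : I) : continuous f ->
      0 < weight v (f y) -> \forall ys \near (y, s), 0 < weight v (f ys.1).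
    move=> cf Uy; have : \forall z \near y, 0 < weight v (f z).
      have h : nbhs (f y) [set z | 0 < weight v z] by apply: open_nbhs_nbhs; split.
      exact: (cf y _ h).
    move=> h; exists ([set z | 0 < weight v (f z)], setT) => //=.
      by split=> //; exact: filterT.
    by move=> [? ?] [].
  have ctsl (a b : I * I -> I) : continuous a -> continuous b ->
      continuous (fun ts : I * I => lin (a ts) (b ts) ts.2).
    by move=> ca cb; continuity.
  case=> [[[a b] /= ab]|[c k]] y s /= Uy.
  + have nU := nearU I (@echart R r G a b) y s (@echart_continuous _ _ _ _ _) Uy.
    have /bary_gt0 [[va _]|[vb _]] : 0 < bary a b (ui_val y) v by rewrite -(weight_echart (r := r)).
    * apply: (@continuous_at_near _ _ (fun ys : I * I => echart a b (lin ys.1 zero ys.2))).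
        by apply: filterS nU => ys h; rewrite Ka.
      apply: (comp_cont (@echart_continuous R r G a b)); apply: ctsl; continuity.
    * apply: (@continuous_at_near _ _ (fun ys : I * I => echart a b (lin ys.1 one ys.2))).
        by apply: filterS nU => ys h; rewrite Kb.
      apply: (comp_cont (@echart_continuous R r G a b)); apply: ctsl; continuity.
  + have nU := nearU _ (@schart R r G c k) y s (@schart_continuous _ _ _ _ _) Uy.
    have [_ [[va _]|[vb _]]] := (weight_schart_gt0 _ _ _ _).1 Uy.
    * apply: (@continuous_at_near _ _ (fun ys : I * I * I =>
        schart c k (lin ys.1.1 one ys.2, lin ys.1.2 zero ys.2))).
        by apply: filterS nU => ys h; rewrite Kc.
      apply: (comp_cont (@schart_continuous R r G c k)).
      by continuity.
    * apply: (@continuous_at_near _ _ (fun ys : I * I * I =>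
        schart c k (lin ys.1.1 one ys.2, lin ys.1.2 one ys.2))).
        by apply: filterS nU => ys h; rewrite Kd.
      apply: (comp_cont (@schart_continuous R r G c k)).
      by continuity.
- move=> a b t ab Ut.
  have /bary_gt0 [[va _]|[vb _]] : 0 < bary a b (ui_val t) v by rewrite -(weight_echart (r := r)).
    exists (lin t zero); rewrite lin0 lin1; split; [|by []|by left|by move=> s; rewrite Ka].
    by continuity.
  exists (lin t one); rewrite lin0 lin1; split; [|by []|by right|by move=> s; rewrite Kb].
  by continuity.
- move=> c k y Uy.
  have [_ [[va _]|[vb _]]] := (weight_schart_gt0 _ _ _ _).1 Uy.
    exists (fun s => (lin y.1 one s, lin y.2 zero s)); rewrite !lin0 !lin1 -surjective_pairing.
    split; [|by []|by left|by move=> s; rewrite Kc].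
    by continuity.
  exists (fun s => (lin y.1 one s, lin y.2 one s)); rewrite !lin0 !lin1 -surjective_pairing.
  split; [|by []|by right|by move=> s; rewrite Kd].
  by continuity.
Qed.

(** The open disk contracts radially to its center. *)
Lemma cell_contraction c : exists K : X * I -> X,
  (forall x s, 0 < depth c x -> {for (x, s), continuous K}) /\
  forall k y s, ui_val y.1 < 1 -> K (schart c k y, s) = schart c k (lin y.1 zero s, y.2).
Proof.
pose fD c' k (y : I * I) (s : I) : X :=
  if (c' == c) && (ui_val y.1 < 1) then schart c' k (lin y.1 zero s, y.2) else schart c' k y.
have [|||c' k t e|F [FE FD]] := @Xr_rec R r G (I -> X) (fun p _ => rchart p) fD.
- by move=> c' k y; apply/funext => s; rewrite /fD !schart_mod.
- by move=> c' k rho; apply/funext => s; rewrite /fD /= !schart_next.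
- move=> c' k k' t t'; apply/funext => s; rewrite /fD /= linxx.
  by case: ifP => _; exact: schart_center.
- by apply/funext => s; rewrite /fD /= ui_val1 ltxx andbF schart_boundary (echartE e).
have KE k y s : ui_val y.1 < 1 -> F (schart c k y) s = schart c k (lin y.1 zero s, y.2).
  by move=> y1; rewrite FD /fD eqxx y1.
exists (fun xs => F xs.1 xs.2); split=> //.
move=> x s; refine (@final_family_prod_continuous R _ _ X X _ _ _ (@chart_final R r G)
  (open_gt0 (@depth_continuous R r G c)) (@chart_continuous R r G) _ x s); move=> {x s}.
case=> [[[a b] /= ab]|[c' k]] y s /=; first by rewrite (echartE ab) depth_rchart ltxx.
rewrite depth_schart; have [->|cc] := eqVneq c' c; last by rewrite mul0r ltxx.
rewrite mul1r subr_gt0 => y1.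
apply: (@continuous_at_near _ _ (fun ys : I * I * I => schart c k (lin ys.1.1 zero ys.2, ys.1.2))).
  have : \forall ys \near (y, s), ui_val ys.1.1 < 1.
    have cu : continuous (fun ys : I * I * I => ui_val ys.1.1) by continuity.
    exact: cvgr_lt (cu (y, s)) _ y1.
  by apply: filterS => ys h; rewrite KE.
apply: (comp_cont (@schart_continuous R r G c k)).
by continuity.
Qed.

End stars.

(** * From paths of the graph to paths of the complex *)
Section walks.
Context {R : realType} {r : nat} {G : graph}.
Local Notation I := (unit_interval R).
Local Notation X := (Xr R r G).
Implicit Types (c : short_even_cycle r G) (v w : G) (x : X) (f g : nat -> G).

Definition walkable f n : Prop := forall i, (i < n)%N -> edge (f i) (f i.+1).

Fixpoint walk f n : I -> X :=
  if n is m.+1 then pcat (walk f m) (echart (f m) (f m.+1))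
  else cst (Xr_vertex R r (f 0%N)).

Lemma walkable_add f m n : walkable f (m + n) ->
  walkable f m /\ walkable (fun i => f (m + i)%N) n.
Proof.
by move=> fE; split=> i im; rewrite ?addnS; apply: fE; lia.
Qed.

Lemma walk_zero f n : walk f n zero = Xr_vertex R r (f 0%N).
Proof. by elim: n => //= n; rewrite pcat0. Qed.

Lemma walk_one f n : walkable f n -> walk f n one = Xr_vertex R r (f n).
Proof.
case: n => //= n fE; rewrite pcat1 echart_one //; right; exact: fE.
Qed.

Lemma walk_continuous f n : walkable f n -> continuous (walk f n).
Proof.
elim: n => /= [_|n IH fE]; first exact: cst_cont.
have fE' : walkable f n by move=> i im; apply: fE; lia.
apply: pcat_cont; [exact: IH|exact: echart_continuous|].
by rewrite walk_one // echart_zero.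
Qed.

Lemma eq_walk f g n : (forall i, (i <= n)%N -> f i = g i) -> walk f n = walk g n.
Proof.
elim: n => /= [E|n IH E]; first by rewrite E.
by rewrite IH ?E // => i im; apply: E; lia.
Qed.

Lemma walk_add f m n : walkable f (m + n) ->
  homotopic (walk f (m + n)) (pcat (walk f m) (walk (fun i => f (m + i)%N) n)).
Proof.
elim: n => [|n IH] fE.
  have [fm _] := walkable_add fE.
  rewrite /= !addn0 in fE *.
  rewrite -(walk_one fm); apply: homotopic_sym.
  exact: pcat_cst (walk_continuous fm).
rewrite addnS /= in fE *.
have fE' : walkable f (m + n) by move=> i im; apply: fE; lia.
have [fm fn] := walkable_add fE'.
have e : continuous (echart (f (m + n)%N) (f (m + n).+1) : I -> X) by exact: echart_continuous.
apply: homotopic_trans.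
  apply: homotopic_pcat; [|exact: IH|exact: homotopic_refl].
  by rewrite walk_one // echart_zero.
rewrite addnS; apply: pcatA => //.
- exact: walk_continuous.
- exact: walk_continuous.
- by rewrite walk_one // walk_zero addn0.
- by rewrite walk_one // echart_zero.
Qed.

(** The index [h] may go up or down by one at each step, so that both ways around
 the cycle are covered. *)
Lemma walk_boundary c (h : nat -> nat) n :
  (forall i, (i < n)%N -> h i.+1 = (h i).+1 \/ h i = (h i.+1).+1) ->
  exists g : I -> disk R, [/\ continuous g,
    walk (fun i => cyc c (h i)) n = fun t => dchart c (g t),
    g zero = polar one (angle c (h 0%N) 0) & g one = polar one (angle c (h n) 0)].
Proof.
have angS k : angle c k 1 = angle c k.+1 0 :> R.
  by rewrite /angle addr0 natr1.
have ca (a : I -> R) : continuous a -> continuous (fun t => polar one (a t)).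
  move=> h'; apply: (comp_cont (g := fun ra : I * R => polar ra.1 ra.2) (f := fun t => (one, a t))).
    exact: polar_continuous.
  by continuity.
have edgeP k (t : I) :
    echart (cyc c k) (cyc c k.+1) t = dchart c (polar one (angle c k (ui_val t))) :> X.
  by rewrite -schart_boundary.
elim: n => /= [_|n IH hE].
  exists (fun=> polar one (angle c (h 0%N) 0)); split=> //; first exact: cst_cont.
  have := edgeP (h 0%N) zero; rewrite echart_zero ui_val0 => <-.
  by [].
have [|g [cg gE g0 g1]] := IH; first by move=> i im; apply: hE; lia.
have [e|e] := hE n (ltnSn n).
  pose b (t : I) : disk R := polar one (angle c (h n) (ui_val t)).
  have cb : continuous b by apply: ca; have cang := @angle_continuous R _ _ c (h n); continuity.
  exists (pcat g b); rewrite pcat0 pcat1; split=> //.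
  - by apply: pcat_cont => //; rewrite g1 /b ui_val0.
  - rewrite -pcat_comp gE; congr pcat; apply/funext => t; rewrite e; exact: edgeP.
  - by rewrite /b ui_val1 angS e.
pose b (t : I) : disk R := polar one (angle c (h n.+1) (1 - ui_val t)).
have cb : continuous b by apply: ca; have cang := @angle_continuous R _ _ c (h n.+1); continuity.
exists (pcat g b); rewrite pcat0 pcat1; split=> //.
- by apply: pcat_cont => //; rewrite g1 /b ui_val0 subr0 angS e.
- rewrite -pcat_comp gE; congr pcat; apply/funext => t; rewrite e.
  rewrite echart_rev; last by left; apply/edge_sym/cyc_edge.
  rewrite edgeP clampE //; have /andP[? ?] := ui_valP t; lra.
- by rewrite /b ui_val1 subrr.
Qed.

Lemma homotopic_boundary c (h k : nat -> nat) m n :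
  (forall i, (i < m)%N -> h i.+1 = (h i).+1 \/ h i = (h i.+1).+1) ->
  (forall i, (i < n)%N -> k i.+1 = (k i).+1 \/ k i = (k i.+1).+1) ->
  (h 0%N = k 0%N %[mod clen c])%N -> (h m = k n %[mod clen c])%N ->
  homotopic (walk (fun i => cyc c (h i)) m) (walk (fun i => cyc c (k i)) n).
Proof.
move=> /(@walk_boundary c)[g [cg -> g0 g1]] /(@walk_boundary c)[g' [cg' -> g0' g1']] e0 e1.
apply: homotopic_through => //; first exact: convex_disk.
- exact: dchart_continuous.
- by rewrite g0 g0' -polar_mod e0 polar_mod.
- by rewrite g1 g1' -polar_mod e1 polar_mod.
Qed.

(** Two walks of length [m] with the same ends form a cycle of length [2 * m]: follow
 [f], then [g] backwards.  Both walks are arcs of its boundary. *)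
Section two_walks.
Context (f g : nat -> G) (m : nat) (m_bounds : (2 <= m <= r)%N).
Hypothesis (fE : walkable f m) (gE : walkable g m).
Hypothesis (fg0 : f 0%N = g 0%N) (fgm : f m = g m).

Let u (i : 'I_(2 * m)) : G := if (i <= m)%N then f i else g (2 * m - i)%N.

Let u_succ (i : 'I_(2 * m)) : edge (u i) (u (ordS i)).
Proof.
rewrite /u /=; move: (ltn_ord i); move: (i : nat) => {}i i2m.
have [im|im] := ltnP i m.
  by rewrite modn_small ?(ltnW im) ?im; [exact: fE|lia].
have E : (if (i <= m)%N then f i else g (2 * m - i)%N) = g (2 * m - i)%N.
  case: ifP => // im'; have -> : i = m by lia.
  by rewrite fgm; congr g; lia.
rewrite {}E; apply: edge_sym.
have [i1|i1] := ltnP i.+1 (2 * m).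
  rewrite modn_small // [(i.+1 <= m)%N]leqNgt ltnS im /=.
  by rewrite (_ : 2 * m - i = (2 * m - i.+1).+1)%N; [apply: gE; lia|lia].
have -> : (i.+1 = 2 * m)%N by lia.
rewrite modnn /= fg0.
by rewrite (_ : 2 * m - i = 1)%N; [apply: gE; lia|lia].
Qed.

Let u_edge (i j : cycle_graph (2 * m)) : edge i j -> edge (u i) (u j).
Proof.
case=> ->; first exact: u_succ.
by apply: edge_sym; rewrite -{2}(ord_predK i); exact: u_succ.
Qed.

Lemma homotopic_two_walks : homotopic (walk f m) (walk g m).
Proof.
pose c : short_even_cycle r G :=
  ShortEvenCycle m_bounds (@GraphHom (cycle_graph (2 * m)) G u u_edge).
have cE i : cyc c i =
      if (i %% (2 * m) <= m)%N then f (i %% (2 * m)) else g (2 * m - i %% (2 * m))%N.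
  by [].
have -> : walk f m = walk (fun i => cyc c i) m.
  apply: eq_walk => i im; rewrite cE modn_small; last by lia.
  by rewrite im.
have -> : walk g m = walk (fun i => cyc c (2 * m - i)) m.
  apply: eq_walk => -[|i] im; rewrite cE; first by rewrite subn0 modnn /=.
  rewrite modn_small; last by lia.
  case: ifP => im'; last by congr g; lia.
  by rewrite (_ : 2 * m - i.+1 = m)%N ?fgm; [congr g; lia|lia].
apply: (@homotopic_boundary c id) => [i im|i im| |].
- by left.
- by right; lia.
- by rewrite subn0 modnn mod0n.
- by congr (_ %% _)%N; lia.
Qed.

End two_walks.

Definition differences f g n : nat := (\sum_(0 <= i < n.+1) `[< f i <> g i >])%N.

Lemma differences_add f g m n : differences f g (m + n) =
  ((\sum_(0 <= i < m) `[< f i <> g i >]) +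
   differences (fun i => f (m + i)%N) (fun i => g (m + i)%N) n)%N.
Proof.
rewrite /differences (@big_cat_nat _ _ _ m) //=; last by lia.
congr addn; rewrite -{1}[m]add0n big_addn.
rewrite (_ : (m + n).+1 - m = n.+1)%N; last by lia.
by apply: eq_bigr => i _; rewrite addnC.
Qed.

(** Cut both walks at the first time [m > 0] when they agree.  The times strictly
 between 0 and [m] are differences, so [m <= r], and the remaining walks are
 shorter and have no more differences. *)
Lemma homotopic_few_differences f g n : walkable f n -> walkable g n ->
  f 0%N = g 0%N -> f n = g n -> (differences f g n < r)%N ->
  homotopic (walk f n) (walk g n).
Proof.
have [k nk] := ubnP n; elim: k n f g nk => // k IH [|n] f g nk fE gE fg0 fgn fgr.
  rewrite (_ : walk f 0 = walk g 0); first exact: homotopic_refl (walk_continuous gE).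
  by apply: eq_walk => -[].
have ex : exists m, (0 < m)%N && `[< f m = g m >] by exists n.+1; apply/asboolP.
case: (ex_minnP ex) => m /andP[m0 /asboolP fgm] mmin.
have mn : (m <= n.+1)%N by apply: mmin; apply/asboolP.
move: (fE) (gE); rewrite -(subnKC mn).
move=> /[dup] fmn /walkable_add[fm f'] /[dup] gmn /walkable_add[gm g'].
apply: (homotopic_trans (walk_add fmn)).
apply: homotopic_trans _ (homotopic_sym (walk_add gmn)).
have diff : (m.-1 + differences (fun i => f (m + i)%N) (fun i => g (m + i)%N) (n.+1 - m)
             <= differences f g n.+1)%N.
  rewrite -{2}(subnKC mn) differences_add leq_add2r.
  rewrite big_ltn // -[m.-1]subn1 -[leqLHS]muln1 -sum_nat_const_nat.
  apply: leq_trans (leq_addl _ _); rewrite big_nat [leqRHS]big_nat.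
  apply: leq_sum => i /andP[i0 im]; rewrite lt0b; apply/asboolP => fgi.
  by have := mmin i; rewrite i0 leqNgt im => /(_ (asboolT fgi)).
apply: homotopic_pcat.
- by rewrite walk_one // walk_zero addn0.
- have [m1|m1] := leqP m 1.
    have {m1 m0} m1 : m = 1%N by lia.
    subst m; rewrite (_ : walk f 1 = walk g 1); first exact: homotopic_refl (walk_continuous gm).
    by apply: eq_walk => -[|[]].
  by apply: homotopic_two_walks => //; lia.
- apply: IH => //; rewrite ?addn0 ?subnKC //; lia.
Qed.

(** Both paths factor through the edge, which is convex. *)
Lemma walk_backtrack f : edge (f 0%N) (f 1%N) -> f 2%N = f 0%N ->
  homotopic (walk f 2) (cst (Xr_vertex R r (f 0%N))).
Proof.
move=> e f20; rewrite /= f20.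
pose back (t : I) : I := clamp (1 - ui_val t).
have cback : continuous back by rewrite /back; continuity.
have -> : pcat (pcat (cst (Xr_vertex R r (f 0%N))) (echart (f 0%N) (f 1%N)))
      (echart (f 1%N) (f 0%N)) = fun t => echart (f 0%N) (f 1%N) (pcat (pcat (cst zero) id) back t) :> X.
  rewrite -pcat_comp; congr pcat; last first.
    by apply/funext => t; rewrite echart_rev //; left; exact: edge_sym.
  by rewrite -pcat_comp; congr pcat; apply/funext => t; rewrite /= echart_zero.
have -> : cst (Xr_vertex R r (f 0%N)) = fun t : I => echart (f 0%N) (f 1%N) (cst zero t).
  by apply/funext => t; rewrite /= echart_zero.
apply: homotopic_through; first exact: convex_interval.
- exact: echart_continuous.
- apply: pcat_cont => //; last by rewrite pcat1 /back ui_val0 subr0 clamp1.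
  by apply: pcat_cont => //; continuity.
- exact: cst_cont.
- by rewrite !pcat0.
- by rewrite pcat1 /back ui_val1 subrr clamp0.
Qed.

Definition gwalk v w (p : gpath v w) : I -> X := walk (gat p) (glen p).

Lemma gwalkable v w (p : gpath v w) : walkable (gat p) (glen p).
Proof. by move=> i ip; exact: gat_edge. Qed.

Lemma gwalk_zero v w (p : gpath v w) : gwalk p zero = Xr_vertex R r v.
Proof. by rewrite /gwalk walk_zero gat0. Qed.

Lemma gwalk_one v w (p : gpath v w) : gwalk p one = Xr_vertex R r w.
Proof. by rewrite /gwalk walk_one ?gat_len //; exact: gwalkable. Qed.

Lemma gwalk_continuous v w (p : gpath v w) : continuous (gwalk p).
Proof. exact: (walk_continuous (@gwalkable v w p)). Qed.

Lemma gwalk_id v : gwalk (gpath_id v) = cst (Xr_vertex R r v).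
Proof. by []. Qed.

Lemma gwalk_cat u v w (p : gpath u v) (q : gpath v w) :
  homotopic (gwalk (gpath_cat p q)) (pcat (gwalk p) (gwalk q)).
Proof.
have pq : walkable (gat (gpath_cat p q)) (glen p + glen q) by exact: gwalkable.
apply: (homotopic_trans (walk_add pq)).
rewrite (@eq_walk (gat (gpath_cat p q)) (gat p)); last by move=> i ip; exact: gat_catl.
rewrite (@eq_walk (fun i => gat _ (_ + i)%N) (gat q)); last first.
  by move=> i iq; rewrite gat_catr ?leq_addr ?leq_add2l //= addKn.
apply: (@homotopic_refl _ _ (pcat (gwalk p) (gwalk q))).
apply: pcat_cont; try exact: gwalk_continuous.
by rewrite gwalk_one gwalk_zero.
Qed.

Lemma gwalk_insert v w (p q : gpath v w) : gpath_insert p q -> homotopic (gwalk p) (gwalk q).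
Proof.
move=> [E [x xp [lex gex]]].
have qE : (glen q = x + (2 + (glen p - x)))%N by lia.
have pE : (glen p = x + (glen p - x))%N by lia.
have qw : walkable (gat q) (x + (2 + (glen p - x))) by rewrite -qE; exact: gwalkable.
have pw : walkable (gat p) (x + (glen p - x)) by rewrite -pE; exact: gwalkable.
rewrite /gwalk qE; have -> : walk (gat p) (glen p) = walk (gat p) (x + (glen p - x)) by rewrite -pE.
have [_ qw'] := walkable_add qw; have [qw1 qw2] := walkable_add qw'.
have [pw1 pw2] := walkable_add pw.
apply: (homotopic_trans (walk_add pw)); apply/homotopic_sym.
apply: (homotopic_trans (walk_add qw)).
rewrite (@eq_walk (gat q) (gat p)) //.
have qx : gat q x = gat p x by exact: lex.
have q2 : walk (fun i => gat q (x + (2 + i))) (glen p - x) =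
          walk (fun i => gat p (x + i)) (glen p - x).
  by apply: eq_walk => i ip; rewrite addnCA; apply: gex; lia.
apply: homotopic_pcat.
- by rewrite walk_one // walk_zero addn0 qx.
- exact/homotopic_refl/walk_continuous.
apply: (homotopic_trans (walk_add qw')); rewrite q2.
have b2 := @walk_backtrack (fun i => gat q (x + i)).
apply: (homotopic_trans (homotopic_pcat _ (b2 _ _) (homotopic_refl (walk_continuous pw2)))).
- by rewrite walk_one // walk_zero addn0 addn2; congr Xr_vertex; apply: gex; lia.
- by have := qw1 0%N; exact.
- by rewrite addn2 addn0 qx; apply: gex; lia.
have -> : Xr_vertex R r (gat q (x + 0)) = walk (fun i => gat p (x + i)) (glen p - x) zero.
  by rewrite walk_zero !addn0 qx.
exact: cst_pcat (walk_continuous pw2).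
Qed.

Lemma gwalk_subst v w (p q : gpath v w) : gpath_subst r p q -> homotopic (gwalk p) (gwalk q).
Proof.
move=> [E pq]; have := @gwalkable _ _ q; rewrite /gwalk -E => qw.
apply: homotopic_few_differences => //; first exact: gwalkable.
- by rewrite !gat0.
- by rewrite {2}E !gat_len.
apply: leq_ltn_trans pq; rewrite /differences big_mkord -sum1dep_card [leqRHS]big_mkcond.
by apply: leq_sum => i _; case: `[< _ >].
Qed.

Lemma gwalk_equiv v w (p q : gpath v w) : gpath_equiv r v w p q -> homotopic (gwalk p) (gwalk q).
Proof.
move/generated_equivP; elim=> [a b [ab|ab]|a|a b _|a b c _ ab _].
- exact: gwalk_insert.
- exact: gwalk_subst.
- exact/homotopic_refl/gwalk_continuous.
- exact: homotopic_sym.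
- exact: homotopic_trans.
Qed.

End walks.

(** * Surjectivity *)
Section spokes.
Context {R : realType} {r : nat} {G : graph}.
Context (simpleG : simple_graph G).
Local Notation I := (unit_interval R).
Local Notation X := (Xr R r G).
Local Notation cell := (short_even_cycle r G).
Implicit Types (c : cell) (a b v w : G) (x : X) (m : G + cell).

Definition level m : X -> R :=
  match m with inl v => weight v | inr c => depth c end.

Lemma level_continuous m : continuous (level m).
Proof. by case: m => ?; [exact: weight_continuous|exact: depth_continuous]. Qed.

Lemma contraction_exists m : exists K : X * I -> X,
  [/\ forall x s, 0 < level m x -> {for (x, s), continuous K},
      forall a b (t : I), spans_simplex a b -> 0 < level m (echart a b t) ->
        exists v (g : I -> I), [/\ m = inl v, continuous g, g zero = t,
          v = a /\ g one = zero \/ v = b /\ g one = one &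
          forall s, K (echart a b t, s) = echart a b (g s)] &
      forall c k y, 0 < level m (schart c k y) ->
        exists g : I -> I * I, [/\ continuous g, g zero = y,
          [\/ m = inl (cyc c k) /\ g one = (one, zero),
              m = inl (cyc c k.+1) /\ g one = (one, one) |
              m = inr c /\ (g one).1 = zero] &
          forall s, K (schart c k y, s) = schart c k (g s)]].
Proof.
case: m => [v|c] /=.
  have [K [K1 K2 K3]] := vertex_contraction (R := R) (r := r) simpleG v.
  exists K; split=> // [a b t ab /(K2 _ _ _ ab)[g [? ? ? ?]]|c k y /K3[g [? ? gv ?]]].
    by exists v, g; split.
  exists g; split=> //.
  by case: gv => -[-> ?]; [constructor 1|constructor 2].
have [K [K1 K2]] := cell_contraction (R := R) c.
exists K; split=> // [a b t ab|c' k y]; first by rewrite (echartE ab) depth_rchart ltxx.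
rewrite depth_schart; have [->|_] := eqVneq c' c; last by rewrite mul0r ltxx.
rewrite mul1r subr_gt0 => y1.
exists (fun s => (lin y.1 zero s, y.2)); rewrite lin0 lin1 -surjective_pairing.
split=> //; [|by constructor 3|by move=> s; rewrite K2].
by continuity.
Qed.

Definition contraction m : X * I -> X := sval (cid (contraction_exists m)).

Definition tip m : G := match m with inl v => v | inr c => cyc c 0 end.

Definition base m : X :=
  match m with inl v => Xr_vertex R r v | inr c => schart c 0 (zero, zero) end.

(** The contraction of a disk ends at its center; the leg joins it to a vertex of
 the graph, along the radius of index 0. *)
Definition leg m (s : I) : X :=
  match m with
  | inl v => Xr_vertex R r v
  | inr c => schart c 0 (clamp (1 - ui_val s), zero)
  end.

Definition ray m x (s : I) : X := contraction m (x, clamp (1 - ui_val s)).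

Definition spoke m x : I -> X := pcat (leg m) (ray m x).

Lemma contraction_continuous m x s : 0 < level m x ->
  {for (x, s), continuous (contraction m)}.
Proof. by rewrite /contraction; case: cid => K /= [H _ _]; exact: H. Qed.

Lemma rev_continuous : continuous (fun s : I => clamp (1 - ui_val s)).
Proof. by continuity. Qed.

Lemma rev0 : clamp (1 - ui_val (zero : I)) = one.
Proof. by rewrite ui_val0 subr0 clamp1. Qed.

Lemma rev1 : clamp (1 - ui_val (one : I)) = zero.
Proof. by rewrite ui_val1 subrr clamp0. Qed.

Lemma pcat_cst_cst (T : topologicalType) (z : T) : pcat (cst z) (cst z) = cst z :> (I -> T).
Proof. by apply/funext => t; rewrite /pcat; case: ifP. Qed.

Lemma spoke_edge m a b t : spans_simplex a b -> 0 < level m (echart a b t) ->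
  exists v (g : I -> I), [/\ m = inl v, continuous g, g one = t,
    v = a /\ g zero = zero \/ v = b /\ g zero = one &
    spoke m (echart a b t) = fun s => echart a b (g s)].
Proof.
move=> ab mx; have : exists v (g : I -> I), [/\ m = inl v, continuous g, g zero = t,
    v = a /\ g one = zero \/ v = b /\ g one = one &
    forall s, contraction m (echart a b t, s) = echart a b (g s)].
  by rewrite /contraction; case: cid => K /= [_ H _]; exact: H.
move=> [v [g [mv cg g0 g1 gE]]]; subst m.
exists v, (pcat (cst (g one)) (fun s => g (clamp (1 - ui_val s)))).
split; [by []| |by rewrite pcat1 rev1|by rewrite pcat0|].
  apply: pcat_cont; [exact: cst_cont|exact: (comp_cont cg rev_continuous)|by rewrite rev0].
rewrite -pcat_comp /spoke; congr pcat; last by apply/funext => s; rewrite /ray gE.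
apply/funext => s /=.
by case: g1 => -[-> ->]; rewrite ?echart_zero ?echart_one.
Qed.

(** The spoke of a point of a closed disk is the image of a path in this disk that
 starts at one of the marked points of the boundary. *)
Lemma spoke_cell m c k y : 0 < level m (schart c k y) ->
  exists j (g : I -> disk R), [/\ tip m = cyc c j, continuous g,
    g zero = polar one (angle c j 0), g one = polar y.1 (angle c k (ui_val y.2)) &
    spoke m (schart c k y) = fun s => dchart c (g s)].
Proof.
move=> mx; have : exists g : I -> I * I, [/\ continuous g, g zero = y,
          [\/ m = inl (cyc c k) /\ g one = (one, zero),
              m = inl (cyc c k.+1) /\ g one = (one, one) |
              m = inr c /\ (g one).1 = zero] &
          forall s, contraction m (schart c k y, s) = schart c k (g s)].
  by rewrite /contraction; case: cid => K /= [_ _ H]; exact: H.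
move=> [g [cg g0 g1 gE]].
pose z (y : I * I) : disk R := polar y.1 (angle c k (ui_val y.2)).
have cz : continuous z by exact: polar_sector_continuous.
pose h (s : I) := z (g (clamp (1 - ui_val s))).
have ch : continuous h by exact: (comp_cont cz (comp_cont cg rev_continuous)).
have h1 : h one = z y by rewrite /h rev1 g0.
have hE : ray m (schart c k y) = fun s => dchart c (h s).
  by apply/funext => s; rewrite /ray gE.
have vtx j : Xr_vertex R r (cyc c j) = dchart c (polar one (angle c j 0)).
  by rewrite -(echart_zero _ (cyc c j.+1)) -schart_boundary /schart /= ui_val0.
have angS : angle c k 1 = angle c k.+1 0 :> R by rewrite /angle addr0 natr1.
case: g1 => -[mE g1].
- exists k, (pcat (cst (z (one, zero))) h); rewrite pcat0 pcat1 {1}mE; split=> //.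
  + by apply: pcat_cont => //; [exact: cst_cont|rewrite /h rev0 g1].
  + by rewrite /= /z /= ui_val0.
  + rewrite -pcat_comp /spoke hE; congr pcat; apply/funext => s.
    by rewrite mE /= vtx /z /= ui_val0.
- exists k.+1, (pcat (cst (z (one, one))) h); rewrite pcat0 pcat1 {1}mE; split=> //.
  + by apply: pcat_cont => //; [exact: cst_cont|rewrite /h rev0 g1].
  + by rewrite /= /z /= ui_val1 angS.
  + rewrite -pcat_comp /spoke hE; congr pcat; apply/funext => s.
    by rewrite mE /= vtx /z /= ui_val1 angS.
- pose l (s : I) : disk R := polar (clamp (1 - ui_val s)) (angle c 0 0).
  have cl : continuous l.
    apply: (comp_cont (g := fun ra : I * R => polar ra.1 ra.2)
      (f := fun s => (clamp (1 - ui_val s), angle c 0 0))); first exact: polar_continuous.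
    by continuity.
  exists 0%N, (pcat l h); rewrite pcat0 pcat1 {1}mE; split=> //.
  + apply: pcat_cont => //; rewrite /l /h rev1 rev0 /z g1.
    by apply/val_inj; rewrite /= ui_val0 !mul0r.
  + by rewrite /l rev0.
  + rewrite -pcat_comp /spoke hE; congr pcat; apply/funext => s.
    by rewrite mE /= /schart /l /= ui_val0.
Qed.

Lemma contraction_ends m x : 0 < level m x ->
  contraction m (x, zero) = x /\ contraction m (x, one) = base m.
Proof.
rewrite /contraction; case: cid => K /= [_ K2 K3].
case: (Xr_cover x) => [[a [b [t [ab ->]]]]|[c [k [y ->]]]].
  move=> /(K2 _ _ _ ab)[v [g [-> _ g0 g1 gE]]]; rewrite !gE g0; split=> //=.
  by case: g1 => -[-> ->]; rewrite ?echart_zero ?echart_one.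
move=> /K3[g [_ g0 g1 gE]]; rewrite !gE g0; split=> //=.
case: g1 => -[-> g1] /=.
- by rewrite g1 schart_boundary echart_zero.
- by rewrite g1 schart_boundary echart_one //; right; exact: cyc_edge.
- by rewrite [g one]surjective_pairing g1; exact: schart_center.
Qed.

Lemma leg_continuous m : continuous (leg m).
Proof.
case: m => [v|c] /=; first exact: cst_cont.
by apply: (comp_cont (@schart_continuous R r G c 0)); continuity.
Qed.

Lemma leg_zero m : leg m zero = Xr_vertex R r (tip m).
Proof. by case: m => //= c; rewrite rev0 schart_boundary echart_zero. Qed.

Lemma leg_one m : leg m one = base m.
Proof. by case: m => //= c; rewrite rev1. Qed.

Lemma ray_continuous m x : 0 < level m x -> continuous (ray m x).
Proof.
have ch : continuous (fun s : I => (x, clamp (1 - ui_val s))) by continuity.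
move=> mx s; apply: (@continuous_comp _ _ _ _ (contraction m) s (ch s)).
exact: contraction_continuous.
Qed.

Lemma ray_zero m x : 0 < level m x -> ray m x zero = base m.
Proof. by move=> /contraction_ends[_ E]; rewrite /ray rev0. Qed.

Lemma ray_one m x : 0 < level m x -> ray m x one = x.
Proof. by move=> /contraction_ends[E _]; rewrite /ray rev1. Qed.

Lemma spoke_continuous m x : 0 < level m x -> continuous (spoke m x).
Proof.
move=> mx; apply: pcat_cont; [exact: leg_continuous|exact: ray_continuous|].
by rewrite leg_one ray_zero.
Qed.

Lemma spoke_zero m x : spoke m x zero = Xr_vertex R r (tip m).
Proof. by rewrite /spoke pcat0 leg_zero. Qed.

Lemma spoke_one m x : 0 < level m x -> spoke m x one = x.
Proof. by move=> mx; rewrite /spoke pcat1 ray_one. Qed.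

Lemma level_vertex v : 0 < level (inl v) (Xr_vertex R r v).
Proof.
rewrite /= -(echart_zero v v) weight_echart; last by left.
by apply/bary_gt0; left; rewrite ui_val0.
Qed.

Lemma spoke_vertex v : spoke (inl v) (Xr_vertex R r v) = cst (Xr_vertex R r v).
Proof.
have vv : spans_simplex v v by left.
have := level_vertex v; rewrite -{1 2}(echart_zero v v) => /(spoke_edge vv).
move=> [w [g [[<-] _ _ _ ->]]]; apply/funext => s /=; exact: echart_cst.
Qed.

Lemma path_along_cycle c j j' : exists e : gpath (cyc c j) (cyc c j'),
  exists (g : I -> disk R), [/\ continuous g, gwalk e = fun t => dchart c (g t),
    g zero = polar one (angle c j 0) & g one = polar one (angle c j' 0)].
Proof.
have main (h : nat -> nat) n : h 0%N = j -> h n = j' ->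
    (forall i, (i < n)%N -> h i.+1 = (h i).+1 \/ h i = (h i.+1).+1) ->
    exists e : gpath (cyc c j) (cyc c j'),
    exists (g : I -> disk R), [/\ continuous g, gwalk e = fun t => dchart c (g t),
    g zero = polar one (angle c j 0) & g one = polar one (angle c j' 0)].
  move=> h0 hn hE.
  have fE i : (i < n)%N -> edge (cyc c (h i)) (cyc c (h i.+1)).
    by move=> /hE[]->; [exact: cyc_edge|exact/edge_sym/cyc_edge].
  have f0 : cyc c (h 0%N) = cyc c j by rewrite h0.
  have fn : cyc c (h n) = cyc c j' by rewrite hn.
  have [g [cg gE g0 g1]] := walk_boundary (R := R) c hE.
  exists (mkgpath fE f0 fn), g; split=> //; [|by rewrite g0 h0|by rewrite g1 hn].
  by rewrite -gE; apply: eq_walk => i im; rewrite gat_mkgpath.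
have [jj|jj] := leqP j j'.
  apply: (main (fun i => j + i)%N (j' - j)%N); rewrite ?addn0 ?subnKC //.
  by move=> i _; left; rewrite addnS.
apply: (main (fun i => j - i)%N (j - j')%N); [lia|lia|].
by move=> i ij; right; lia.
Qed.

(** The origins of the two spokes are joined along the boundary of a closed disk, or by
 an edge; disks and edges are convex. *)
Lemma spoke_link m m' x : 0 < level m x -> 0 < level m' x ->
  exists e : gpath (tip m) (tip m'), homotopic (spoke m x) (pcat (gwalk e) (spoke m' x)).
Proof.
move=> mx m'x.
case: (Xr_cover x) => [[a [b [t [ab xE]]]]|[c [k [y xE]]]]; subst x; last first.
  have [j [g [-> cg g0 g1 ->]]] := spoke_cell mx.
  have [j' [g' [-> cg' g0' g1' ->]]] := spoke_cell m'x.
  have [e [d [cd dE d0 d1]]] := path_along_cycle c j j'.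
  exists e; rewrite dE pcat_comp.
  have ends : d one = g' zero by rewrite d1 g0'.
  apply: homotopic_through => //; first exact: convex_disk.
  - exact: dchart_continuous.
  - exact: pcat_cont.
  - by rewrite pcat0 g0 d0.
  - by rewrite pcat1 g1 g1'.
have [v [g [mE cg g1 g0 gE]]] := spoke_edge ab mx.
have [v' [g' [mE' cg' g1' g0' gE']]] := spoke_edge ab m'x.
have [vv|vv] := pselect (m = m').
  rewrite -vv; exists (gpath_id _); rewrite gwalk_id -(spoke_zero m (echart a b t)).
  exact/homotopic_sym/cst_pcat/spoke_continuous.
have e : edge v v' by subst m m'; apply: weight_edge mx m'x _ => // ?; subst v'.
pose f i := if i is 0%N then v else v'.
have fE i : (i < 1)%N -> edge (f i) (f i.+1) by case: i.
rewrite gE gE'; subst m m'; exists (mkgpath fE erefl erefl).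
have -> : gwalk (mkgpath fE erefl erefl) = pcat (cst (Xr_vertex R r v)) (echart v v').
  by apply: (@eq_walk R r G _ f 1) => i i1; rewrite gat_mkgpath.
have [d [cd dE d0 d1]] : exists d : I -> I, [/\ continuous d,
    pcat (cst (Xr_vertex R r v)) (echart v v') = fun t => echart a b (d t),
    d zero = g zero & d one = g' zero].
  case: g0 g0' => -[va ->] [] [vb ->]; subst v v'; try by case: vv.
  - exists (pcat (cst zero) id); rewrite pcat0 pcat1; split=> //.
      by apply: pcat_cont => //; continuity.
    by rewrite -pcat_comp; congr pcat; apply/funext => s; rewrite /= echart_zero.
  - exists (pcat (cst one) (fun s => clamp (1 - ui_val s))); rewrite pcat0 pcat1 rev1; split=> //.
      by apply: pcat_cont; [exact: cst_cont|exact: rev_continuous|rewrite rev0].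
    rewrite -pcat_comp; congr pcat; apply/funext => s; first by rewrite /= echart_one.
    by rewrite echart_rev //; left.
rewrite dE pcat_comp; apply: homotopic_through; first exact: convex_interval.
- exact: echart_continuous.
- by [].
- exact: pcat_cont.
- by rewrite pcat0.
- by rewrite pcat1 g1 g1'.
Qed.

(** The contraction applied to [f] is a map on a square; on its sides it is constant,
 equal to [f], and equal to the two rays. *)
Lemma spoke_move m (f : I -> X) : continuous f -> (forall t, 0 < level m (f t)) ->
  homotopic (pcat (spoke m (f zero)) f) (spoke m (f one)).
Proof.
move=> cf mf.
pose q (ts : I * I) : X := contraction m (f ts.1, ts.2).
have cq : continuous q.
  have ch : continuous (fun ts : I * I => (f ts.1, ts.2)) by continuity.
  move=> [t s]; apply: (@continuous_comp _ _ _ _ (contraction m) (t, s) (ch (t, s))).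
  exact: contraction_continuous.
have qE t s : contraction m (f t, s) = q (t, s) by [].
have key : homotopic (pcat (ray m (f zero)) f) (ray m (f one)).
  apply: (@homotopic_trans _ _ _ (pcat (cst (base m)) (ray m (f one)))); last first.
    rewrite -(ray_zero (mf one)); apply: cst_pcat; exact: ray_continuous.
  pose a (s : I) : I * I := (zero, clamp (1 - ui_val s)).
  pose b (t : I) : I * I := (t, zero).
  pose a' (s : I) : I * I := (one, clamp (1 - ui_val s)).
  pose b' (t : I) : I * I := (t, one).
  have ca : continuous a by rewrite /a; continuity.
  have cb : continuous b by rewrite /b; continuity.
  have ca' : continuous a' by rewrite /a'; continuity.
  have cb' : continuous b' by rewrite /b'; continuity.
  have -> : pcat (ray m (f zero)) f = fun t => q (pcat a b t).
    rewrite -pcat_comp; congr pcat; apply/funext => t.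
    by rewrite /q /= (contraction_ends (mf t)).1.
  have -> : pcat (cst (base m)) (ray m (f one)) = fun t => q (pcat b' a' t).
    rewrite -pcat_comp; congr pcat; apply/funext => t.
    by rewrite /q /= (contraction_ends (mf t)).2.
  apply: homotopic_through => //.
  - by apply: convex_prod; exact: convex_interval.
  - by apply: pcat_cont => //; rewrite /a /b rev1.
  - by apply: pcat_cont => //; rewrite /a' /b' rev0.
  - by rewrite !pcat0 /a /b' rev0.
  - by rewrite !pcat1 /b /a' rev1.
apply: (homotopic_trans (pcatA _ _ _ _ _)) => //.
- exact: leg_continuous.
- exact: ray_continuous.
- by rewrite leg_one ray_zero.
- by rewrite ray_one.
apply: homotopic_pcat key.
  by rewrite pcat0 leg_one ray_zero.
exact/homotopic_refl/leg_continuous.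
Qed.

End spokes.

Section surjectivity.
Context {R : realType} {r : nat} {G : graph}.
Context (simpleG : simple_graph G).
Local Notation I := (unit_interval R).
Local Notation X := (Xr R r G).
Local Notation cell := (short_even_cycle r G).

Context (v0 : G) (f : I -> X) (cf : continuous f) (f0 : f zero = Xr_vertex R r v0).

Let part t (u : I) : X := f (lin zero t u).

(** At time [t], the path followed so far is a path of the graph completed by a
 spoke. *)
Let good t : Prop := exists m, 0 < level m (f t) /\
  exists p : gpath v0 (tip m), homotopic (part t) (pcat (gwalk p) (spoke simpleG m (f t))).

Let good_switch t m : good t -> 0 < level m (f t) ->
  exists p : gpath v0 (tip m), homotopic (part t) (pcat (gwalk p) (spoke simpleG m (f t))).
Proof.
move=> [m' [m't [p pE]]] mt; have [e eE] := spoke_link simpleG m't mt.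
exists (gpath_cat p e); apply: (homotopic_trans pE).
have ew : gwalk e one = spoke simpleG m (f t) zero by rewrite gwalk_one spoke_zero.
apply: (@homotopic_trans _ _ _ (pcat (gwalk p) (pcat (gwalk e) (spoke simpleG m (f t))))).
  apply: homotopic_pcat eE; first by rewrite gwalk_one spoke_zero.
  exact/homotopic_refl/gwalk_continuous.
apply: (homotopic_trans (homotopic_sym (pcatA _ _ _ _ _))) => //; try exact: gwalk_continuous.
- exact: spoke_continuous.
- by rewrite gwalk_one gwalk_zero.
apply: homotopic_pcat; first by rewrite pcat1.
- exact/homotopic_sym/gwalk_cat.
- exact/homotopic_refl/spoke_continuous.
Qed.

Let good_move m t t' : (forall u, 0 < level m (f (lin t t' u))) -> good t -> good t'.
Proof.
move=> mu gt.
have mt : 0 < level m (f t) by have := mu zero; rewrite lin0.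
have mt' : 0 < level m (f t') by have := mu one; rewrite lin1.
have [p pE] := good_switch gt mt; exists m; split=> //; exists p.
pose g u := f (lin t t' u).
have cg : continuous g by rewrite /g; continuity.
have g0 : g zero = f t by rewrite /g lin0.
have g1 : g one = f t' by rewrite /g lin1.
have pt1 : part t one = g zero by rewrite /part lin1 g0.
apply: (@homotopic_trans _ _ _ (pcat (part t) g)).
  have cl (a b : I) : continuous (lin a b) by continuity.
  rewrite /part /g pcat_comp; apply: homotopic_through => //; first exact: convex_interval.
  - by apply: pcat_cont => //; rewrite lin1 lin0.
  - by rewrite pcat0 !lin0.
  - by rewrite pcat1 !lin1.
apply: (homotopic_trans (homotopic_pcat pt1 pE (homotopic_refl cg))).
apply: (homotopic_trans (pcatA _ _ _ _ _)) => //.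
- exact: gwalk_continuous.
- exact: spoke_continuous.
- by rewrite gwalk_one spoke_zero.
- by rewrite spoke_one.
apply: homotopic_pcat.
- by rewrite gwalk_one pcat0 spoke_zero.
- exact/homotopic_refl/gwalk_continuous.
- by rewrite -g0 -g1; apply: spoke_move.
Qed.

(** The segment from [t] to [t'] is compact and shrinks to [t]. *)
Lemma near_segment (U : set X) t : open U -> U (f t) ->
  \forall t' \near t, forall u, U (f (lin t t' u)) /\ U (f (lin t' t u)).
Proof.
move=> oU Uft.
have cT : compact [set: I] by exact: interval_compact.
have key (h : I * I -> I) : continuous h -> (forall u, h (t, u) = t) ->
    \forall t' \near t, forall u, U (f (h (t', u))).
  move=> ch hE.
  have : \forall t' \near t, [set: I] `<=` (fun u => U (f (h (t', u)))).
    apply: ((compact_near_coveringP _).1 cT I (nbhs t) (fun t' u => U (f (h (t', u))))) => u _.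
    have : nbhs (t, u) [set y | U (f (h y))].
      have cfh : continuous (fun y => f (h y)) by exact: (comp_cont cf ch).
      have n : nbhs (f (h (t, u))) U by rewrite hE; exact: open_nbhs_nbhs.
      exact: (cfh (t, u) _ n).
    by case=> -[N M] /= [? ?] NM; exists (M, N) => // -[? ?] [? ?]; exact: (NM (_, _)).
  by apply: filterS => t' H u; exact: H.
have h1 : \forall t' \near t, forall u, U (f (lin t t' u)).
  apply: (key (fun y => lin t y.1 y.2)); first by continuity.
  by move=> u; rewrite linxx.
have h2 : \forall t' \near t, forall u, U (f (lin t' t u)).
  apply: (key (fun y => lin y.1 t y.2)); first by continuity.
  by move=> u; rewrite linxx.
by apply: filterS2 h1 h2 => t' ? ? u.
Qed.

Lemma homotopic_gwalk w : f one = Xr_vertex R r w ->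
  exists p : gpath v0 w, homotopic f (gwalk p).
Proof.
move=> f1.
have g0 : good zero.
  exists (inl v0); rewrite f0; split; first exact: level_vertex.
  exists (gpath_id v0); rewrite spoke_vertex gwalk_id pcat_cst_cst.
  rewrite (_ : part zero = cst (Xr_vertex R r v0)); first exact/homotopic_refl/cst_cont.
  by apply/funext => u; rewrite /part linxx f0.
have /(_ one)[m [m1 [p pE]]] : forall t, good t.
  move=> u; apply: (connected_locally_constant (P := good) interval_connected _ _ g0) => // t _.
  have [m mt] : exists m, 0 < level m (f t).
    by case: (weight_or_depth (f t)) => -[a ?]; [exists (inl a)|exists (inr a)].
  have oU := open_gt0 (@level_continuous R r G m).
  have H := @near_segment [set x | 0 < level m x] t oU mt.
  by apply: filterS H => t' H _; split; apply: (@good_move m) => y; have [] := H y.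
have {m m1 p pE} [p] : exists p : gpath v0 w, homotopic (part one)
    (pcat (gwalk p) (spoke simpleG (inl w) (f one))).
  apply: (@good_switch one (inl w)); last by rewrite f1; exact: level_vertex.
  by exists m; split=> //; exists p.
rewrite f1 spoke_vertex -(gwalk_one p) => pE; exists p.
rewrite (_ : f = part one).
  apply: (homotopic_trans pE); apply: pcat_cst; exact: gwalk_continuous.
by apply/funext => u; rewrite /part /lin ui_val0 ui_val1 mulr0 add0r mulr1 clampK.
Qed.

End surjectivity.

(** * The covering of the graph *)
Section graph_cover.
Context {r : nat} {G : graph} {v0 : G}.
Context (simpleG : simple_graph G).
Local Notation cell := (short_even_cycle r G).

(** The universal covering modulo short even cycles: its vertices over [w] are the
 classes of paths from [v0] to [w]. *)
Definition cover_vertex : Type := {w : G & {eq_quot (gpath_equiv r v0 w)}}.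

(** The lift of [p] to the covering ends at the class of [p] itself. *)
Definition lift_end w (p : gpath v0 w) : cover_vertex :=
  existT (fun w => {eq_quot (gpath_equiv r v0 w)}) w (\pi_({eq_quot (gpath_equiv r v0 w)}) p).

Definition foot (a : cover_vertex) : G := projT1 a.

Lemma lift_end_eq w (p q : gpath v0 w) : lift_end p = lift_end q <-> gpath_equiv r v0 w p q.
Proof.
split=> [|pq]; last by congr (existT _ w _); exact/eqmodP.
move=> E; have := projT2_eq E.
by rewrite (Prop_irrelevance (projT1_eq E) erefl) => /= /eqmodP.
Qed.

Lemma lift_end_surj (a : cover_vertex) : exists p : gpath v0 (foot a), a = lift_end p.
Proof. by case: a => w z; exists (repr z); rewrite /lift_end reprK. Qed.

Lemma lift_end_ext w w' (p : gpath v0 w) (q : gpath v0 w') : glen p = glen q ->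
  (forall i, (i <= glen p)%N -> gat p i = gat q i) -> lift_end p = lift_end q.
Proof.
move=> pq E; have ww : w = w' by rewrite -(gat_len p) -(gat_len q) -pq E.
by subst w'; rewrite (eq_gpath pq E).
Qed.

Definition gstep w w' (e : edge w w') : gpath w w' :=
  @mkgpath G 1 (fun i => if i is 0%N then w else w') w w'
    (fun i => match i return (i < 1)%N -> edge (if i is 0%N then w else w') w' with
              | 0%N => fun=> e | _.+1 => fun h => False_ind _ (notF h) end)
    erefl erefl.

Lemma gstep_back w w' (e : edge w w') (e' : edge w' w) :
  gpath_equiv r _ _ (gpath_cat (gstep e) (gstep e')) (gpath_id w).
Proof.
rewrite (_ : gstep e' = gpath_rev (gstep e)); first exact: gpath_equiv_catrev.
apply: eq_gpath => //= i i1; rewrite gat_rev // !gat_mkgpath //=; last by lia.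
by case: i i1 => [|[]].
Qed.

Definition adj (a b : cover_vertex) : Prop := exists w w' (e : edge w w') (p : gpath v0 w),
  a = lift_end p /\ b = lift_end (gpath_cat p (gstep e)).

Lemma adj_edge a b : adj a b -> edge (foot a) (foot b).
Proof. by move=> [w [w' [e [p [-> ->]]]]]. Qed.

Lemma lift_end_cat w w' (p q : gpath v0 w) (s t : gpath w w') : lift_end p = lift_end q ->
  gpath_equiv r _ _ s t -> lift_end (gpath_cat p s) = lift_end (gpath_cat q t).
Proof. by move=> /lift_end_eq pq st; apply/lift_end_eq/gpath_equiv_cat. Qed.

Lemma gequiv_refl (w w' : G) (p : gpath w w') : gpath_equiv r _ _ p p.
Proof. by apply/generated_equivP; exact: rst_refl. Qed.

Lemma adj_sym a b : adj a b -> adj b a.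
Proof.
move=> [w [w' [e [p [-> ->]]]]]; exists w', w, (edge_sym e), (gpath_cat p (gstep e)).
split=> //; rewrite -gpath_catA -{1}(gpath_catid p).
apply/lift_end_eq/gpath_equiv_cat; first exact: gequiv_refl.
have /generated_equivP H := gstep_back e (edge_sym e).
by apply/generated_equivP/rst_sym.
Qed.

Lemma adj_uniq a b b' : adj a b -> adj a b' -> foot b = foot b' -> b = b'.
Proof.
move=> [w [w1 [e [p [-> ->]]]]] [w' [w1' [e' [p' [pp ->]]]]] /= ww1.
have ww : w = w' by exact: (congr1 foot pp).
subst w' w1'; rewrite (Prop_irrelevance e' e).
exact: lift_end_cat (gequiv_refl _).
Qed.

Lemma adj_exists a w : edge (foot a) w -> exists2 b, adj a b & foot b = w.
Proof.
have [p ap] := lift_end_surj a => e.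
by exists (lift_end (gpath_cat p (gstep e))) => //; exists (foot a), w, e, p.
Qed.

(** Unique lifting: a walk in the covering over [u], issued from the class of [p],
 ends at the class of [p] followed by [u]. *)
Lemma adj_walk w w' (p : gpath v0 w) (u : gpath w w') (a : nat -> cover_vertex) :
  a 0%N = lift_end p -> (forall i, (i <= glen u)%N -> foot (a i) = gat u i) ->
  (forall i, (i < glen u)%N -> adj (a i) (a i.+1)) ->
  a (glen u) = lift_end (gpath_cat p u).
Proof.
move=> a0 af aa.
have fE k : (k <= glen u)%N -> forall i, (i < k)%N -> edge (gat u i) (gat u i.+1).
  by move=> ku i ik; apply: gat_edge; lia.
have main k (ku : (k <= glen u)%N) :
    a k = lift_end (gpath_cat p (mkgpath (fE k ku) (gat0 u) erefl)).
  elim: k ku => [|k IH] ku.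
    rewrite a0; apply: lift_end_ext => [|i ip] /=; first by rewrite addn0.
    by rewrite gat_catl.
  have ku' : (k <= glen u)%N by lia.
  have e : edge (gat u k) (gat u k.+1) by apply: gat_edge.
  set q := mkgpath (fE k ku') (gat0 u) erefl.
  have H : adj (a k) (lift_end (gpath_cat (gpath_cat p q) (gstep e))).
    by exists (gat u k), (gat u k.+1), e, (gpath_cat p q); rewrite (IH ku').
  rewrite (adj_uniq (aa k ku) H); last by rewrite af.
  apply: lift_end_ext => [|i] /=; first by rewrite addn1 addnS.
  rewrite addn1 => ile; have [ip|pi] := leqP i (glen p).
    by rewrite !gat_catl //=; lia.
  rewrite [RHS]gat_catr /=; last by lia.
  rewrite [RHS]gat_mkgpath; last by lia.
  have [ik|ki] := leqP i (glen p + k).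
    by rewrite gat_catl //= gat_catr /=; [rewrite gat_mkgpath //; lia|lia].
  have -> : i = (glen p + k).+1 by lia.
  rewrite gat_catr /=; last by lia.
  by rewrite subSnn subSn ?leq_addr // addKn gat_mkgpath.
rewrite (main (glen u)) //; apply: lift_end_ext => //= i ile.
have [ip|pi] := leqP i (glen p); first by rewrite !gat_catl.
by rewrite !gat_catr /= ?gat_mkgpath //; lia.
Qed.

(** The two halves of the cycle, travelled from the same origin [A] forwards and [B]
 backwards, have the same ends and differ at most at the [half_length c - 1]
 intermediate times, so they are equivalent; hence the whole cycle [A] followed
 by the reverse of [B] is trivial. *)
Lemma cycle_lift_closed (c : cell) j (b : nat -> cover_vertex) :
  (forall k, foot (b k) = cyc c (j + k)) -> (forall k, adj (b k) (b k.+1)) ->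
  b (clen c) = b 0%N.
Proof.
move=> bf ba; pose s := half_length c.
have nE : clen c = (s + s)%N by rewrite /clen /s; lia.
have b0 : foot (b 0%N) = cyc c j by rewrite bf addn0.
have upE n i : (i < n)%N -> edge (cyc c (j + i)) (cyc c (j + i.+1)).
  by move=> _; rewrite addnS; exact: cyc_edge.
have dnE i : (i < s)%N -> edge (cyc c (j + clen c - i)) (cyc c (j + clen c - i.+1)).
  move=> si; have -> : (j + clen c - i = (j + clen c - i.+1).+1)%N by lia.
  exact: edge_sym (cyc_edge _ _).
have e0 : cyc c (j + 0) = cyc c j by rewrite addn0.
have d0 : cyc c (j + clen c - 0) = cyc c j by rewrite subn0 cyc_period.
have ds : cyc c (j + clen c - s) = cyc c (j + s) by congr cyc; lia.
have en : cyc c (j + clen c) = cyc c j by rewrite cyc_period.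
pose u : gpath (cyc c j) (cyc c j) := mkgpath (@upE (clen c)) e0 en.
pose A : gpath (cyc c j) (cyc c (j + s)) := mkgpath (@upE s) e0 erefl.
pose B : gpath (cyc c j) (cyc c (j + s)) := mkgpath dnE d0 ds.
have AB : gpath_equiv r _ _ A B.
  apply/generated_equivP/rst_step; right; split=> //=.
  have sr : (s.-1 < r)%N by rewrite /s; have := half_length_bounds c; lia.
  apply: leq_ltn_trans sr.
  have c2 : #|[set (ord0 : 'I_s.+1); ord_max]%SET| = 2%N.
    rewrite cards2; have s2 : (2 <= s)%N by rewrite /s; have := half_length_bounds c; lia.
    by case: eqP => // /(congr1 val) /=; lia.
  apply: (@leq_trans #|(~: [set (ord0 : 'I_s.+1); ord_max])%SET|); last first.
    by rewrite cardsCs finset.setCK card_ord c2; lia.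
  apply/subset_leq_card/fintype.subsetP => i; rewrite finset.in_set => /asboolP h.
  rewrite finset.in_setC finset.in_set2; apply/negP => /orP[] /eqP E; apply: h; subst i.
    by rewrite !gat0.
  exact: etrans (gat_len A) (esym (gat_len B)).
have [p bp] : exists p : gpath v0 (cyc c j), b 0%N = lift_end p.
  by rewrite -b0; exact: lift_end_surj.
rewrite (@adj_walk _ _ p u b) // => [|i iu]; last by rewrite gat_mkgpath // bf.
have uE : u = gpath_cat A (gpath_rev B).
  apply: eq_gpath => [|i] /=; first exact: nE.
  move=> iu; rewrite gat_mkgpath //; have [si|si] := leqP i s.
    by rewrite gat_catl // gat_mkgpath.
  rewrite gat_catr /=; last by lia.
  rewrite gat_rev /=; last by lia.
  by rewrite gat_mkgpath; [congr cyc; lia|lia].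
rewrite bp -{2}(gpath_catid p) uE; apply: lift_end_cat => //.
apply/generated_equivP; apply: (@rst_trans _ _ _ (gpath_cat B (gpath_rev B))).
  by apply/generated_equivP/gpath_equiv_cat => //; exact: gequiv_refl.
exact/generated_equivP/gpath_equiv_catrev.
Qed.

(** A lift of the cycle to the covering, as a periodic sequence. *)
Definition lifts (c : cell) (f : nat -> cover_vertex) : Prop :=
  forall i, foot (f i) = cyc c i /\ adj (f i) (f i.+1).

Lemma lifts_period c f i m : lifts c f -> f (i + m * clen c)%N = f i.
Proof.
move=> fc; elim: m => [|m IH]; first by rewrite mul0n addn0.
rewrite -IH mulSn addnCA addnC.
have := @cycle_lift_closed c (i + m * clen c) (fun k => f (i + m * clen c + k)%N).
rewrite addn0; apply=> k; first by have [] := fc (i + m * clen c + k)%N.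
by rewrite addnS; have [] := fc (i + m * clen c + k)%N.
Qed.

Lemma lifts_mod c f i j : lifts c f -> (i = j %[mod clen c])%N -> f i = f j.
Proof.
move=> fc ij; rewrite (divn_eq i (clen c)) (divn_eq j (clen c)) ij.
by rewrite ![(_ * _ + _)%N]addnC !lifts_period.
Qed.

Lemma lifts_agree c f f' j : lifts c f -> lifts c f' -> f j = f' j -> f = f'.
Proof.
move=> fc fc' fj.
have fwd k : f (j + k)%N = f' (j + k)%N.
  elim: k => [|k IH]; first by rewrite addn0.
  rewrite addnS; apply: (@adj_uniq (f (j + k)%N)).
  - by have [] := fc (j + k)%N.
  - by rewrite IH; have [] := fc' (j + k)%N.
  - by rewrite (fc _).1 (fc' _).1.
apply/funext => i.
have le : (j <= i + j * clen c)%N.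
  by have := clen_gt0 c; case: (clen c) => // n _; rewrite mulnS; lia.
by rewrite -(lifts_period i j fc) -(lifts_period i j fc') -(subnKC le).
Qed.

Lemma walk_lift (f : nat -> G) (a : cover_vertex) : foot a = f 0%N ->
  exists2 b : nat -> cover_vertex, b 0%N = a &
  forall n, walkable f n -> foot (b n) = f n /\ forall i, (i < n)%N -> adj (b i) (b i.+1).
Proof.
move=> af.
pose s := fix s i : cover_vertex :=
  if i is k.+1 then
    if pselect (exists b, adj (s k) b /\ foot b = f k.+1) is left e then sval (cid e) else s k
  else a.
exists s => //; elim=> [|n IH] fE; first by split.
have [|sn sa] := IH; first by move=> i ik; apply: fE; lia.
have [|b bs bf] := @adj_exists (s n) (f n.+1); first by rewrite sn; exact: fE.
have [sn1 sn2] : adj (s n) (s n.+1) /\ foot (s n.+1) = f n.+1.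
  by rewrite /=; case: pselect => [e|[]]; [case: cid|exists b].
split=> // i; rewrite ltnS leq_eqVlt => /predU1P[->//|]; exact: sa.
Qed.

(** Lift the infinite walk around the cycle that starts at index [j], and shift it by
 a complement [d] of [j] to a multiple of the length. *)
Lemma lifts_exist c j (a : cover_vertex) : foot a = cyc c j -> exists2 f, lifts c f & f j = a.
Proof.
move=> aj; pose n := clen c; pose d := (n - j %% n)%N.
have jn : (j %% n <= n)%N by rewrite ltnW // ltn_mod clen_gt0.
have [|b b0 bw] := @walk_lift (fun i => cyc c (j + i)) a; first by rewrite addn0.
have bE i : foot (b i) = cyc c (j + i) /\ adj (b i) (b i.+1).
  have [|_ ba] := bw i.+1; first by move=> k _; rewrite addnS; exact: cyc_edge.
  have [|bi _] := bw i; first by move=> k _; rewrite addnS; exact: cyc_edge.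
  by split=> //; apply: ba.
have period i m : b (i + m * n)%N = b i.
  elim: m => [|m IH]; first by rewrite mul0n addn0.
  rewrite -IH mulSn addnCA addnC.
  have := @cycle_lift_closed c (j + (i + m * n)) (fun k => b (i + m * n + k)%N).
  rewrite addn0; apply=> k; first by rewrite (bE _).1; congr cyc; lia.
  by rewrite addnS; exact: (bE _).2.
exists (fun i => b (i + d)%N) => [i|].
  rewrite addSn; split; last exact: (bE _).2.
  rewrite (bE _).1; apply: cyc_mod_eq; rewrite /d.
  have -> : (j + (i + (n - j %% n)) = i + (j %/ n).+1 * n)%N.
    by rewrite {1}(divn_eq j n) mulSn; lia.
  by rewrite addnC modnMDl.
have -> : (j + d = 0 + (j %/ n).+1 * n)%N by rewrite /d {1}(divn_eq j n) mulSn; lia.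
by rewrite period.
Qed.

Lemma gpath_lift w (p : gpath v0 w) : exists b : nat -> cover_vertex,
  [/\ b 0%N = lift_end (gpath_id v0), b (glen p) = lift_end p,
      forall i, (i <= glen p)%N -> foot (b i) = gat p i &
      forall i, (i < glen p)%N -> adj (b i) (b i.+1)].
Proof.
have [|b b0 bw] := @walk_lift (gat p) (lift_end (gpath_id v0)); first by rewrite gat0.
have bf i : (i <= glen p)%N -> foot (b i) = gat p i.
  by move=> ip; have [] // := bw i; move=> k ki; apply: gat_edge; lia.
have ba i : (i < glen p)%N -> adj (b i) (b i.+1).
  by move=> ip; have [|_] := bw i.+1; [move=> k ki; apply: gat_edge; lia|exact].
exists b; split=> //.
by rewrite (adj_walk b0 bf ba) gpath_idcat.
Qed.

End graph_cover.

(** * Local systems *)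
Section monodromy.
Context {S : Type}.

(** A covering described by partial sections over open sets: [S] is a set of names
 of such sections, [E y a a] says that [a] is defined at [y], and [E y a b] that
 [a] and [b] have the same value at [y].  The third axiom says that coincidence is
 locally constant, the fourth one that the covering is trivial over some
 neighbourhood [N] of each point. *)
Definition local_system (Y : topologicalType) (E : Y -> S -> S -> Prop) : Prop :=
  [/\ forall y a b, E y a b -> E y b a,
      forall y a b c, E y a b -> E y b c -> E y a c,
      forall y a b, E y a a -> E y b b -> \forall y' \near y, E y' a b <-> E y a b &
      forall y : Y, exists2 N : set Y, nbhs y N &
        forall y' a, N y' -> E y' a a -> exists2 b, E y' a b & forall z, N z -> E z b b].

(** A global section over [B], given by the choice at each point of a partial section
 through its value. *)
Definition flat_on (Y : topologicalType) (E : Y -> S -> S -> Prop) (B : set Y) (s : Y -> S) :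
  Prop := forall y : Y, B y -> E y (s y) (s y) /\
            \forall y' \near y, B y' -> E y' (s y') (s y).

Definition extends_from (Y : topologicalType) (E : Y -> S -> S -> Prop) (B : set Y) (y0 : Y) :
  Prop := forall a, E y0 a a -> exists2 s, flat_on E B s & E y0 (s y0) a.

Lemma local_system_pullback (Y Z : topologicalType) (E : Y -> S -> S -> Prop) (h : Z -> Y) :
  continuous h -> local_system E -> local_system (fun z => E (h z)).
Proof.
move=> ch [Es Et Ec Ee]; split=> [z|z|z a b Ea Eb|z].
- exact: Es.
- exact: Et.
- exact: (ch z _ (Ec _ _ _ Ea Eb)).
- have [N nN NE] := Ee (h z); exists (h @^-1` N); first exact: (ch z _ nN).
  by move=> z' a Nz' /(NE _ _ Nz')[b ab bN]; exists b => // y Ny; exact: bN.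
Qed.

Lemma flat_pullback (Y Z : topologicalType) (E : Y -> S -> S -> Prop) (h : Z -> Y)
    (B : set Y) (C : set Z) s : continuous h -> (forall z, C z -> B (h z)) ->
  flat_on E B s -> flat_on (fun z => E (h z)) C (fun z => s (h z)).
Proof.
move=> ch CB fs z Cz; have [sz nz] := fs _ (CB _ Cz); split=> //.
have nhz := ch z _ nz; rewrite /nbhs /= in nhz.
near=> z' => Cz'.
have : B (h z') -> E (h z') (s (h z')) (s (h z)) by near: z'.
by apply; exact: CB.
Unshelve. all: by end_near. Qed.

Lemma flat_cst (Y : topologicalType) (E : Y -> S -> S -> Prop) (B : set Y) a :
  (forall y, B y -> E y a a) -> flat_on E B (fun=> a).
Proof. by move=> aB y By; split; [exact: aB|apply: nearW => z; exact: aB]. Qed.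

Section flat_sections.
Context {Y : topologicalType} {E : Y -> S -> S -> Prop} (lE : local_system E).
Implicit Types (B : set Y) (s t : Y -> S).

Lemma flat_unique B s t y0 : connected B -> flat_on E B s -> flat_on E B t ->
  B y0 -> E y0 (s y0) (t y0) -> forall y, B y -> E y (s y) (t y).
Proof.
have [Es Et Ec _] := lE => cB fs ft By0 st0.
apply: (connected_locally_constant cB) By0 st0 => y By.
have [sy ns] := fs y By; have [ty nt] := ft y By.
apply: filterS3 ns nt (Ec _ _ _ sy ty) => y' ss tt H By'.
have {}ss := ss By'; have {}tt := tt By'.
split=> [st|/H st].
  by apply/H; apply: Et (Es _ _ _ ss) (Et _ _ _ _ st tt).
by apply: Et ss (Et _ _ _ _ st (Es _ _ _ tt)).
Qed.

(** A section over [B], continued from [y1] to [C], agrees with its continuation on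
 the connected set where both are defined. *)
Lemma flat_glue B C y0 y1 : closed B -> closed C -> connected (B `&` C) ->
  B y0 -> B y1 -> C y1 ->
  extends_from E B y0 -> extends_from E C y1 -> extends_from E (B `|` C) y0.
Proof.
have [Es Et Ec _] := lE => clB clC cBC By0 By1 Cy1 eB eC a a0.
have [s fs s0] := eB a a0.
have [t ft t1] := eC _ (fs y1 By1).1.
have ts y : B y -> C y -> E y (t y) (s y).
  move=> By Cy; apply: (@flat_unique (B `&` C) t s y1) => //.
  - move=> z [Bz Cz]; have [tz nz] := ft z Cz; split=> //.
    by apply: filterS nz => z' H [_ ?]; exact: H.
  - move=> z [Bz Cz]; have [sz nz] := fs z Bz; split=> //.
    by apply: filterS nz => z' H [? _]; exact: H.
pose u y := if pselect (B y) then s y else t y.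
have uB y : B y -> u y = s y by rewrite /u; case: pselect.
have uC y : ~ B y -> u y = t y by rewrite /u; case: pselect.
exists u; last by rewrite uB.
have outside (A : set Y) (y : Y) : closed A -> ~ A y -> \forall y' \near y, ~ A y'.
  by move=> cA nA; apply: open_nbhs_nbhs; split=> //; exact: closed_openC.
move=> y BCy; have [By|nBy] := pselect (B y).
  rewrite (uB y) //; have [sy ns] := fs y By; split=> //.
  have [Cy|nCy] := pselect (C y); last first.
    have nC : \forall y' \near y, ~ C y' := outside _ _ clC nCy.
    by apply: filterS2 ns nC => y' H nC' [By'|//]; rewrite uB //; exact: H.
  have [ty nt] := ft y Cy.
  apply: filterS3 ns nt (Ec _ _ _ ty sy) => y' ns' nt' H BCy'.
  have [By'|nBy'] := pselect (B y'); first by rewrite uB //; exact: ns'.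
  have Cy' : C y' by case: BCy'.
  rewrite uC //; apply: Et (nt' Cy') _; apply/H; exact: ts.
have Cy : C y by case: BCy.
rewrite (uC y) //; have [ty nt] := ft y Cy; split=> //.
have nB : \forall y' \near y, ~ B y' := outside _ _ clB nBy.
apply: filterS2 nt nB => y' H nB' [//|Cy'].
by rewrite uC //; exact: H.
Qed.

Lemma flat_local (y : Y) : exists2 N : set Y, nbhs y N &
  forall B y0, B `<=` N -> B y0 -> extends_from E B y0.
Proof.
have [Es Et _ Ee] := lE; have [N nN NE] := Ee y; exists N => // B y0 BN By0 a aa.
have [b ab bN] := NE _ _ (BN _ By0) aa; exists (fun=> b); last exact: Es.
by apply: flat_cst => z Bz; apply: bN; exact: BN.
Qed.

End flat_sections.
End monodromy.

Section square_sections.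
Context {R : realType} {S : Type}.

(** For fixed [a], the property that [Q a t'] holds for all [t'] between [a] and [t]
 is locally constant in [t]. *)
Lemma segment_induction (Q : R -> R -> Prop) :
  (forall a b c, a <= b -> b <= c -> Q a b -> Q b c -> Q a c) ->
  (forall t, exists2 e, 0 < e & forall a b, a <= b -> t - e < a -> b < t + e -> Q a b) ->
  forall a b, a <= b -> Q a b.
Proof.
move=> add loc a b ab.
have loc0 t : Q t t by have [e e0 H] := loc t; apply: H; lra.
pose P t := forall t', a <= t' <= t -> Q a t'.
suff : P b by apply; rewrite ab lexx.
have cab : connected `[a, b] by exact: segment_connected.
apply: (connected_locally_constant (P := P) cab _ (y0 := a)).
- move=> t; rewrite /= in_itv /= => /andP[at_ tb].
  have [e e0 H] := loc t.
  have : \forall t' \near t, t - e < t' < t + e.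
    by near=> t'; apply/andP; split; near: t'; [apply: lt_nbhsr|apply: lt_nbhsl]; lra.
  apply: filterS => t' /andP[t'1 t'2]; rewrite in_itv /= => /andP[at' _].
  have gen s s' : t - e < s -> s' < t + e -> s <= s' -> a <= s -> P s -> P s'.
    move=> s1 s2 ss as_ Ps x /andP[ax xs'].
    have [xs|sx] := leP x s; first by apply: Ps; rewrite ax xs.
    apply: (add _ s) => //; [exact: ltW|by apply: Ps; rewrite as_ lexx|].
    by apply: H => //; [exact: ltW|lra].
  have mono s s' : s <= s' -> P s' -> P s.
    by move=> ss Ps' x /andP[ax xs]; apply: Ps'; rewrite ax (le_trans xs ss).
  have [tt|/ltW tt] := leP t t'; split.
  + exact: mono.
  + by apply: gen => //; lra.
  + by apply: gen => //; lra.
  + exact: mono.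
- by rewrite /= in_itv /= lexx ab.
- by move=> t' /andP[h1 h2]; have -> : t' = a by apply/eqP; rewrite eq_le h1 h2.
- by rewrite /= in_itv /= lexx ab.
Unshelve. all: by end_near. Qed.

Context (E : R * R -> S -> S -> Prop) (lE : local_system E).

Definition rect (a b c d : R) : set (R * R) := [set y | a <= y.1 <= b /\ c <= y.2 <= d].

Lemma rect_closed a b c d : closed (rect a b c d).
Proof.
have -> : rect a b c d = (fst @^-1` `[a, b]) `&` (snd @^-1` `[c, d]).
  by apply/seteqP; split=> -[x y] /=; rewrite /rect /= !in_itv.
apply: closedI; apply: preimage_closed; try exact: itv_closed.
  by move=> z _; exact: fst_cont.
by move=> z _; exact: snd_cont.
Qed.

(** Sections exist on small rectangles and can be glued along a common side, so
 [segment_induction] applies twice: in the second coordinate it gives thin columns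
 of full height, in the first one it puts columns side by side. *)
Lemma rect_extends a b c d : a <= b -> c <= d -> extends_from E (rect a b c d) (a, c).
Proof.
move=> ab cd; move: a b ab.
have gluet a b e : a <= b -> b <= e ->
    extends_from E (rect a b c d) (a, c) -> extends_from E (rect b e c d) (b, c) ->
    extends_from E (rect a e c d) (a, c).
  move=> ab be H1 H2.
  have -> : rect a e c d = rect a b c d `|` rect b e c d.
    apply/seteqP; split=> -[x y] /=; rewrite /rect /=.
      by move=> [/andP[h1 h2] h3]; have [xb|bx] := leP x b; [left|right]; split=> //;
        apply/andP; split=> //; exact: ltW.
    by case=> -[/andP[h1 h2] h3]; split=> //; apply/andP; split=> //; lra.
  apply: (flat_glue lE (y1 := (b, c))) => //; try exact: rect_closed.
  - have -> : rect a b c d `&` rect b e c d = (fun t : R => (b, t)) @` `[c, d].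
      apply/seteqP; split=> [[x y] /= [[/andP[h1 h2] h3] [/andP[h4 h5] _]]|_ [t + <-]].
        exists y; first by rewrite in_itv.
        by congr pair; apply/eqP; rewrite eq_le h2 h4.
      by rewrite /= in_itv /= => h; rewrite /rect /= ab be !lexx.
    apply: connected_continuous_connected; first exact: segment_connected.
    by apply: continuous_subspaceT; continuity.
  - by rewrite /rect /= !lexx ab cd.
  - by rewrite /rect /= !lexx ab cd.
  - by rewrite /rect /= !lexx be cd.
have glues a b c0 d0 e : a <= b -> c0 <= d0 -> d0 <= e ->
    extends_from E (rect a b c0 d0) (a, c0) -> extends_from E (rect a b d0 e) (a, d0) ->
    extends_from E (rect a b c0 e) (a, c0).
  move=> ab cd0 de H1 H2.
  have -> : rect a b c0 e = rect a b c0 d0 `|` rect a b d0 e.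
    apply/seteqP; split=> -[x y] /=; rewrite /rect /=.
      by move=> [h3 /andP[h1 h2]]; have [xb|bx] := leP y d0; [left|right]; split=> //;
        apply/andP; split=> //; exact: ltW.
    by case=> -[h3 /andP[h1 h2]]; split=> //; apply/andP; split=> //; lra.
  apply: (flat_glue lE (y1 := (a, d0))) => //; try exact: rect_closed.
  - have -> : rect a b c0 d0 `&` rect a b d0 e = (fun t : R => (t, d0)) @` `[a, b].
      apply/seteqP; split=> [[x y] /= [[h3 /andP[h1 h2]] [_ /andP[h4 h5]]]|_ [t + <-]].
        exists x; first by rewrite in_itv.
        by congr pair; apply/eqP; rewrite eq_le h2 h4.
      by rewrite /= in_itv /= => h; rewrite /rect /= cd0 de !lexx.
    apply: connected_continuous_connected; first exact: segment_connected.
    by apply: continuous_subspaceT; continuity.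
  - by rewrite /rect /= !lexx ab cd0.
  - by rewrite /rect /= !lexx ab cd0.
  - by rewrite /rect /= !lexx ab de.
have {glues} column t : exists2 e, 0 < e & forall a b, a <= b -> t - e < a -> b < t + e ->
    extends_from E (rect a b c d) (a, c).
  move: c d cd {gluet}; apply: segment_induction => [c d e cd de [e1 e10 H1] [e2 e20 H2]|s].
    exists (Num.min e1 e2) => [|a b ab]; first by rewrite lt_min e10 e20.
    rewrite ltrBlDr -ltrBlDl lt_min => /andP[a1 a2].
    rewrite -ltrBlDl lt_min => /andP[b1 b2].
    by apply: (glues a b c d e) => //; [apply: H1|apply: H2] => //; lra.
  have [N [[N1 N2] /= [N1t N2s] N12] NE] := flat_local lE (t, s).
  have /nbhs_ballP[e1 /= e10 B1] := N1t; have /nbhs_ballP[e2 /= e20 B2] := N2s.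
  exists (Num.min e1 e2) => [|c d cd]; first by rewrite lt_min e10 e20.
  rewrite ltrBlDr -ltrBlDl lt_min => /andP[c1 c2].
  rewrite -ltrBlDl lt_min => /andP[d1 d2].
  exists (Num.min e1 e2) => [|a b ab]; first by rewrite lt_min e10 e20.
  rewrite ltrBlDr -ltrBlDl lt_min => /andP[a1 a2].
  rewrite -ltrBlDl lt_min => /andP[b1 b2].
  apply: NE; last by rewrite /rect /= !lexx ab cd.
  move=> -[x y]; rewrite /rect /= => -[/andP[x1 x2] /andP[y1 y2]]; apply: (N12 (x, y)).
  by split; [apply: B1|apply: B2]; rewrite /ball /= ltr_norml; apply/andP; split; lra.
apply: segment_induction => [a b e ab be|t]; first exact: gluet.
by have [e e0 H] := column t; exists e.
Qed.

End square_sections.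

(** * Injectivity *)
Section sheets.
Context {R : realType} {r : nat} {G : graph} {v0 : G}.
Context (simpleG : simple_graph G).
Local Notation I := (unit_interval R).
Local Notation X := (Xr R r G).
Local Notation cell := (short_even_cycle r G).
Local Notation vert := (@cover_vertex r G v0).
Implicit Types (c : cell) (x : X) (a b : vert) (f : nat -> vert).

(** The part of the covering over the star of a vertex is the union of the stars of
 the vertices above it, and over an open disk it is the union of copies of the
 disk, one for each lift of its boundary cycle. *)
Definition sheet : Type := (vert + cell * (nat -> vert))%type.

Definition same_sheet x (s t : sheet) : Prop :=
  match s, t with
  | inl a, inl b => [/\ 0 < weight (foot a) x, 0 < weight (foot b) x & a = b \/ adj a b]
  | inl a, inr (c, f) | inr (c, f), inl a =>
      lifts c f /\ exists2 j, 0 < sector c j x & f j = a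
  | inr cf, inr cf' => [/\ lifts cf.1 cf.2, 0 < depth cf.1 x & cf = cf']
  end.

Lemma same_sheet_sym x s t : same_sheet x s t -> same_sheet x t s.
Proof.
case: s t => [a|[c f]] [b|[c' f']] //=.
  by move=> [ax bx [->|ab]]; split=> //; [left|right; exact: adj_sym].
by move=> [cf cx [<- <-]].
Qed.

Lemma foot_adj a b : adj a b -> foot a <> foot b.
Proof. by move=> /adj_edge + E; rewrite E => /simpleG. Qed.

Lemma sector_foot c f j x : lifts c f -> 0 < sector c j x -> 0 < weight (foot (f j)) x.
Proof. by move=> cf jx; rewrite (cf j).1; exact: sector_weight. Qed.

Lemma sector_unique c j j' x : 0 < sector c j x -> 0 < sector c j' x ->
  cyc c j = cyc c j' -> (j = j' %[mod clen c])%N.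
Proof.
move=> jx j'x E; case: (sector_adjacent jx j'x) => // e.
  by case: (cyc_neq simpleG (c := c) (k := j)); rewrite E; apply/esym/cyc_mod_eq.
by case: (cyc_neq simpleG (c := c) (k := j')); rewrite -E; apply/esym/cyc_mod_eq.
Qed.

(** The points of the disk of [c] lying in the stars of two adjacent vertices are in
 sectors with consecutive indices, and the lift of the cycle follows edges of the
 covering. *)
Lemma same_sheet_lift x a b c f : same_sheet x (inl a) (inl b) ->
  same_sheet x (inl b) (inr (c, f)) -> same_sheet x (inl a) (inr (c, f)).
Proof.
move=> [ax bx ab] [cf [j jx fj]]; case: ab => [->|ab]; first by split=> //; exists j.
split=> //; have [j' aj' j'x] := weight_depth ax (sector_depth jx).
exists j' => //; have bj : foot b = cyc c j by rewrite -fj (cf j).1.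
apply: (@adj_uniq _ _ _ b); [|exact: adj_sym|by rewrite (cf j').1].
case: (sector_adjacent jx j'x) => e.
- by case: (foot_adj ab); rewrite aj' bj; apply/esym/cyc_mod_eq.
- by rewrite -fj -(lifts_mod cf e); exact: (cf j).2.
- by rewrite -fj -(lifts_mod cf e); apply: adj_sym; exact: (cf j').2.
Qed.

Lemma same_sheet_trans x s t u : same_sheet x s t -> same_sheet x t u -> same_sheet x s u.
Proof.
case: s t u => [a|[c f]] [b|[c' f']] [d|[c'' f'']].
- move=> /= [ax bx ab] [_ dx bd]; split=> //.
  case: ab bd => [->//|ab] [<-|bd]; [by right|].
  have [ad|ba] := weight_three dx ax bx (foot_adj ab).
    by left; apply: (adj_uniq (adj_sym ab) bd).
  by case: (foot_adj (adj_sym bd)).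
- exact: same_sheet_lift.
- move=> /= [cf [j jx <-]] [_ [j' j'x <-]].
  have fx i := @sector_foot c' f' i x cf.
  split; [exact: fx|exact: fx|].
  case: (sector_adjacent jx j'x) => e.
  + by left; exact: lifts_mod e.
  + by right; rewrite -(lifts_mod cf e); exact: (cf j).2.
  + by right; rewrite -(lifts_mod cf e); apply: adj_sym; exact: (cf j').2.
- by move=> /= ? [_ _ [<- <-]].
- move=> cb bd; apply: same_sheet_sym; apply: same_sheet_lift (same_sheet_sym cb).
  exact: same_sheet_sym bd.
- move=> /= [cf [j jx fj]] [cf' [j' j'x fj']]; split=> //=; first exact: sector_depth jx.
  have cc := depth_unique (sector_depth jx) (sector_depth j'x); subst c''; congr pair.
  apply: (lifts_agree (j := j) cf cf'); rewrite fj -fj'; apply: (lifts_mod cf').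
  apply: sector_unique j'x jx _.
  by rewrite -(cf j).1 -(cf' j').1 fj fj'.
- by move=> /= [_ _ [<- <-]].
- by move=> /= [? ? [<- <-]] [? ? [<- <-]].
Qed.

Lemma near_gt0 (h : X -> R) x : continuous h -> 0 < h x -> \forall x' \near x, 0 < h x'.
Proof. by move=> ch hx; exact: cvgr_gt (ch x) _ hx. Qed.

(** Only the comparison of a vertex and a disk depends on the point, and it does so
 through the index of its sector, which is locally constant. *)
Lemma same_sheet_near x s t : same_sheet x s s -> same_sheet x t t ->
  \forall x' \near x, same_sheet x' s t <-> same_sheet x s t.
Proof.
have mixed a c f : same_sheet x (inl a) (inl a) -> same_sheet x (inr (c, f)) (inr (c, f)) ->
    \forall x' \near x, same_sheet x' (inl a) (inr (c, f)) <-> same_sheet x (inl a) (inr (c, f)).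
  move=> [ax _ _] [/= cf cx _].
  have [j aj jx] := weight_depth ax cx.
  have key z : 0 < sector c j z -> same_sheet z (inl a) (inr (c, f)) <-> f j = a.
    move=> jz; split=> [[_ [j' j'z fj']]|fj]; last by split=> //; exists j.
    rewrite -fj'; apply: (lifts_mod cf); apply: sector_unique jz j'z _.
    by rewrite -aj -fj' (cf j').1.
  apply: filterS (near_gt0 (@sector_continuous R r G c j) jx) => x' jx'.
  by split=> /key H; apply/key => //; exact: H.
case: s t => [a|[c f]] [b|[c' f']] ss tt.
- have [ax _ _] := ss; have [bx _ _] := tt.
  apply: filterS2 (near_gt0 (@weight_continuous R r G (foot a)) ax)
    (near_gt0 (@weight_continuous R r G (foot b)) bx) => x' ax' bx'.
  by split=> -[_ _ ?]; split.
- exact: mixed.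
- by apply: filterS (mixed _ _ _ tt ss) => x' H; split=> /same_sheet_sym/H/same_sheet_sym.
- have [/= cf cx _] := ss.
  apply: filterS (near_gt0 (@depth_continuous R r G c) cx) => x' cx'.
  by split=> -[_ _ ?]; split.
Qed.

Lemma same_sheet_local_system : local_system same_sheet.
Proof.
split; [exact: same_sheet_sym|exact: same_sheet_trans|exact: same_sheet_near|].
move=> x; have [[v lift_end]|[c cx]] := weight_or_depth x.
  exists [set z | 0 < weight v z]; first exact: near_gt0 (@weight_continuous R r G v) lift_end.
  move=> z s /= vz ss.
  suff [b bv sb] : exists2 b, foot b = v & same_sheet z s (inl b).
    by exists (inl b) => // y vy; split; [rewrite bv|rewrite bv|left].
  case: s ss => [a [az _ _]|[c f] [/= cf cz _]].
    have [<-|av] := pselect (foot a = v); first by exists a => //; split=> //; left.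
    have [b ab bv] := adj_exists (weight_edge az vz av).
    by exists b => //; split=> //; [rewrite bv|right].
  have [j vj jz] := weight_depth vz cz.
  by exists (f j); [rewrite (cf j).1|split=> //; exists j].
exists [set z | 0 < depth c z]; first exact: near_gt0 (@depth_continuous R r G c) cx.
move=> z s /= cz ss.
suff [f cf sf] : exists2 f, lifts c f & same_sheet z s (inr (c, f)).
  by exists (inr (c, f)) => // y cy; split.
case: s ss => [a [az _ _]|[c' f] [/= cf c'z _]].
  have [j aj jz] := weight_depth az cz.
  have [f cf fj] := lifts_exist aj.
  by exists f => //; split=> //; exists j.
have cc := depth_unique cz c'z; subst c'.
by exists f => //; split.
Qed.

(** Stated for all sections along [f], so that transport along a concatenation needs
 restrictions of sections and no gluing. *)
Definition transports (f : I -> X) (s t : sheet) : Prop := forall h : I -> sheet,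
  flat_on (fun u => same_sheet (f u)) setT h -> same_sheet (f zero) (h zero) s ->
  same_sheet (f one) (h one) t.

Lemma transports_valid (f : I -> X) (s : sheet) :
  continuous f -> (forall u, same_sheet (f u) s s) -> transports f s s.
Proof.
move=> cf fs h fh h0.
have lE := local_system_pullback cf same_sheet_local_system.
by apply: (flat_unique lE interval_connected fh (flat_cst (fun u _ => fs u)) _ h0).
Qed.

Definition half : I := clamp (2^-1).

Lemma ui_val_half : ui_val half = 2^-1.
Proof. by rewrite clampE //; lra. Qed.

Lemma transports_split (f : I -> X) (s t u : sheet) : continuous f ->
  transports (fun y => f (lin zero half y)) s t -> transports (fun y => f (lin half one y)) t u ->
  transports f s u.
Proof.
move=> cf ft fu h fh h0.
have cl (a b : I) : continuous (lin a b) by continuity.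
have := ft (fun y => h (lin zero half y)).
rewrite !lin0 !lin1 => /(_ _ h0) H1.
have {}H1 := H1 (@flat_pullback _ _ _ _ (lin zero half) setT setT h (cl _ _) (fun _ _ => Logic.I) fh).
have := fu (fun y => h (lin half one y)).
rewrite !lin0 !lin1; apply => //.
exact: (@flat_pullback _ _ _ _ (lin half one) setT setT h (cl _ _) (fun _ _ => Logic.I) fh).
Qed.

Lemma transports_pcat (f g : I -> X) (s t u : sheet) :
  continuous f -> continuous g -> f one = g zero ->
  transports f s t -> transports g t u -> transports (pcat f g) s u.
Proof.
move=> cf cg fg ft gu; apply: (transports_split (pcat_cont cf cg fg) (t := t)).
  rewrite (_ : (fun y => _) = f) //; apply/funext => y.
  have /andP[y0 y1] := ui_valP y.
  rewrite /pcat ui_val_lin ui_val0 ui_val_half ifT; last by lra.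
  by rewrite -[in RHS](clampK y); congr (f (clamp _)); lra.
rewrite (_ : (fun y => _) = g) //; apply/funext => y.
have /andP[y0 y1] := ui_valP y.
rewrite /pcat ui_val_lin ui_val1 ui_val_half; case: ifP => [yy|_].
  have y_0 : y = zero by apply: ui_val_inj; rewrite ui_val0; lra.
  by rewrite y_0 ui_val0 -fg -clamp1; congr (f (clamp _)); lra.
by rewrite -[in RHS](clampK y); congr (g (clamp _)); lra.
Qed.

(** The first sheet contains the first half of the edge, the second one its second
 half, and they meet at the midpoint. *)
Lemma transports_edge a b : adj a b ->
  transports (echart (foot a) (foot b)) (inl a) (inl b).
Proof.
move=> ab; have e := adj_edge ab; have sp : spans_simplex (foot a) (foot b) by right.
have cl (u v : I) : continuous (lin u v) by continuity.
have ce : continuous (echart (foot a) (foot b) : I -> X) by exact: echart_continuous.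
have wa (t : I) : ui_val t < 1 -> 0 < weight (foot a) (echart (foot a) (foot b) t : X).
  by move=> t1; rewrite weight_echart //; apply/bary_gt0; left.
have wb (t : I) : 0 < ui_val t -> 0 < weight (foot b) (echart (foot a) (foot b) t : X).
  by move=> t1; rewrite weight_echart //; apply/bary_gt0; right.
have hab : same_sheet (echart (foot a) (foot b) half) (inl a) (inl b).
  by split; [apply: wa; rewrite ui_val_half; lra|apply: wb; rewrite ui_val_half; lra|right].
apply: (transports_split ce (t := inl b)).
  move=> h fh h0; rewrite lin1; apply: same_sheet_trans hab; rewrite -(lin1 zero half).
  apply: (@transports_valid (fun y => echart (foot a) (foot b) (lin zero half y)) (inl a) _ _ h) => //.
    exact: (comp_cont ce (cl _ _)).
  move=> u; have /andP[u0 u1] := ui_valP u.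
  by split; [apply: wa|apply: wa|left] => //; rewrite ui_val_lin ui_val0 ui_val_half; lra.
apply: transports_valid; first exact: (comp_cont ce (cl _ _)).
move=> u; have /andP[u0 u1] := ui_valP u.
by split; [apply: wb|apply: wb|left] => //; rewrite ui_val_lin ui_val1 ui_val_half; lra.
Qed.

Lemma vertex_valid a : same_sheet (Xr_vertex R r (foot a)) (inl a) (inl a).
Proof. by split; [exact: (level_vertex (foot a))|exact: (level_vertex (foot a))|left]. Qed.

Lemma transports_gwalk w (p : gpath v0 w) :
  transports (gwalk p) (inl (lift_end (gpath_id v0))) (inl (lift_end p)).
Proof.
have [b [b0 bp bf ba]] := @gpath_lift r G v0 w p; rewrite -b0 -bp.
have main n : (n <= glen p)%N -> transports (walk (gat p) n) (inl (b 0%N)) (inl (b n)).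
  elim: n => [_|n IH np] /=.
    apply: transports_valid => [|u]; first exact: cst_cont.
    by rewrite /= -bf //; exact: vertex_valid.
  have wn : walkable (gat p) n by move=> i ip; apply: gat_edge; lia.
  apply: (@transports_pcat _ _ _ (inl (b n))).
  - exact: walk_continuous.
  - exact: echart_continuous.
  - by rewrite walk_one // echart_zero.
  - by apply: IH; lia.
  - by rewrite -!bf //; [apply: transports_edge; exact: ba|lia].
exact: main.
Qed.

(** A section over the square of the homotopy starts at the trivial class; by
 transport it reaches the class of [p] along one side, that of [q] along the
 opposite one, and it stays constant along the other two. *)
Lemma homotopic_lift_end w (p q : gpath v0 w) :
  homotopic (gwalk p : I -> X) (gwalk q) -> lift_end p = lift_end q :> vert.
Proof.
move=> [H [cH H0 H1 He]].
pose E (y : R * R) := same_sheet (H (clamp y.1, clamp y.2)).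
have cE : continuous (fun y : R * R => H (clamp y.1, clamp y.2)) by continuity.
have lE : local_system E := local_system_pullback cE same_sheet_local_system.
have H00 : H (zero, zero) = Xr_vertex R r v0 by rewrite H0 gwalk_zero.
have start : E (0, 0) (inl (lift_end (gpath_id v0))) (inl (lift_end (gpath_id v0))).
  by rewrite /E /= clamp0 H00; exact: (vertex_valid (lift_end (gpath_id v0))).
have [s fs s0] := rect_extends lE ler01 ler01 start.
have edgeF (h : I -> R * R) (f : I -> X) : continuous h ->
    (forall t, rect 0 1 0 1 (h t)) -> (forall t, H (clamp (h t).1, clamp (h t).2) = f t) ->
    flat_on (fun t => same_sheet (f t)) setT (fun t => s (h t)).
  move=> ch hr hE.
  have -> : (fun t => same_sheet (f t)) = fun t => E (h t) by apply/funext => t; rewrite /E hE.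
  exact: flat_pullback ch (fun t _ => hr t) fs.
have in1 (t : I) : 0 <= ui_val t <= 1 by exact: ui_valP.
have in0 : 0 <= (0 : R) <= 1 by rewrite lexx ler01.
have in1' : 0 <= (1 : R) <= 1 by rewrite lexx ler01.
have bottom : flat_on (fun t => same_sheet (gwalk p t)) setT (fun t => s (ui_val t, 0)).
  apply: (edgeF (fun t => (ui_val t, 0))) => [|t|t] /=;
    [by continuity|exact: (conj (in1 t) in0)|].
  by rewrite clampK clamp0 H0.
have top : flat_on (fun t => same_sheet (gwalk q t)) setT (fun t => s (ui_val t, 1)).
  apply: (edgeF (fun t => (ui_val t, 1))) => [|t|t] /=;
    [by continuity|exact: (conj (in1 t) in1')|].
  by rewrite clampK clamp1 H1.
have left_side : flat_on (fun t => same_sheet (cst (Xr_vertex R r v0) t)) setT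
    (fun t : I => s (0, ui_val t)).
  apply: (edgeF (fun t => (0, ui_val t))) => [|t|t] /=;
    [by continuity|exact: (conj in0 (in1 t))|].
  by rewrite clampK clamp0 (He t).1 gwalk_zero.
have right_side : flat_on (fun t => same_sheet (cst (Xr_vertex R r w) t)) setT
    (fun t : I => s (1, ui_val t)).
  apply: (edgeF (fun t => (1, ui_val t))) => [|t|t] /=;
    [by continuity|exact: (conj in1' (in1 t))|].
  by rewrite clampK clamp1 (He t).2 gwalk_one.
have cstT a : transports (cst (Xr_vertex R r (foot a))) (inl a) (inl a).
  by apply: transports_valid => [|u]; [exact: cst_cont|exact: vertex_valid].
have s00 : same_sheet (Xr_vertex R r v0) (s (0, 0)) (inl (lift_end (gpath_id v0))).
  by move: s0; rewrite /E /= clamp0 H00.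
have b := transports_gwalk bottom; rewrite /= ui_val0 ui_val1 gwalk_zero gwalk_one in b.
have l := cstT (lift_end (gpath_id v0)) _ left_side; rewrite /= ui_val0 ui_val1 in l.
have t := transports_gwalk top; rewrite /= ui_val0 ui_val1 gwalk_zero gwalk_one in t.
have rr := cstT (lift_end p) _ right_side; rewrite /= ui_val0 ui_val1 in rr.
have [_ _ [//|pq]] := same_sheet_trans (same_sheet_sym (rr (b s00))) (t (l s00)).
by case: (foot_adj pq).
Qed.

End sheets.

Theorem theorem3p2 (R : realType) (r : nat) (G : graph) (v : G)
    (r_gt0 : (0 < r)%N) (simpleG : simple_graph G) :
  group_isomorphic (rpi1 r v) (pi1 R (Xr_vertex R r v)).
Proof.
pose F (p : gpath v v) : upath R (Xr_vertex R r v) (Xr_vertex R r v) :=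
  mk_path (@gwalk_continuous R r G v v p) (gwalk_zero p) (gwalk_one p).
pose phi (a : rpi1 r v) : pi1 R (Xr_vertex R r v) := pi1_class (F (repr a)).
have phiE p : phi (rpi1_class r p) = pi1_class (F p).
  apply/pi1_classP/homotopicE/gwalk_equiv.
  by apply/(rpi1_classP r); rewrite /rpi1_class reprK.
have classK (a : rpi1 r v) : rpi1_class r (repr a) = a by exact: reprK.
have phiM : {morph phi : a b / (a * b)%g}.
  move=> a b; rewrite -(classK a) -(classK b) rpi1_mulE !phiE pi1_mulE.
  apply/pi1_classP/homotopicE; exact: gwalk_cat.
have phi_inj : injective phi.
  move=> a b; rewrite -(classK a) -(classK b) !phiE => /pi1_classP/homotopicE pq.
  by apply/(rpi1_classP r)/lift_end_eq/(homotopic_lift_end simpleG pq).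
have phi_surj z : exists a, phi a = z.
  pose f := repr z.
  have [p pE] := homotopic_gwalk simpleG (@cts_fun _ _ f) path_zero path_one.
  exists (rpi1_class r p); rewrite phiE -[z]reprK.
  by apply/pi1_classP/homotopicE/homotopic_sym.
pose mixin := isMultiplicative.Build _ _ phi phiM.
pose psi : {multiplicative rpi1 r v -> pi1 R (Xr_vertex R r v)} := HB.pack phi mixin.
exists psi.
exists (fun z => sval (cid (phi_surj z))) => [a|z] /=.
  by apply: phi_inj; case: cid.
by case: cid.
Qed.
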